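(* Let $s$ be a complex number with $\sigma:=\operatorname{Re}(s)>0$, and let $\psi:(0,\infty)\to\mathbb{C}$ be a real-analytic function satisfying $$\psi(x)=\psi(x+1)+(x+1)^{-2s}\psi\Big(\frac{x}{x+1}\Big)\qquad(x>0)$$ and $$\psi(x)=o\big(x^{-\min(2\sigma,1)}\big)\ \text{as } x\to0^+,\qquad \psi(x)=o\big(x^{\min(0,1-2\sigma)}\big)\ \text{as } x\to\infty.$$ Then $\psi$ extends to a holomorphic function on $\mathbb{C}'=\mathbb{C}\setminus(-\infty,0]$ which satisfies the growth conditions $$\psi(z)\ll\begin{cases}|z|^{-2\sigma}&\text{if }\operatorname{Re}(z)\ge0,\ |z|\ge1,\\ 1&\text{if }\operatorname{Re}(z)\ge0,\ |z|\le1,\\ |\operatorname{Im}(z)|^{-\sigma}&\text{if }\operatorname{Re}(z)<0.\end{cases}$$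
   Context: Powers such as $(x+1)^{-2s}$ are taken with the principal branch. $F\ll G$ means $|F|\le C\,G$ for a constant $C$ (depending on $\psi$ and $s$ but not on $z$). *)

(* Defs.v *)
From Stdlib Require Export Reals.
From Coquelicot Require Export Coquelicot.
Open Scope R_scope.

Definition Cexp (z : C) : C := (exp (Re z) * cos (Im z), exp (Re z) * sin (Im z)).

(* Principal value of x ^ w for a real base x > 0, where the principal
   logarithm is the real one; a junk value for x <= 0. *)
Definition Cpower_pos (x : R) (w : C) : C := Cexp (w * RtoC (ln x)).

(* [D] is meant to be open; values of [f] outside [D] are then irrelevant,
   since the radius [r] may be taken small. *)
Definition real_analytic_on (D : R -> Prop) (f : R -> C) : Prop :=
  forall x0 : R, D x0 ->
    exists (a : nat -> C) (r : R), 0 < r /\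
      forall x : R, Rabs (x - x0) < r ->
        @is_pseries R_AbsRing C_R_NormedModule a (x - x0) (f x).

(* C \ (-oo, 0] *)
Definition slit_plane (z : C) : Prop := ~ (Im z = 0 /\ Re z <= 0).

(* [D] is meant to be open, so that [f] is a total function whose values
   outside [D] are irrelevant. *)
Definition holomorphic_on (D : C -> Prop) (f : C -> C) : Prop :=
  forall z : C, D z -> @ex_derive C_AbsRing C_NormedModule f z.

(* psi = o(g) along the filter F, for a complex-valued psi and a real gauge g.
   Note the argument order of [is_domin]: the gauge comes first. *)
Definition little_o (F : (R -> Prop) -> Prop) (psi : R -> C) (g : R -> R) : Prop :=
  @is_domin R R_AbsRing R_AbsRing R_NormedModule C_R_NormedModule F g psi.

(* Main.v *)
From Stdlib Require Import Znat Lra Lia ClassicalEpsilon Classical.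
Require Import Defs.

(** Iterating the three-term equation gives
    [psi x = psi (x+N) + sum_(n=1..N) (x+n)^(-2s) psi (1 - 1/(x+n))].  The growth
    condition at infinity forces first [psi 1 = 0] and then, as [N] tends to
    infinity, a series that converges in a half-plane [Re z > R1] and is
    [O(|z|^(-2 sigma))] there.  Since [x^(-2s) psi (1/x)] solves the same equation,
    the same holds near [0]; with a compactness argument in between, [psi]
    extends to a wedge [|Im z| < k Re z].  Every point of the slit plane is sent
    into this wedge by all sufficiently long words in [z -> z+1] and
    [z -> z/(z+1)], so unfolding the equation extends [psi] to the slit plane.
    The bounds for [Re z >= 0] follow from the half-plane bound by finitely many
    applications of the equation.  For [Re z < 0], the function
    [f z = psi z + z^(-2s) psi (-1/z)] is periodic, and moving [z] up by
    [z -> -1/z] and integer translations shows that [(Im z)^sigma |f z|] is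
    bounded. *)

(** * Complex differentiability *)

(** The terms of the iterated sum are a priori only O(n^(-2 sigma)), which is not summable when 2
    sigma <= 1; [psi 1 = 0] gains the factor 1/n that makes the series converge and, by telescoping,
    decay like |z|^(-2 sigma). For Re z < 0 the equation alone does not help: the number of
    unfoldings needed grows without bound near the negative axis, and each costs a constant. The
    weight (Im z)^sigma is the remedy, because z -> -1/z divides Im z by |z|^2 while |z^(-2s)| is
    |z|^(-2 sigma) up to exp(2 Im(s) arg z). That factor is harmless for non-real s too: the
    argument can be measured at whichever of z and -1/z lies in the right half-plane, where it is at
    most 2 Im z / |z|, and these ratios have a bounded sum along the orbit. Identities of powers and
    of local continuations are transported from the real axis by an identity theorem on star-shaped
    domains, so no branch is followed by hand. The complex analysis rests on Cauchy's formula for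
    circles, obtained by differentiating under the integral sign while the circle shrinks to a
    point. *)

Definition disc (c : C) (r : R) (z : C) : Prop := Cmod (z - c) < r.

Definition nbhd (z : C) (P : C -> Prop) : Prop :=
  exists d : R, 0 < d /\ forall w : C, disc z d w -> P w.

(** Stated for an arbitrary filter so that one set of limit rules serves continuity at a point
    ([nbhd]), convergence of series ([eventually]) and joint continuity in two real parameters
    ([locally]). *)
Definition ctends {X : Type} (F : (X -> Prop) -> Prop) (f : X -> C) (l : C) : Prop :=
  forall eps : R, 0 < eps -> F (fun x => Cmod (f x - l) < eps).

Definition ccont (f : C -> C) (z : C) : Prop := ctends (nbhd z) f (f z).

(* Caratheodory's form of the derivative: the difference quotient [q] is
   continuous at [z]. *)
Definition cderiv (f : C -> C) (z l : C) : Prop :=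
  exists q : C -> C, q z = l /\ ccont q z /\
    nbhd z (fun w => (f w - f z)%C = (q w * (w - z))%C).

(* Continuity of the derivative is part of the definition: it makes Goursat's
   lemma unnecessary. *)
Definition hol (f : C -> C) (z : C) : Prop :=
  exists f' : C -> C, nbhd z (fun w => cderiv f w (f' w) /\ ccont f' w).

Lemma Cmod_minus_sym (a b : C) : Cmod (a - b) = Cmod (b - a).
Proof. rewrite <- Cmod_opp. f_equal. ring. Qed.

Lemma disc_center (z : C) (r : R) : 0 < r -> disc z r z.
Proof.
  intros Hr. unfold disc. replace (z - z)%C with (RtoC 0) by ring.
  now rewrite Cmod_0.
Qed.

Lemma Cmod_triangle3 (a b c : C) : Cmod (a - c) <= Cmod (a - b) + Cmod (b - c).
Proof.
  replace (a - c)%C with ((a - b) + (b - c))%C by ring. apply Cmod_triangle.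
Qed.

Lemma Cmod_rev_triangle (a b : C) : Cmod a - Cmod b <= Cmod (a - b).
Proof.
  generalize (Cmod_triangle (a - b) b).
  replace (a - b + b)%C with a by ring. lra.
Qed.

Lemma nbhd_open_disc (z c : C) (r : R) : disc c r z -> nbhd z (disc c r).
Proof.
  intros H. exists (r - Cmod (z - c)). split; [unfold disc in H; lra|].
  intros w Hw. unfold disc in *. generalize (Cmod_triangle3 w z c). lra.
Qed.

#[global] Instance nbhd_filter (z : C) : ProperFilter (nbhd z).
Proof.
  split.
  - intros P [d [Hd H]]. exists z. apply H. now apply disc_center.
  - split.
    + exists 1. split; [lra|auto].
    + intros P Q [d [Hd H]] [e [He K]]. exists (Rmin d e). split.
      { now apply Rmin_glb_lt. }
      intros w Hw. unfold disc in *. split.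
      * apply H. unfold disc. eapply Rlt_le_trans; [exact Hw|apply Rmin_l].
      * apply K. unfold disc. eapply Rlt_le_trans; [exact Hw|apply Rmin_r].
    + intros P Q HPQ [d [Hd H]]. exists d. split; auto.
Qed.

Lemma nbhd_self (z : C) (P : C -> Prop) : nbhd z P -> P z.
Proof. intros [d [Hd H]]. apply H. now apply disc_center. Qed.

Lemma nbhd_nbhd (z : C) (P : C -> Prop) : nbhd z P -> nbhd z (fun w => nbhd w P).
Proof.
  intros [d [Hd H]]. exists d. split; auto. intros w Hw.
  destruct (nbhd_open_disc _ _ _ Hw) as [e [He K]]. exists e. split; auto.
Qed.

Section Tends.
Context {X : Type} (F : (X -> Prop) -> Prop) {FF : Filter F}.

Lemma ctends_const (l : C) : ctends F (fun _ => l) l.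
Proof.
  intros e He. apply filter_forall. intros _.
  replace (l - l)%C with (RtoC 0) by ring. now rewrite Cmod_0.
Qed.

Lemma ctends_ext (f g : X -> C) (l : C) :
  F (fun x => f x = g x) -> ctends F f l -> ctends F g l.
Proof.
  intros H Hf e He. generalize (filter_and _ _ H (Hf e He)).
  apply filter_imp. intros x [E K]. now rewrite <- E.
Qed.

Lemma ctends_plus (f g : X -> C) (a b : C) :
  ctends F f a -> ctends F g b -> ctends F (fun x => f x + g x)%C (a + b)%C.
Proof.
  intros Hf Hg e He.
  assert (He2 : 0 < e / 2) by lra.
  generalize (filter_and _ _ (Hf _ He2) (Hg _ He2)). apply filter_imp.
  intros x [H1 H2].
  replace (f x + g x - (a + b))%C with ((f x - a) + (g x - b))%C by ring.
  eapply Rle_lt_trans; [apply Cmod_triangle|]. lra.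
Qed.

Lemma ctends_bound (f : X -> C) (a : C) :
  ctends F f a -> F (fun x => Cmod (f x) <= Cmod a + 1).
Proof.
  intros Hf. generalize (Hf 1 Rlt_0_1). apply filter_imp. intros x H.
  generalize (Cmod_rev_triangle (f x) a). lra.
Qed.

Lemma ctends_mult (f g : X -> C) (a b : C) :
  ctends F f a -> ctends F g b -> ctends F (fun x => f x * g x)%C (a * b)%C.
Proof.
  intros Hf Hg e He.
  set (M := Cmod a + Cmod b + 1).
  assert (HM : 0 < M) by (unfold M; generalize (Cmod_ge_0 a) (Cmod_ge_0 b); lra).
  assert (He2 : 0 < e / (2 * M)) by (apply Rdiv_lt_0_compat; lra).
  generalize (filter_and _ _ (ctends_bound f a Hf)
    (filter_and _ _ (Hf _ He2) (Hg _ He2))). apply filter_imp.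
  intros x [H0 [H1 H2]].
  replace (f x * g x - a * b)%C with (f x * (g x - b) + (f x - a) * b)%C by ring.
  eapply Rle_lt_trans; [apply Cmod_triangle|]. rewrite !Cmod_mult.
  assert (Cmod (f x) * Cmod (g x - b) <= M * Cmod (g x - b)).
  { apply Rmult_le_compat_r; [apply Cmod_ge_0|].
    unfold M; generalize (Cmod_ge_0 b); lra. }
  assert (Cmod (f x - a) * Cmod b <= Cmod (f x - a) * M).
  { apply Rmult_le_compat_l; [apply Cmod_ge_0|].
    unfold M; generalize (Cmod_ge_0 a); lra. }
  assert (e = M * (e / (2 * M)) + (e / (2 * M)) * M) by (field; lra).
  nra.
Qed.

Lemma ctends_comp (f : X -> C) (g : C -> C) (a : C) :
  ctends F f a -> ccont g a -> ctends F (fun x => g (f x)) (g a).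
Proof.
  intros Hf Hg e He. destruct (Hg e He) as [d [Hd H]].
  generalize (Hf d Hd). apply filter_imp. intros x Hx. apply H. exact Hx.
Qed.

Lemma ctends_minus (f g : X -> C) (a b : C) :
  ctends F f a -> ctends F g b -> ctends F (fun x => f x - g x)%C (a - b)%C.
Proof.
  intros Hf Hg. replace (a - b)%C with (a + RtoC (-1) * b)%C by ring.
  apply (ctends_ext (fun x => f x + RtoC (-1) * g x)%C).
  - apply filter_forall. intros. ring.
  - apply ctends_plus; auto. apply ctends_mult; auto. apply ctends_const.
Qed.

End Tends.

Lemma ccont_id (z : C) : ccont (fun w => w) z.
Proof. intros e He. exists e. split; auto. Qed.

Lemma ccont_const (c z : C) : ccont (fun _ => c) z.
Proof. apply (ctends_const (nbhd z)). Qed.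

Lemma ccont_plus (f g : C -> C) (z : C) :
  ccont f z -> ccont g z -> ccont (fun w => f w + g w)%C z.
Proof. apply (ctends_plus (nbhd z)). Qed.

Lemma ccont_mult (f g : C -> C) (z : C) :
  ccont f z -> ccont g z -> ccont (fun w => f w * g w)%C z.
Proof. apply (ctends_mult (nbhd z)). Qed.

Lemma ccont_comp (f g : C -> C) (z : C) :
  ccont g z -> ccont f (g z) -> ccont (fun w => f (g w)) z.
Proof. apply (ctends_comp (nbhd z)). Qed.

Lemma ccont_ext (f g : C -> C) (z : C) :
  nbhd z (fun w => f w = g w) -> ccont f z -> ccont g z.
Proof.
  intros H Hf. unfold ccont. rewrite <- (nbhd_self _ _ H).
  now apply (ctends_ext (nbhd z) f g).
Qed.

Lemma nbhd_neq (z c : C) : z <> c -> nbhd z (fun w => w <> c).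
Proof.
  intros H. exists (Cmod (z - c)). split.
  - apply Cmod_gt_0. now apply Cminus_eq_contra.
  - intros w Hw E. subst w. unfold disc in Hw. rewrite Cmod_minus_sym in Hw. lra.
Qed.

Lemma ccont_inv (z : C) : z <> 0 -> ccont Cinv z.
Proof.
  intros Hz e He.
  assert (Hm : 0 < Cmod z) by now apply Cmod_gt_0.
  set (m := Cmod z) in *.
  exists (Rmin (m / 2) (e * (m * m / 2))). split.
  { apply Rmin_glb_lt; [lra|]. apply Rmult_lt_0_compat; nra. }
  intros w Hw. unfold disc in Hw.
  assert (H1 := Rlt_le_trans _ _ _ Hw (Rmin_l _ _)).
  assert (H2 := Rlt_le_trans _ _ _ Hw (Rmin_r _ _)).
  assert (Hw2 : m / 2 < Cmod w).
  { generalize (Cmod_rev_triangle z w). rewrite Cmod_minus_sym. fold m. lra. }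
  assert (Hw0 : w <> 0) by (apply Cmod_gt_0; lra).
  replace (/ w - / z)%C with ((z - w) / (w * z))%C by (field; auto).
  rewrite Cmod_div by now apply Cmult_neq_0.
  rewrite Cmod_mult, Cmod_minus_sym. fold m.
  apply Rlt_div_l; [apply Rmult_gt_0_compat; lra|].
  eapply Rlt_le_trans; [exact H2|]. apply Rmult_le_compat_l; nra.
Qed.

Lemma cderiv_cont (f : C -> C) (z l : C) : cderiv f z l -> ccont f z.
Proof.
  intros [q [Hq [Cq H]]].
  apply (ccont_ext (fun w => f z + q w * (w + - z))%C).
  - revert H. apply filter_imp. intros w E.
    replace (f w) with (f z + (f w - f z))%C by ring. rewrite E. ring.
  - apply ccont_plus; [apply ccont_const|]. apply ccont_mult; auto.
    apply ccont_plus; [apply ccont_id|apply ccont_const].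
Qed.

Lemma cderiv_const (c z : C) : cderiv (fun _ => c) z 0.
Proof.
  exists (fun _ => RtoC 0). repeat split; [apply ccont_const|].
  apply filter_forall. intros. ring.
Qed.

Lemma cderiv_id (z : C) : cderiv (fun w => w) z 1.
Proof.
  exists (fun _ => RtoC 1). repeat split; [apply ccont_const|].
  apply filter_forall. intros. ring.
Qed.

Lemma cderiv_plus (f g : C -> C) (z a b : C) :
  cderiv f z a -> cderiv g z b -> cderiv (fun w => f w + g w)%C z (a + b)%C.
Proof.
  intros [p [Hp [Cp Ep]]] [q [Hq [Cq Eq]]].
  exists (fun w => p w + q w)%C. split; [now rewrite Hp, Hq|].
  split; [now apply ccont_plus|].
  generalize (filter_and _ _ Ep Eq). apply filter_imp. intros w [H1 H2].
  replace (f w + g w - (f z + g z))%C with ((f w - f z) + (g w - g z))%C by ring.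
  rewrite H1, H2. ring.
Qed.

Lemma cderiv_mult (f g : C -> C) (z a b : C) :
  cderiv f z a -> cderiv g z b ->
  cderiv (fun w => f w * g w)%C z (a * g z + f z * b)%C.
Proof.
  intros Hf Hg. assert (Cg := cderiv_cont _ _ _ Hg).
  destruct Hf as [p [Hp [Cp Ep]]], Hg as [q [Hq [Cq Eq]]].
  exists (fun w => p w * g w + f z * q w)%C. split; [now rewrite Hp, Hq|].
  split.
  { apply ccont_plus; apply ccont_mult; auto. apply ccont_const. }
  generalize (filter_and _ _ Ep Eq). apply filter_imp. intros w [H1 H2].
  replace (f w * g w - f z * g z)%C
    with ((f w - f z) * g w + f z * (g w - g z))%C by ring.
  rewrite H1, H2. ring.
Qed.

Lemma nbhd_comp (g : C -> C) (z : C) (P : C -> Prop) :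
  ccont g z -> nbhd (g z) P -> nbhd z (fun w => P (g w)).
Proof.
  intros Cg [d [Hd H]]. generalize (Cg d Hd). apply filter_imp. auto.
Qed.

Lemma cderiv_comp (f g : C -> C) (z a b : C) :
  cderiv g z b -> cderiv f (g z) a -> cderiv (fun w => f (g w)) z (a * b)%C.
Proof.
  intros Hg [p [Hp [Cp Ep]]]. assert (Cg := cderiv_cont _ _ _ Hg).
  destruct Hg as [q [Hq [Cq Eq]]].
  exists (fun w => p (g w) * q w)%C. split; [now rewrite Hp, Hq|].
  split.
  { apply ccont_mult; auto. now apply ccont_comp. }
  generalize (filter_and _ _ (nbhd_comp _ _ _ Cg Ep) Eq). apply filter_imp.
  intros w [H1 H2]. rewrite H1, H2. ring.
Qed.

Lemma cderiv_ext (f g : C -> C) (z l : C) :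
  nbhd z (fun w => f w = g w) -> cderiv f z l -> cderiv g z l.
Proof.
  intros H [q [Hq [Cq E]]]. exists q. split; [auto|split; [auto|]].
  rewrite <- (nbhd_self _ _ H).
  generalize (filter_and _ _ H E). apply filter_imp. intros w [H1 H2].
  now rewrite <- H1.
Qed.

Lemma cderiv_inv (z : C) : z <> 0 -> cderiv Cinv z (- / (z * z))%C.
Proof.
  intros Hz. exists (fun w => - / (w * z))%C. split; [auto|]. split.
  - apply (ccont_ext (fun w => (- / z) * / w)%C).
    + generalize (nbhd_neq _ _ Hz). apply filter_imp. intros w Hw. field. auto.
    + apply ccont_mult; [apply ccont_const|now apply ccont_inv].
  - generalize (nbhd_neq _ _ Hz). apply filter_imp. intros w Hw. field. auto.
Qed.

(** Both quotients equal the same difference quotient off [z] and are continuous at [z]; one nearby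
    point at a real displacement suffices for the comparison. *)
Lemma cderiv_unique (f : C -> C) (z a b : C) : cderiv f z a -> cderiv f z b -> a = b.
Proof.
  intros [p [Hp [Cp Ep]]] [q [Hq [Cq Eq]]]. subst a b.
  apply Ceq_minus. apply Cmod_eq_0.
  destruct (Req_dec (Cmod (p z - q z)) 0) as [|N]; auto. exfalso.
  assert (He : 0 < Cmod (p z - q z) / 2) by (generalize (Cmod_ge_0 (p z - q z)); lra).
  destruct (filter_and _ _ (filter_and _ _ Ep Eq)
    (filter_and _ _ (Cp _ He) (Cq _ He))) as [d [Hd H]].
  set (w := (z + RtoC (d / 2))%C).
  assert (Hwz : (w - z)%C = RtoC (d / 2)) by (unfold w; ring).
  assert (Hw : disc z d w).
  { unfold disc. rewrite Hwz, Cmod_R, Rabs_pos_eq; lra. }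
  destruct (H w Hw) as [[H1 H2] [H3 H4]].
  assert (E : p w = q w).
  { rewrite H1, Hwz in H2.
    assert (N0 : RtoC (d / 2) <> 0) by (intros E; apply RtoC_inj in E; lra).
    apply (f_equal (fun c => c * / RtoC (d / 2))%C) in H2.
    rewrite <- !Cmult_assoc, !Cinv_r, !Cmult_1_r in H2; auto. }
  rewrite E in H3.
  generalize (Cmod_triangle3 (p z) (q w) (q z)). rewrite (Cmod_minus_sym (p z) (q w)). lra.
Qed.

Lemma hol_ext (f g : C -> C) (z : C) :
  nbhd z (fun w => f w = g w) -> hol f z -> hol g z.
Proof.
  intros H [f' Hf]. exists f'.
  generalize (filter_and _ _ (nbhd_nbhd _ _ H) Hf). apply filter_imp.
  intros w [H1 [H2 H3]]. split; auto. eapply cderiv_ext; eauto.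
Qed.

Lemma hol_cont (f : C -> C) (z : C) : hol f z -> ccont f z.
Proof.
  intros [f' H]. destruct (nbhd_self _ _ H) as [H1 _].
  eapply cderiv_cont; eauto.
Qed.

Lemma hol_const (c z : C) : hol (fun _ => c) z.
Proof.
  exists (fun _ => RtoC 0). apply filter_forall. intros w. split.
  - apply cderiv_const.
  - apply ccont_const.
Qed.

Lemma hol_id (z : C) : hol (fun w => w) z.
Proof.
  exists (fun _ => RtoC 1). apply filter_forall. intros w. split.
  - apply cderiv_id.
  - apply ccont_const.
Qed.

Lemma hol_plus (f g : C -> C) (z : C) :
  hol f z -> hol g z -> hol (fun w => f w + g w)%C z.
Proof.
  intros [f' Hf] [g' Hg]. exists (fun w => f' w + g' w)%C.
  generalize (filter_and _ _ Hf Hg). apply filter_imp.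
  intros w [[H1 H2] [H3 H4]]. split; [now apply cderiv_plus|now apply ccont_plus].
Qed.

Lemma hol_mult (f g : C -> C) (z : C) :
  hol f z -> hol g z -> hol (fun w => f w * g w)%C z.
Proof.
  intros [f' Hf] [g' Hg]. exists (fun w => f' w * g w + f w * g' w)%C.
  generalize (filter_and _ _ Hf Hg). apply filter_imp.
  intros w [[H1 H2] [H3 H4]]. split; [now apply cderiv_mult|].
  apply cderiv_cont in H1 as H5. apply cderiv_cont in H3 as H6.
  apply ccont_plus; now apply ccont_mult.
Qed.

Lemma hol_opp (f : C -> C) (z : C) : hol f z -> hol (fun w => - f w)%C z.
Proof.
  intros H. apply (hol_ext (fun w => RtoC (-1) * f w)%C).
  - apply filter_forall. intros w.
    ring.
  - apply hol_mult; auto. apply hol_const.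
Qed.

Lemma hol_minus (f g : C -> C) (z : C) :
  hol f z -> hol g z -> hol (fun w => f w - g w)%C z.
Proof. intros H K. apply hol_plus; auto. now apply hol_opp. Qed.

Lemma hol_comp (f g : C -> C) (z : C) :
  hol g z -> hol f (g z) -> hol (fun w => f (g w)) z.
Proof.
  intros Hg [f' Hf]. assert (Cg := hol_cont _ _ Hg). destruct Hg as [g' Hg].
  exists (fun w => f' (g w) * g' w)%C.
  generalize (filter_and _ _ (nbhd_comp _ _ _ Cg Hf) Hg). apply filter_imp.
  intros w [[H1 H2] [H3 H4]]. split; [now apply cderiv_comp|].
  apply ccont_mult; auto. apply ccont_comp; auto. eapply cderiv_cont; eauto.
Qed.

Lemma hol_inv (z : C) : z <> 0 -> hol Cinv z.
Proof.
  intros Hz. exists (fun w => - / (w * w))%C.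
  generalize (nbhd_neq _ _ Hz). apply filter_imp. intros w Hw. split.
  - now apply cderiv_inv.
  - apply (ccont_ext (fun w => RtoC (-1) * (/ w * / w))%C).
    + generalize (nbhd_neq _ _ Hw). apply filter_imp. intros v Hv.
      field. auto.
    + apply ccont_mult; [apply ccont_const|].
      apply ccont_mult; now apply ccont_inv.
Qed.

Lemma hol_div (f g : C -> C) (z : C) :
  hol f z -> hol g z -> g z <> 0 -> hol (fun w => f w / g w)%C z.
Proof.
  intros Hf Hg N. apply hol_mult; auto. apply (hol_comp Cinv); auto.
  now apply hol_inv.
Qed.

(** [hol] only provides a derivative function near each point. By uniqueness of the derivative, one
    global choice agrees with all the local ones and inherits their continuity. *)
Lemma hol_derivative (U : C -> Prop) (f : C -> C) :
  (forall z, U z -> hol f z) ->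
  exists f' : C -> C, forall z, U z -> cderiv f z (f' z) /\ ccont f' z.
Proof.
  intros H.
  exists (fun z => epsilon (inhabits (RtoC 0)) (fun l => cderiv f z l)).
  intros z Hz. destruct (H z Hz) as [g Hg].
  assert (E : nbhd z (fun w =>
    g w = epsilon (inhabits (RtoC 0)) (fun l => cderiv f w l))).
  { revert Hg. apply filter_imp. intros w [Hw _].
    apply (cderiv_unique f w); auto. apply epsilon_spec. now exists (g w). }
  destruct (nbhd_self _ _ Hg) as [H1 H2].
  split.
  - now rewrite <- (nbhd_self _ _ E).
  - eapply ccont_ext; [exact E|exact H2].
Qed.

(** * Exponential, principal logarithm and powers *)

Lemma Cmod_le_Rabs (z : C) : Cmod z <= Rabs (Re z) + Rabs (Im z).
Proof.
  replace z with (RtoC (Re z) + Ci * RtoC (Im z))%C at 1.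
  - eapply Rle_trans; [apply Cmod_triangle|].
    rewrite Cmod_mult, Cmod_Ci, !Cmod_R. lra.
  - destruct z as [x y]. unfold RtoC, Ci, Cmult, Cplus; simpl. f_equal; ring.
Qed.

Lemma Rabs_Re_le (z : C) : Rabs (Re z) <= Cmod z.
Proof. apply re_le_Cmod. Qed.

Lemma Rabs_Im_le (z : C) : Rabs (Im z) <= Cmod z.
Proof. eapply Rle_trans; [|apply Rmax_Cmod]. apply Rmax_r. Qed.

Lemma Cmod_sqr (z : C) : Cmod z * Cmod z = Re z * Re z + Im z * Im z.
Proof. generalize (Cmod2_alt z). simpl. lra. Qed.

Lemma C_ext (a b : C) : Re a = Re b -> Im a = Im b -> a = b.
Proof. destruct a, b; simpl; congruence. Qed.

(** A quadratic remainder makes the difference quotient, completed by [l] at [z], continuous there.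
    The exponential, the logarithm and sums of series get their derivatives this way. *)
Lemma cderiv_of_quadratic (f : C -> C) (z l : C) (M : R) :
  nbhd z (fun w => Cmod (f w - f z - l * (w - z)) <= M * (Cmod (w - z) * Cmod (w - z))) ->
  cderiv f z l.
Proof.
  intros [d [Hd H]].
  exists (fun w => if excluded_middle_informative (w = z) then l
                   else ((f w - f z) / (w - z))%C).
  destruct (excluded_middle_informative (z = z)) as [_|N]; [|congruence].
  split; [reflexivity|]. split.
  - intros e He. set (N := Rabs M + 1).
    assert (HN : 0 < N) by (unfold N; generalize (Rabs_pos M); lra).
    exists (Rmin d (e / N)). split.
    { apply Rmin_glb_lt; [auto|now apply Rdiv_lt_0_compat]. }
    intros w Hw.
    destruct (excluded_middle_informative (z = z)) as [_|]; [|congruence].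
    destruct (excluded_middle_informative (w = z)) as [E|E].
    { replace (l - l)%C with (RtoC 0) by ring. now rewrite Cmod_0. }
    assert (Hne : (w - z)%C <> 0) by now apply Cminus_eq_contra.
    assert (H1 := Rlt_le_trans _ _ _ Hw (Rmin_l _ _)).
    assert (H2 := Rlt_le_trans _ _ _ Hw (Rmin_r _ _)).
    specialize (H w H1).
    replace ((f w - f z) / (w - z) - l)%C
      with ((f w - f z - l * (w - z)) / (w - z))%C by (field; auto).
    rewrite Cmod_div by auto.
    assert (Hp : 0 < Cmod (w - z)) by now apply Cmod_gt_0.
    apply Rlt_div_l; auto. eapply Rle_lt_trans; [exact H|].
    apply Rlt_div_r in H2; auto.
    assert (M <= N) by (unfold N; generalize (Rle_abs M); lra). nra.
  - apply filter_forall. intros w.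
    destruct (excluded_middle_informative (w = z)) as [E|E].
    + subst. ring.
    + field. now apply Cminus_eq_contra.
Qed.

Lemma Cexp_plus (a b : C) : Cexp (a + b) = (Cexp a * Cexp b)%C.
Proof.
  unfold Cexp. destruct a as [a1 a2], b as [b1 b2]. unfold Cplus, Cmult; simpl.
  rewrite exp_plus, cos_plus, sin_plus. f_equal; ring.
Qed.

Lemma Cexp_0 : Cexp 0 = 1.
Proof. apply C_ext; simpl; rewrite exp_0, ?cos_0, ?sin_0; ring. Qed.

Lemma Cexp_neq_0 (a : C) : Cexp a <> 0.
Proof.
  intros H. assert (K := Cexp_plus a (- a)). rewrite H in K.
  replace (a + - a)%C with (RtoC 0) in K by ring. rewrite Cexp_0 in K.
  rewrite Cmult_0_l in K. apply RtoC_inj in K. lra.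
Qed.

Lemma Cmod_Cexp (a : C) : Cmod (Cexp a) = exp (Re a).
Proof.
  apply Rsqr_inj; [apply Cmod_ge_0|left; apply exp_pos|].
  unfold Rsqr. rewrite Cmod_sqr. unfold Cexp; simpl.
  generalize (sin2_cos2 (Im a)). unfold Rsqr. intros E.
  transitivity (exp (Re a) * exp (Re a) *
    (sin (Im a) * sin (Im a) + cos (Im a) * cos (Im a))); [ring|rewrite E; ring].
Qed.

Lemma exp_quadratic (x : R) : Rabs x <= 1 -> Rabs (exp x - 1 - x) <= 3 * (x * x).
Proof.
  intros Hx. apply Rabs_le_between in Hx.
  assert (L : 1 + x <= exp x) by (generalize (exp_ineq1_le x); lra).
  rewrite Rabs_pos_eq by lra.
  assert (L2 : 1 - x / 2 <= exp (- x / 2)) by (generalize (exp_ineq1_le (- x / 2)); lra).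
  (* exp x = 1 / (exp (-x/2))^2 <= 1 / (1 - x/2)^2 *)
  assert (E : exp (- x / 2) * exp (- x / 2) * exp x = 1).
  { rewrite <- !exp_plus. rewrite <- exp_0. f_equal. lra. }
  assert (P := exp_pos x).
  assert (K : (1 - x / 2) * (1 - x / 2) * exp x <= 1).
  { rewrite <- E. apply Rmult_le_compat_r; [lra|]. apply Rmult_le_compat; lra. }
  assert (K2 : exp x <= 1 + x + 3 * (x * x)); [|lra].
  apply Rmult_le_reg_l with ((1 - x / 2) * (1 - x / 2)); [nra|].
  eapply Rle_trans; [exact K|].
  (* The product here is (1 - x/2)^2 (1 + x + 3 x^2) - 1, and its last factor is positive for |x| <=
     1. *)
  assert (0 <= x * x * (2.25 - 2.75 * x + 0.75 * x * x)); [|nra].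
  apply Rmult_le_pos; nra.
Qed.

Lemma Rabs_sin_le (x : R) : Rabs (sin x) <= Rabs x.
Proof.
  destruct (MVT_abs sin cos 0 x) as [c [H _]].
  { intros c _. apply derivable_pt_lim_sin. }
  rewrite sin_0, !Rminus_0_r in H. rewrite H.
  assert (Rabs (cos c) <= 1) by (apply Rabs_le; generalize (COS_bound c); lra).
  generalize (Rabs_pos x). nra.
Qed.

Lemma cos_quadratic (x : R) : Rabs (cos x - 1) <= x * x.
Proof.
  replace x with (2 * (x / 2)) at 1 by field. rewrite cos_2a_sin.
  replace (1 - 2 * sin (x / 2) * sin (x / 2) - 1)
    with (- (2 * (sin (x / 2) * sin (x / 2)))) by ring.
  rewrite Rabs_Ropp, Rabs_mult, (Rabs_mult (sin _)), (Rabs_pos_eq 2) by lra.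
  generalize (Rabs_sin_le (x / 2)) (Rabs_pos (sin (x / 2))). intros H1 H2.
  assert (Rabs (x / 2) * Rabs (x / 2) = x * x / 4).
  { rewrite <- Rabs_mult, Rabs_pos_eq; nra. }
  nra.
Qed.

Lemma sin_quadratic (x : R) : Rabs x <= 1 -> Rabs (sin x - x) <= x * x.
Proof.
  intros Hx.
  destruct (MVT_abs (fun t => sin t - t) (fun t => cos t - 1) 0 x) as [c [H Hc]].
  { intros c _. apply (derivable_pt_lim_minus sin id).
    - apply derivable_pt_lim_sin.
    - apply derivable_pt_lim_id. }
  rewrite sin_0, !Rminus_0_r in H. rewrite H.
  assert (Rabs c <= Rabs x).
  { unfold Rmin, Rmax in Hc. destruct (Rle_dec 0 x).
    - rewrite !Rabs_pos_eq; lra.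
    - rewrite !Rabs_left1; lra. }
  generalize (cos_quadratic c) (Rabs_pos c) (Rabs_pos (cos c - 1)). intros.
  assert (c * c = Rabs c * Rabs c) by (rewrite <- Rabs_mult, Rabs_pos_eq; nra).
  assert (x * x = Rabs x * Rabs x) by (rewrite <- Rabs_mult, Rabs_pos_eq; nra).
  assert (Rabs (cos c - 1) <= Rabs x) by nra.
  nra.
Qed.

Lemma Cexp_quadratic (h : C) :
  Cmod h <= 1 -> Cmod (Cexp h - 1 - h) <= 16 * (Cmod h * Cmod h).
Proof.
  intros Hh. assert (Ha := Rabs_Re_le h). assert (Hb := Rabs_Im_le h).
  assert (Q := Cmod_sqr h).
  destruct h as [a b]; simpl in *.
  eapply Rle_trans; [apply Cmod_le_Rabs|].
  unfold Cexp; simpl. fold (Cmod (a, b)) in *.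
  assert (E1 := exp_quadratic a ltac:(lra)).
  assert (E2 := cos_quadratic b).
  assert (E3 := sin_quadratic b ltac:(lra)).
  assert (B3 : exp a <= 3).
  { apply Rle_trans with (exp 1); [|apply exp_le_3].
    apply Rabs_le_between in Ha. destruct (Req_dec a 1); [subst; lra|].
    left. apply exp_increasing. lra. }
  assert (P := exp_pos a).
  assert (K1 : Rabs (exp a * cos b - 1 - a) <= 3 * (a * a) + 3 * (b * b)).
  { replace (exp a * cos b - 1 - a) with ((exp a - 1 - a) + exp a * (cos b - 1)) by ring.
    eapply Rle_trans; [apply Rabs_triang|]. apply Rplus_le_compat; auto.
    rewrite Rabs_mult, (Rabs_pos_eq (exp a)) by lra.
    apply Rmult_le_compat; try lra. apply Rabs_pos. }
  assert (K2 : Rabs (exp a * sin b - b) <= 3 * (b * b) + Rabs (exp a - 1) * Rabs b).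
  { replace (exp a * sin b - b) with (exp a * (sin b - b) + (exp a - 1) * b) by ring.
    eapply Rle_trans; [apply Rabs_triang|]. rewrite !Rabs_mult.
    apply Rplus_le_compat_r. rewrite (Rabs_pos_eq (exp a)) by lra.
    apply Rmult_le_compat; try lra. apply Rabs_pos. }
  assert (K3 : Rabs (exp a - 1) <= 4 * Rabs a).
  { replace (exp a - 1) with ((exp a - 1 - a) + a) by ring.
    eapply Rle_trans; [apply Rabs_triang|].
    assert (a * a = Rabs a * Rabs a) by (rewrite <- Rabs_mult, Rabs_pos_eq; nra).
    generalize (Rabs_pos a). nra. }
  assert (a * a = Rabs a * Rabs a) by (rewrite <- Rabs_mult, Rabs_pos_eq; nra).
  assert (b * b = Rabs b * Rabs b) by (rewrite <- Rabs_mult, Rabs_pos_eq; nra).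
  generalize (Rabs_pos a) (Rabs_pos b). intros.
  replace (exp a * cos b + - (1) + - a) with (exp a * cos b - 1 - a) by ring.
  replace (exp a * sin b + - 0 + - b) with (exp a * sin b - b) by ring.
  nra.
Qed.

Lemma cderiv_Cexp (z : C) : cderiv Cexp z (Cexp z).
Proof.
  apply (cderiv_of_quadratic _ _ _ (Cmod (Cexp z) * 16)).
  exists 1. split; [lra|]. intros w Hw. unfold disc in Hw.
  replace (Cexp w) with (Cexp z * Cexp (w - z))%C.
  2:{ rewrite <- Cexp_plus. f_equal. ring. }
  replace (Cexp z * Cexp (w - z) - Cexp z - Cexp z * (w - z))%C
    with (Cexp z * (Cexp (w - z) - 1 - (w - z)))%C by ring.
  rewrite Cmod_mult, Rmult_assoc. apply Rmult_le_compat_l; [apply Cmod_ge_0|].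
  apply Cexp_quadratic. lra.
Qed.

Lemma hol_Cexp (z : C) : hol Cexp z.
Proof.
  exists Cexp. apply filter_forall. intros w. split; [apply cderiv_Cexp|].
  eapply cderiv_cont, cderiv_Cexp.
Qed.

(* The half-angle formula gives the principal argument without case analysis. *)
Definition Carg (z : C) : R := 2 * atan (Im z / (Cmod z + Re z)).
Definition Clog (z : C) : C := (ln (Cmod z), Carg z).
Definition Cpow_principal (z w : C) : C := Cexp (w * Clog z).

(** [Carg] divides by this sum, whose positivity is the algebraic form of membership in the slit
    plane: its product with |z| - Re z is (Im z)^2. *)
Lemma slit_plane_pos (z : C) : slit_plane z -> 0 < Cmod z + Re z.
Proof.
  intros H. assert (Q := Cmod_sqr z). assert (P := Cmod_ge_0 z).
  destruct (Rlt_dec 0 (Cmod z + Re z)) as [|N]; auto. exfalso. apply H.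
  assert (Im z * Im z <= 0) by nra. split; nra.
Qed.

Lemma slit_plane_iff (z : C) : slit_plane z <-> 0 < Cmod z + Re z.
Proof.
  split; [apply slit_plane_pos|]. intros H [H1 H2].
  assert (Q := Cmod_sqr z). rewrite H1 in Q. nra.
Qed.

Lemma slit_plane_neq_0 (z : C) : slit_plane z -> z <> 0.
Proof. intros H E. subst. apply H. simpl. lra. Qed.

Lemma slit_plane_Re (z : C) : 0 < Re z -> slit_plane z.
Proof. intros H [_ K]. lra. Qed.

Lemma slit_plane_Im (z : C) : Im z <> 0 -> slit_plane z.
Proof. intros H [K _]. lra. Qed.

Lemma slit_plane_open (z : C) : slit_plane z -> nbhd z slit_plane.
Proof.
  intros H. apply slit_plane_pos in H.
  exists ((Cmod z + Re z) / 2). split; [lra|]. intros w Hw.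
  apply slit_plane_iff. unfold disc in Hw.
  assert (H1 := Rabs_Re_le (w - z)). assert (H2 := Cmod_rev_triangle z w).
  rewrite Cmod_minus_sym in H2.
  change (Re (w - z)) with (Re w - Re z) in H1.
  apply Rabs_le_between in H1. lra.
Qed.

Lemma Cexp_Clog (z : C) : slit_plane z -> Cexp (Clog z) = z.
Proof.
  intros H. assert (Hp := slit_plane_pos z H). assert (Q := Cmod_sqr z).
  assert (Hm : 0 < Cmod z) by (apply Cmod_gt_0; now apply slit_plane_neq_0).
  unfold Cexp, Clog, Carg; simpl. rewrite exp_ln by auto.
  set (m := Cmod z) in *. set (x := Re z) in *. set (y := Im z) in *.
  (* [t] is the tangent of half the argument, so cosine and sine of the argument are (1 - t^2)/(1 +
     t^2) and 2t/(1 + t^2); both goals then reduce to y^2 = m^2 - x^2. *)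
  set (t := y / (m + x)).
  assert (S : 0 < 1 + t²) by (generalize (Rle_0_sqr t); lra).
  assert (S2 : sqrt (1 + t²) * sqrt (1 + t²) = 1 + t²) by (apply sqrt_sqrt; lra).
  assert (S3 : 0 < sqrt (1 + t²)) by now apply sqrt_lt_R0.
  assert (T : t * (m + x) = y) by (unfold t; field; lra).
  unfold Rsqr in *.
  apply C_ext; simpl; fold x; fold y.
  - rewrite cos_2a, cos_atan, sin_atan. unfold Rsqr.
    set (r := sqrt (1 + t * t)) in *.
    transitivity (m * (1 - t * t) / (r * r)); [field; lra|]. rewrite S2.
    apply Rmult_eq_reg_r with (1 + t * t); [|lra].
    replace (m * (1 - t * t) / (1 + t * t) * (1 + t * t)) with (m * (1 - t * t))
      by (field; lra).
    apply Rmult_eq_reg_r with ((m + x) * (m + x)); [|nra].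
    transitivity (m * ((m + x) * (m + x) - (t * (m + x)) * (t * (m + x)))); [ring|].
    transitivity (x * ((m + x) * (m + x) + (t * (m + x)) * (t * (m + x)))); [|ring].
    rewrite T. replace (y * y) with (m * m - x * x) by lra. ring.
  - rewrite sin_2a, cos_atan, sin_atan. unfold Rsqr.
    set (r := sqrt (1 + t * t)) in *.
    transitivity (m * (2 * t) / (r * r)); [field; lra|]. rewrite S2.
    apply Rmult_eq_reg_r with (1 + t * t); [|lra].
    replace (m * (2 * t) / (1 + t * t) * (1 + t * t)) with (m * (2 * t))
      by (field; lra).
    apply Rmult_eq_reg_r with ((m + x) * (m + x)); [|nra].
    transitivity (m * 2 * (t * (m + x)) * (m + x)); [ring|].
    transitivity (y * ((m + x) * (m + x) + (t * (m + x)) * (t * (m + x)))); [|ring].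
    rewrite T. replace (y * y) with (m * m - x * x) by lra. ring.
Qed.

Lemma ccont_real_comp (f : C -> R) (g : R -> R) (z : C) :
  ccont (fun w => RtoC (f w)) z -> continuity_pt g (f z) ->
  ccont (fun w => RtoC (g (f w))) z.
Proof.
  intros Hf Hg e He. destruct (Hg e He) as [d [Hd H]].
  generalize (Hf d Hd). apply filter_imp. intros w Hw.
  rewrite <- RtoC_minus, Cmod_R in *.
  destruct (Req_dec (f z) (f w)) as [E|E].
  { rewrite E, Rminus_diag, Rabs_R0. auto. }
  apply H. split; [split; [exact I|auto]|exact Hw].
Qed.

Lemma ccont_Re (z : C) : ccont (fun w => RtoC (Re w)) z.
Proof.
  intros e He. exists e. split; auto. intros w Hw.
  rewrite <- RtoC_minus, Cmod_R. eapply Rle_lt_trans; [|exact Hw].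
  exact (Rabs_Re_le (w - z)).
Qed.

Lemma ccont_Im (z : C) : ccont (fun w => RtoC (Im w)) z.
Proof.
  intros e He. exists e. split; auto. intros w Hw.
  rewrite <- RtoC_minus, Cmod_R. eapply Rle_lt_trans; [|exact Hw].
  exact (Rabs_Im_le (w - z)).
Qed.

Lemma ccont_Cmod (z : C) : ccont (fun w => RtoC (Cmod w)) z.
Proof.
  intros e He. exists e. split; auto. intros w Hw.
  rewrite <- RtoC_minus, Cmod_R. eapply Rle_lt_trans; [|exact Hw].
  apply Rabs_le. generalize (Cmod_rev_triangle w z) (Cmod_rev_triangle z w).
  rewrite (Cmod_minus_sym z w). lra.
Qed.

Lemma ccont_Clog (z : C) : slit_plane z -> ccont Clog z.
Proof.
  intros H. assert (Hp := slit_plane_pos z H).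
  assert (Hm : 0 < Cmod z) by (apply Cmod_gt_0; now apply slit_plane_neq_0).
  apply (ccont_ext (fun w => RtoC (ln (Cmod w)) +
    Ci * (RtoC 2 * RtoC (atan (Im w / (Cmod w + Re w)))))%C).
  { apply filter_forall. intros w. apply C_ext; simpl; unfold Carg; ring. }
  apply ccont_plus.
  - apply (ccont_real_comp Cmod ln); [apply ccont_Cmod|].
    apply derivable_continuous_pt. exists (/ Cmod z). now apply derivable_pt_lim_ln.
  - apply ccont_mult; [apply ccont_const|]. apply ccont_mult; [apply ccont_const|].
    apply (ccont_real_comp (fun w => Im w / (Cmod w + Re w)) atan).
    + apply (ccont_ext (fun w => RtoC (Im w) * / (RtoC (Cmod w) + RtoC (Re w)))%C).
      * generalize (slit_plane_open z H). apply filter_imp. intros w Hw.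
        apply slit_plane_pos in Hw. rewrite <- RtoC_plus, <- RtoC_inv by lra.
        now rewrite <- RtoC_mult.
      * apply ccont_mult; [apply ccont_Im|].
        apply (ccont_comp Cinv); [apply ccont_plus; [apply ccont_Cmod|apply ccont_Re]|].
        apply ccont_inv. rewrite <- RtoC_plus. intros E. apply RtoC_inj in E. lra.
    + apply derivable_continuous_pt. eexists. apply derivable_pt_lim_atan.
Qed.

(* With [h] the increment of the logarithm, [w = z exp h], so that
   [(w - z) / z] equals [h] up to a quadratic error. *)
Lemma cderiv_Clog (z : C) : slit_plane z -> cderiv Clog z (/ z).
Proof.
  intros H. assert (Hz := slit_plane_neq_0 z H).
  assert (Hm : 0 < Cmod z) by now apply Cmod_gt_0.
  apply (cderiv_of_quadratic _ _ _ (64 * / (Cmod z * Cmod z))).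
  assert (He : 0 < / 32) by lra.
  generalize (filter_and _ _ (slit_plane_open z H) (ccont_Clog z H _ He)).
  apply filter_imp. intros w [Hw Hh].
  set (h := (Clog w - Clog z)%C) in *.
  assert (E : w = (z * Cexp h)%C).
  { rewrite <- (Cexp_Clog z H) at 1. rewrite <- Cexp_plus, <- (Cexp_Clog w Hw) at 1.
    f_equal. unfold h. ring. }
  assert (Q := Cexp_quadratic h ltac:(lra)).
  set (k := (/ z * (w - z))%C).
  assert (K : (h - k)%C = (- (Cexp h - 1 - h))%C).
  { unfold k. rewrite E. field. auto. }
  rewrite K, Cmod_opp. eapply Rle_trans; [exact Q|].
  assert (Hk : Cmod h <= 2 * Cmod k).
  { generalize (Cmod_rev_triangle h k). rewrite K, Cmod_opp.
    generalize (Cmod_ge_0 h). nra. }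
  assert (Ek : Cmod k = / Cmod z * Cmod (w - z)).
  { unfold k. now rewrite Cmod_mult, Cmod_inv. }
  apply Rle_trans with (64 * (Cmod k * Cmod k)).
  { generalize (Cmod_ge_0 h). nra. }
  rewrite Ek. right. field. lra.
Qed.

Lemma hol_Clog (z : C) : slit_plane z -> hol Clog z.
Proof.
  intros H. exists Cinv. generalize (slit_plane_open z H). apply filter_imp.
  intros w Hw. split; [now apply cderiv_Clog|].
  apply ccont_inv. now apply slit_plane_neq_0.
Qed.

Lemma hol_Cpow (w : C) (z : C) : slit_plane z -> hol (fun z => Cpow_principal z w) z.
Proof.
  intros H. unfold Cpow_principal. apply (hol_comp Cexp); [|apply hol_Cexp].
  apply hol_mult; [apply hol_const|now apply hol_Clog].
Qed.

Lemma Clog_RtoC (x : R) : 0 < x -> Clog (RtoC x) = RtoC (ln x).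
Proof.
  intros H. unfold Clog, Carg. rewrite Cmod_R, Rabs_pos_eq by lra. simpl.
  replace (0 / (x + x)) with 0 by (field; lra). rewrite atan_0, Rmult_0_r.
  reflexivity.
Qed.

Lemma Cpow_RtoC (x : R) (w : C) : 0 < x -> Cpow_principal (RtoC x) w = Cpower_pos x w.
Proof. intros H. unfold Cpow_principal, Cpower_pos. now rewrite Clog_RtoC. Qed.

Lemma Carg_bound (z : C) : Rabs (Carg z) <= PI.
Proof.
  unfold Carg. generalize (atan_bound (Im z / (Cmod z + Re z))). intros.
  apply Rabs_le. lra.
Qed.

Lemma atan_le (t : R) : 0 <= t -> 0 <= atan t <= t.
Proof.
  intros Ht. destruct (Req_dec t 0) as [->|N]; [rewrite atan_0; lra|].
  destruct (MVT_abs atan (fun x => / (1 + x ^ 2)) 0 t) as [c [H Hc]].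
  { intros c _. apply derivable_pt_lim_atan. }
  rewrite atan_0, !Rminus_0_r in H.
  assert (P : 0 < atan t).
  { rewrite <- atan_0. apply atan_increasing. lra. }
  assert (S : 1 <= 1 + c ^ 2) by (generalize (pow2_ge_0 c); lra).
  assert (I : 0 < / (1 + c ^ 2) <= 1).
  { split; [apply Rinv_0_lt_compat; lra|]. rewrite <- Rinv_1.
    apply Rinv_le_contravar; lra. }
  rewrite !Rabs_pos_eq in H; nra.
Qed.

(** The tangent of half the argument is Im z / (|z| + Re z), and dropping Re z >= 0 from the
    denominator only increases it. This smallness for nearly horizontal points keeps the product of
    the factors in [f_bounded] under control. *)
Lemma Carg_small (z : C) :
  0 <= Re z -> 0 < Im z -> Rabs (Carg z) <= 2 * (Im z / Cmod z).
Proof.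
  intros Hx Hy.
  assert (Hm : 0 < Cmod z).
  { generalize (Rabs_Im_le z). rewrite Rabs_pos_eq; lra. }
  unfold Carg.
  assert (H : 0 <= Im z / (Cmod z + Re z)) by (apply Rdiv_le_0_compat; lra).
  assert (A := atan_le _ H). rewrite Rabs_pos_eq by lra.
  apply Rmult_le_compat_l; [lra|]. eapply Rle_trans; [apply A|].
  apply Rmult_le_compat_l; [lra|]. apply Rinv_le_contravar; lra.
Qed.

Lemma Cmod_Cpow (z w : C) :
  Cmod (Cpow_principal z w) = Rpower (Cmod z) (Re w) * exp (- Im w * Carg z).
Proof.
  unfold Cpow_principal. rewrite Cmod_Cexp. unfold Rpower. rewrite <- exp_plus.
  f_equal. change (Re (w * Clog z)%C) with (Re w * ln (Cmod z) - Im w * Carg z). ring.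
Qed.

Lemma exp_le (x y : R) : x <= y -> exp x <= exp y.
Proof.
  intros H. destruct (Req_dec x y); [subst; lra|]. left. apply exp_increasing. lra.
Qed.

(** For a non-real exponent the modulus of a power also depends on the argument; as the argument is
    at most pi in absolute value, this costs only a constant. *)
Lemma Cmod_Cpow_le (z w : C) :
  Cmod (Cpow_principal z w) <= exp (PI * Rabs (Im w)) * Rpower (Cmod z) (Re w).
Proof.
  rewrite Cmod_Cpow, Rmult_comm. apply Rmult_le_compat_r; [left; apply exp_pos|].
  apply exp_le. eapply Rle_trans; [apply Rle_abs|]. rewrite Rabs_mult, Rabs_Ropp.
  generalize (Carg_bound z) (Rabs_pos (Im w)). nra.
Qed.

Lemma Cpow_neq_0 (z w : C) : Cpow_principal z w <> 0.
Proof. apply Cexp_neq_0. Qed.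

(** * Cauchy's formula on circles *)

Lemma cderiv_eq (f : C -> C) (z a b : C) : cderiv f z a -> a = b -> cderiv f z b.
Proof. now intros H <-. Qed.

Lemma cderiv_Re_is_derive (f : C -> C) (t : R) (l : C) :
  cderiv f (RtoC t) l -> is_derive (fun u : R => Re (f (RtoC u))) t (Re l).
Proof.
  intros [q [Hq [Cq Eq]]]. apply is_derive_Reals. intros e He.
  destruct (filter_and _ _ Eq (Cq e He)) as [d [Hd H]].
  exists (mkposreal d Hd). intros h Hh Hhd. simpl in Hhd.
  assert (E : (RtoC (t + h) - RtoC t)%C = RtoC h) by (rewrite RtoC_plus; ring).
  destruct (H (RtoC (t + h))) as [H1 H2].
  { unfold disc. now rewrite E, Cmod_R. }
  rewrite E, Hq in *.
  assert (K : Re (f (RtoC (t + h))) - Re (f (RtoC t)) = Re (q (RtoC (t + h))) * h).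
  { change (Re (f (RtoC (t + h))) - Re (f (RtoC t)))
      with (Re (f (RtoC (t + h)) - f (RtoC t))%C).
    rewrite H1. now rewrite re_scal_r. }
  rewrite K. replace (Re (q (RtoC (t + h))) * h / h) with (Re (q (RtoC (t + h))))
    by (field; auto).
  eapply Rle_lt_trans; [|exact H2]. exact (Rabs_Re_le (q (RtoC (t + h)) - l)).
Qed.

Lemma Re_mult_nCi (z : C) : Re (- Ci * z) = Im z.
Proof. destruct z; simpl; ring. Qed.

Lemma cderiv_scal (c : C) (f : C -> C) (z l : C) :
  cderiv f z l -> cderiv (fun w => c * f w)%C z (c * l)%C.
Proof.
  intros H. eapply cderiv_eq.
  - apply cderiv_mult; [apply cderiv_const|exact H].
  - cbv beta. ring.
Qed.

Lemma ccont_Re_continuous (f : C -> C) (t : R) :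
  ccont f (RtoC t) -> continuous (fun u : R => Re (f (RtoC u))) t.
Proof.
  intros H. apply continuity_pt_filterlim. intros e He.
  destruct (H e He) as [d [Hd K]]. exists d. split; auto.
  intros u [_ Hu]. unfold dist in *; simpl in *. unfold R_dist in *.
  eapply Rle_lt_trans; [exact (Rabs_Re_le (f (RtoC u) - f (RtoC t)))|].
  apply K. unfold disc. now rewrite <- RtoC_minus, Cmod_R.
Qed.

Lemma ccont_Im_continuous (f : C -> C) (t : R) :
  ccont f (RtoC t) -> continuous (fun u : R => Im (f (RtoC u))) t.
Proof.
  intros H.
  apply (continuous_ext (fun u : R => Re (- Ci * f (RtoC u))%C)).
  - intros u. apply Re_mult_nCi.
  - apply (ccont_Re_continuous (fun z => - Ci * f z)%C).
    apply ccont_mult; [apply ccont_const|auto].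
Qed.

(** The integrand is a function of a complex variable, restricted to reals only here, so that
    parametrised circles can be differentiated with [cderiv]. *)
Definition is_CInt (g : C -> C) (I : C) : Prop :=
  is_RInt (fun u : R => Re (g (RtoC u))) 0 (2 * PI) (Re I) /\
  is_RInt (fun u : R => Im (g (RtoC u))) 0 (2 * PI) (Im I).

Definition CInt (g : C -> C) : C :=
  (RInt (fun u : R => Re (g (RtoC u))) 0 (2 * PI),
   RInt (fun u : R => Im (g (RtoC u))) 0 (2 * PI)).

Lemma CInt_correct (g : C -> C) :
  (forall t : R, ccont g (RtoC t)) -> is_CInt g (CInt g).
Proof.
  intros H. split; simpl.
  - apply (RInt_correct (V := R_CompleteNormedModule)).
    apply (ex_RInt_continuous (V := R_CompleteNormedModule)).
    intros t _. now apply ccont_Re_continuous.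
  - apply (RInt_correct (V := R_CompleteNormedModule)).
    apply (ex_RInt_continuous (V := R_CompleteNormedModule)).
    intros t _. now apply ccont_Im_continuous.
Qed.

Lemma is_CInt_unique (g : C -> C) (I J : C) : is_CInt g I -> is_CInt g J -> I = J.
Proof.
  intros [H1 H2] [K1 K2]. apply C_ext.
  - rewrite <- (is_RInt_unique (V := R_CompleteNormedModule) _ _ _ _ H1).
    exact (is_RInt_unique (V := R_CompleteNormedModule) _ _ _ _ K1).
  - rewrite <- (is_RInt_unique (V := R_CompleteNormedModule) _ _ _ _ H2).
    exact (is_RInt_unique (V := R_CompleteNormedModule) _ _ _ _ K2).
Qed.

Lemma is_CInt_ext (g h : C -> C) (I : C) :
  (forall t : R, g (RtoC t) = h (RtoC t)) -> is_CInt g I -> is_CInt h I.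
Proof.
  intros E [H1 H2]. split.
  - apply (is_RInt_ext (fun u : R => Re (g (RtoC u)))); [|exact H1]. intros t _. now rewrite E.
  - apply (is_RInt_ext (fun u : R => Im (g (RtoC u)))); [|exact H2]. intros t _. now rewrite E.
Qed.

Lemma is_CInt_plus (g h : C -> C) (I J : C) :
  is_CInt g I -> is_CInt h J -> is_CInt (fun u => g u + h u)%C (I + J)%C.
Proof.
  intros [H1 H2] [K1 K2]. split.
  - exact (is_RInt_plus _ _ _ _ _ _ H1 K1).
  - exact (is_RInt_plus _ _ _ _ _ _ H2 K2).
Qed.

Lemma is_CInt_scal (c : C) (g : C -> C) (I : C) :
  is_CInt g I -> is_CInt (fun u => c * g u)%C (c * I)%C.
Proof.
  intros [H1 H2]. split.
  - exact (is_RInt_minus _ _ _ _ _ _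
      (is_RInt_scal _ _ _ (Re c) _ H1) (is_RInt_scal _ _ _ (Im c) _ H2)).
  - exact (is_RInt_plus _ _ _ _ _ _
      (is_RInt_scal _ _ _ (Re c) _ H2) (is_RInt_scal _ _ _ (Im c) _ H1)).
Qed.

(** The constant is 4 pi and not 2 pi because real and imaginary parts are estimated separately and
    added. *)
Lemma is_CInt_bound (g : C -> C) (I : C) (M : R) :
  is_CInt g I -> (forall t : R, 0 <= t <= 2 * PI -> Cmod (g (RtoC t)) <= M) -> Cmod I <= 4 * PI * M.
Proof.
  intros [H1 H2] B.
  assert (P : 0 <= 2 * PI) by (generalize PI_RGT_0; lra).
  assert (K : forall h v, is_RInt h 0 (2 * PI) v -> (forall t, 0 <= t <= 2 * PI -> Rabs (h t) <= M) ->
    Rabs v <= 2 * PI * M).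
  { intros h v Hv Hb.
    refine (norm_RInt_le h (fun _ => M) 0 (2 * PI) v (2 * PI * M) P _ Hv _).
    - exact Hb.
    - assert (L := is_RInt_const 0 (2 * PI) M). unfold scal in L; simpl in L.
      unfold mult in L; simpl in L. now rewrite Rminus_0_r in L. }
  eapply Rle_trans; [apply Cmod_le_Rabs|].
  assert (Rabs (Re I) <= 2 * PI * M).
  { eapply K; [exact H1|]. intros t Ht. eapply Rle_trans; [apply Rabs_Re_le|now apply B]. }
  assert (Rabs (Im I) <= 2 * PI * M).
  { eapply K; [exact H2|]. intros t Ht. eapply Rle_trans; [apply Rabs_Im_le|now apply B]. }
  lra.
Qed.

Lemma RInt_param_const (h ht : R -> R -> R) (a b al be : R) :
  a <= b ->
  (forall t, al < t < be -> forall u, is_derive (fun t => h t u) t (ht t u)) ->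
  (forall t, al < t < be -> forall u, continuity_2d_pt ht t u) ->
  (forall t, al < t < be -> forall u, continuous (h t) u) ->
  (forall t, al < t < be -> exists l : R -> R,
     (forall u, is_derive l u (ht t u)) /\ l a = l b) ->
  forall t1 t2, al < t1 -> t1 < t2 -> t2 < be -> RInt (h t1) a b = RInt (h t2) a b.
Proof.
  intros Hab Hd Hc2 Hc Hl t1 t2 H1 H12 H2.
  apply (eq_is_derive (fun t => RInt (h t) a b)); auto.
  intros t Ht. assert (Ht' : al < t < be) by lra.
  assert (Loc : locally t (fun t => al < t < be)).
  { apply (open_and (fun t => al < t) (fun t => t < be)); [apply open_gt|apply open_lt|auto]. }
  destruct (Hl t Ht') as [l [Dl Pl]].
  assert (D : is_derive (fun t => RInt (fun u => h t u) a b) t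
    (RInt (fun u => Derive (fun t => h t u) t) a b)).
  { apply is_derive_RInt_param.
    - revert Loc. apply filter_imp. intros s Hs u _. eexists. now apply Hd.
    - intros u _. apply (continuity_2d_pt_ext_loc ht); [|now apply Hc2].
      destruct Loc as [d Hd']. exists d. intros s v Hs _. symmetry.
      apply is_derive_unique. apply Hd. now apply Hd'.
    - revert Loc. apply filter_imp. intros s Hs.
      apply (ex_RInt_continuous (V := R_CompleteNormedModule)). intros u _. now apply Hc. }
  assert (Z : RInt (fun u => Derive (fun t => h t u) t) a b = 0).
  { assert (K : is_RInt (ht t) a b (minus (l b) (l a))).
    { apply (is_RInt_derive (V := R_CompleteNormedModule)).
      - intros u _. apply Dl.
      - intros u _. apply continuity_pt_filterlim.
        intros e He. destruct (Hc2 t Ht' u (mkposreal e He)) as [d Hd'].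
        exists d. split; [apply cond_pos|]. intros v [_ Hv].
        apply Hd'; [rewrite Rminus_diag, Rabs_R0; apply cond_pos|exact Hv]. }
    rewrite (RInt_ext _ (ht t)).
    - rewrite Pl in K. rewrite (is_RInt_unique (V := R_CompleteNormedModule) _ _ _ _ K).
      apply (minus_eq_zero (l b)).
    - intros u _. apply is_derive_unique. now apply Hd. }
  rewrite Z in D. exact D.
Qed.

(* The [t]-derivative of the integrand is a [u]-derivative of a periodic
   function, so the integral does not depend on [t]. *)
Lemma CInt_param_const (H Ht : C -> C -> C) (al be : R) :
  (forall t u : R, al < t < be ->
     cderiv (fun s => H s (RtoC u)) (RtoC t) (Ht (RtoC t) (RtoC u))) ->
  (forall t u : R, al < t < be ->
     ctends (locally ((t, u) : R * R)) (fun p => Ht (RtoC (fst p)) (RtoC (snd p)))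
       (Ht (RtoC t) (RtoC u))) ->
  (forall t u : R, al < t < be -> ccont (H (RtoC t)) (RtoC u)) ->
  (forall t : R, al < t < be -> exists L : C -> C,
     (forall u : R, cderiv L (RtoC u) (Ht (RtoC t) (RtoC u))) /\
     L (RtoC 0) = L (RtoC (2 * PI))) ->
  forall t1 t2 : R, al < t1 -> t1 < t2 -> t2 < be ->
  CInt (H (RtoC t1)) = CInt (H (RtoC t2)).
Proof.
  intros HD HC HU HL t1 t2 H1 H12 H2.
  assert (P : 0 <= 2 * PI) by (generalize PI_RGT_0; lra).
  (* The real lemma sees only real parts; the factor [c] is later 1 for the real part and -i for the
     imaginary part. *)
  assert (K : forall c : C,
    RInt (fun u : R => Re (c * H (RtoC t1) (RtoC u))%C) 0 (2 * PI) =
    RInt (fun u : R => Re (c * H (RtoC t2) (RtoC u))%C) 0 (2 * PI)).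
  { intros c.
    apply (RInt_param_const (fun t u => Re (c * H (RtoC t) (RtoC u))%C)
      (fun t u => Re (c * Ht (RtoC t) (RtoC u))%C) 0 (2 * PI) al be); auto.
    - intros t Ht' u.
      apply (cderiv_Re_is_derive (fun s => c * H s (RtoC u))%C).
      apply cderiv_scal. now apply HD.
    - intros t Ht' u e.
      assert (T := ctends_mult (locally ((t, u) : R * R)) _ _ _ _
        (ctends_const (locally ((t, u) : R * R)) c) (HC t u Ht') e (cond_pos e)).
      apply locally_2d_locally. revert T. apply filter_imp. intros [t' u'] T.
      simpl in T. eapply Rle_lt_trans; [|exact T].
      exact (Rabs_Re_le (c * Ht (RtoC t') (RtoC u') - c * Ht (RtoC t) (RtoC u))).
    - intros t Ht' u. apply (ccont_Re_continuous (fun z => c * H (RtoC t) z)%C).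
      apply ccont_mult; [apply ccont_const|now apply HU].
    - intros t Ht'. destruct (HL t Ht') as [L [DL PL]].
      exists (fun u : R => Re (c * L (RtoC u))%C). split.
      + intros u. apply (cderiv_Re_is_derive (fun z => c * L z)%C).
        now apply cderiv_scal.
      + now rewrite PL. }
  unfold CInt. f_equal.
  - generalize (K 1).
    rewrite !(RInt_ext (fun u : R => Re (RtoC 1 * H _ (RtoC u))%C)
      (fun u : R => Re (H _ (RtoC u)))) by (intros; now rewrite Cmult_1_l).
    auto.
  - generalize (K (- Ci)%C).
    rewrite !(RInt_ext (fun u : R => Re (- Ci * H _ (RtoC u))%C)
      (fun u : R => Im (H _ (RtoC u)))) by (intros; apply Re_mult_nCi).
    auto.
Qed.

Definition circ (z0 : C) (r : R) (u : C) : C := (z0 + RtoC r * Cexp (Ci * u))%C.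

Lemma circ_mod (z0 : C) (r : R) (u : R) :
  0 <= r -> Cmod (circ z0 r (RtoC u) - z0) = r.
Proof.
  intros Hr. unfold circ.
  replace (z0 + RtoC r * Cexp (Ci * RtoC u) - z0)%C
    with (RtoC r * Cexp (Ci * RtoC u))%C by ring.
  rewrite Cmod_mult, Cmod_R, Cmod_Cexp, Rabs_pos_eq by auto. simpl.
  replace (0 * u - 1 * 0) with 0 by ring. rewrite exp_0. ring.
Qed.

Lemma circ_period (z0 : C) (r : R) : circ z0 r (RtoC 0) = circ z0 r (RtoC (2 * PI)).
Proof.
  unfold circ. do 2 f_equal. apply C_ext; simpl;
  rewrite ?Rmult_0_l, ?Rmult_0_r, ?Rmult_1_l, ?Rminus_0_r, ?Rplus_0_l, ?Rplus_0_r,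
    ?cos_0, ?sin_0, ?cos_2PI, ?sin_2PI; auto.
Qed.

Lemma circ_deriv (z0 : C) (r : R) (u : C) :
  cderiv (circ z0 r) u (Ci * (circ z0 r u - z0))%C.
Proof.
  unfold circ. eapply cderiv_eq.
  - apply cderiv_plus; [apply cderiv_const|]. apply cderiv_scal.
    apply (cderiv_comp Cexp); [|apply cderiv_Cexp].
    apply cderiv_scal. apply cderiv_id.
  - ring.
Qed.

Lemma circ_cont (z0 : C) (r : R) (u : C) : ccont (circ z0 r) u.
Proof. eapply cderiv_cont, circ_deriv. Qed.

Lemma ccont_minus (f g : C -> C) (z : C) :
  ccont f z -> ccont g z -> ccont (fun w => f w - g w)%C z.
Proof.
  apply (ctends_minus (nbhd z)).
Qed.

Lemma ccont_div (f g : C -> C) (z : C) :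
  ccont f z -> ccont g z -> g z <> 0 -> ccont (fun w => f w / g w)%C z.
Proof.
  intros H K N. apply ccont_mult; auto. apply (ccont_comp Cinv); auto.
  now apply ccont_inv.
Qed.

Lemma ctends_fst (t u : R) :
  ctends (locally ((t, u) : R * R)) (fun p => RtoC (fst p)) (RtoC t).
Proof.
  intros e He. exists (mkposreal e He). intros [a b] [H _].
  rewrite <- RtoC_minus, Cmod_R. exact H.
Qed.

Lemma ctends_snd (t u : R) :
  ctends (locally ((t, u) : R * R)) (fun p => RtoC (snd p)) (RtoC u).
Proof.
  intros e He. exists (mkposreal e He). intros [a b] [_ H].
  rewrite <- RtoC_minus, Cmod_R. exact H.
Qed.

Lemma CInt_const (c : C) : is_CInt (fun _ => c) (RtoC (2 * PI) * c)%C.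
Proof.
  split.
  - assert (L := is_RInt_const 0 (2 * PI) (Re c)). unfold scal in L; simpl in L.
    unfold mult in L; simpl in L. rewrite Rminus_0_r in L.
    now rewrite re_scal_l.
  - assert (L := is_RInt_const 0 (2 * PI) (Im c)). unfold scal in L; simpl in L.
    unfold mult in L; simpl in L. rewrite Rminus_0_r in L.
    now rewrite im_scal_l.
Qed.

Lemma circ_neq (z0 w : C) (r : R) (u : R) :
  0 <= r -> disc z0 r w -> (circ z0 r (RtoC u) - w)%C <> 0.
Proof.
  intros Hr Hw E. assert (M := circ_mod z0 r u Hr). unfold disc in Hw.
  replace (circ z0 r (RtoC u)) with w in M.
  - lra.
  - symmetry. now apply Ceq_minus.
Qed.

Lemma circ_neq_center (z0 : C) (r : R) (u : R) :
  0 < r -> (circ z0 r (RtoC u) - z0)%C <> 0.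
Proof. intros Hr. apply circ_neq; [lra|now apply disc_center]. Qed.

(** With v = (w - z0)/(zeta - z0) the kernel is 1/(1 - v), and |v| is a constant m < 1. Deform it to
    1/(1 - t v): the integral is constant in t and equals 2 pi at t = 0. *)
Lemma cauchy_kernel (z0 w : C) (r : R) :
  0 < r -> disc z0 r w ->
  CInt (fun u => (circ z0 r u - z0) / (circ z0 r u - w))%C = RtoC (2 * PI).
Proof.
  intros Hr Hw.
  set (v := fun u : C => ((w - z0) / (circ z0 r u - z0))%C).
  set (m := Cmod (w - z0) / r).
  assert (Hm : 0 <= m < 1).
  { unfold m. split; [apply Rdiv_le_0_compat; [apply Cmod_ge_0|auto]|].
    apply Rlt_div_l; auto. rewrite Rmult_1_l. exact Hw. }
  assert (Vm : forall u : R, Cmod (v (RtoC u)) = m).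
  { intros u. unfold v. rewrite Cmod_div by now apply circ_neq_center.
    rewrite circ_mod by lra. reflexivity. }
  (* 2/(1 + m) lies beyond 1 and still keeps |t v| < 1, which leaves room around the endpoint t =
     1. *)
  set (be := / ((1 + m) / 2)).
  assert (Hbe : 1 < be).
  { unfold be. rewrite <- Rinv_1 at 1. apply Rinv_lt_contravar; lra. }
  assert (Nz : forall t u : R, -1 < t < be -> (1 - RtoC t * v (RtoC u))%C <> 0).
  { intros t u Ht E. apply (f_equal (fun c => c + RtoC t * v (RtoC u))%C) in E.
    rewrite Cplus_0_l in E.
    replace (1 - RtoC t * v (RtoC u) + RtoC t * v (RtoC u))%C with (RtoC 1) in E by ring.
    apply (f_equal Cmod) in E. rewrite Cmod_mult, Vm, !Cmod_R, Rabs_R1 in E.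
    assert (be * m < 1).
    { apply Rlt_le_trans with (be * ((1 + m) / 2)); [apply Rmult_lt_compat_l; lra|].
      unfold be. right. field. lra. }
    assert (Rabs t <= be) by (apply Rabs_le; lra). generalize (Rabs_pos t). nra. }
  assert (Dv : forall u : R, cderiv v (RtoC u) (- Ci * v (RtoC u))%C).
  { intros u. unfold v. eapply cderiv_eq.
    - apply cderiv_scal. apply (cderiv_comp Cinv).
      + apply cderiv_plus; [apply circ_deriv|apply cderiv_const].
      + apply cderiv_inv. now apply circ_neq_center.
    - cbv beta. field. now apply circ_neq_center. }
  assert (K : CInt (fun u => / (1 - RtoC 0 * v u))%C = CInt (fun u => / (1 - RtoC 1 * v u))%C).
  { apply (CInt_param_const (fun t u => / (1 - t * v u))%C
      (fun t u => v u * (/ (1 - t * v u) * / (1 - t * v u)))%C (-1) be); try lra.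
    - intros t u Ht. eapply cderiv_eq.
      + apply (cderiv_comp Cinv).
        * apply cderiv_plus; [apply cderiv_const|].
          apply (cderiv_ext (fun s => - v (RtoC u) * s)%C).
          { apply filter_forall. intros. ring. }
          apply cderiv_scal, cderiv_id.
        * apply cderiv_inv. now apply Nz.
      + field. now apply Nz.
    - intros t u Ht.
      assert (Tv : ctends (locally ((t, u) : R * R)) (fun p => v (RtoC (snd p))) (v (RtoC u))).
      { apply ctends_comp; [apply locally_filter|apply ctends_snd|].
        eapply cderiv_cont, Dv. }
      assert (Ti : ctends (locally ((t, u) : R * R))
        (fun p => / (1 - RtoC (fst p) * v (RtoC (snd p))))%C (/ (1 - RtoC t * v (RtoC u)))%C).
      { apply (ctends_comp (locally ((t, u) : R * R))
          (fun p => 1 - RtoC (fst p) * v (RtoC (snd p)))%C Cinv).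
        - apply ctends_minus; [typeclasses eauto|apply ctends_const; typeclasses eauto|].
          apply ctends_mult; [typeclasses eauto|apply ctends_fst|exact Tv].
        - apply ccont_inv. now apply Nz. }
      apply ctends_mult; [typeclasses eauto|exact Tv|].
      apply ctends_mult; [typeclasses eauto|exact Ti|exact Ti].
    - intros t u Ht. apply (ccont_comp Cinv).
      + apply ccont_minus; [apply ccont_const|]. apply ccont_mult; [apply ccont_const|].
        eapply cderiv_cont, Dv.
      + apply ccont_inv. now apply Nz.
    (* As dv/du = -i v, the u-derivative of i v/(1 - t v) is v/(1 - t v)^2, which is the
       t-derivative of the kernel. *)
    - intros t Ht. exists (fun u => Ci * (v u * / (1 - RtoC t * v u)))%C. split.
      + intros u. eapply cderiv_eq.
        * apply cderiv_scal. apply cderiv_mult; [apply Dv|].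
          apply (cderiv_comp Cinv).
          -- apply (cderiv_ext (fun s => 1 + (- RtoC t) * v s)%C).
             { apply filter_forall. intros. ring. }
             apply cderiv_plus; [apply cderiv_const|]. apply cderiv_scal, Dv.
          -- apply cderiv_inv. now apply Nz.
        * assert (N := Nz t u Ht).
          transitivity (- (Ci * Ci) * (v (RtoC u) *
            (/ (1 - RtoC t * v (RtoC u)) * / (1 - RtoC t * v (RtoC u)))))%C.
          { field. auto. }
          replace (Ci * Ci)%C with (RtoC (-1)); [cbv beta; ring|].
          apply C_ext; simpl; ring.
      + unfold v. now rewrite circ_period. }
  assert (E0 : is_CInt (fun u => / (1 - RtoC 0 * v u))%C (RtoC (2 * PI) * 1)%C).
  { apply (is_CInt_ext (fun _ => RtoC 1)); [|apply CInt_const].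
    intros t. replace (1 - RtoC 0 * v (RtoC t))%C with (RtoC 1) by ring.
    field. }
  assert (E1 : CInt (fun u => / (1 - RtoC 0 * v u))%C = RtoC (2 * PI)).
  { rewrite <- (Cmult_1_r (RtoC (2 * PI))). eapply is_CInt_unique; [|exact E0].
    apply CInt_correct. intros t. apply (ccont_comp Cinv).
    - apply ccont_minus; [apply ccont_const|]. apply ccont_mult; [apply ccont_const|].
      eapply cderiv_cont, Dv.
    - apply ccont_inv. apply Nz. lra. }
  rewrite <- E1, K. unfold CInt.
  assert (E : forall u : R, ((circ z0 r u - z0) / (circ z0 r u - w))%C =
    (/ (1 - RtoC 1 * v (RtoC u)))%C).
  { intros u. unfold v. assert (N1 := circ_neq_center z0 r u Hr).
    assert (N2 := circ_neq z0 w r u ltac:(lra) Hw).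
    replace (1 - RtoC 1 * ((w - z0) / (circ z0 r u - z0)))%C
      with ((circ z0 r u - w) / (circ z0 r u - z0))%C by (field; auto).
    field. auto. }
  f_equal; apply RInt_ext; intros u _; now rewrite E.
Qed.

(** The range of [t] exceeds [0, 1] on both sides because the deformation below needs an open
    interval of parameters around its endpoints. *)
Lemma disc_segment (z0 w ze : C) (r R0 t : R) :
  0 < r -> r < R0 -> disc z0 r w -> Cmod (ze - z0) = r ->
  - ((R0 - r) / (2 * r)) < t < 1 + (R0 - r) / (2 * r) ->
  disc z0 R0 (w + RtoC t * (ze - w)).
Proof.
  intros Hr HR Hw Hz Ht. unfold disc in *.
  replace (w + RtoC t * (ze - w) - z0)%C
    with (RtoC (1 - t) * (w - z0) + RtoC t * (ze - z0))%C
    by (rewrite RtoC_minus; ring).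
  eapply Rle_lt_trans; [apply Cmod_triangle|]. rewrite !Cmod_mult, !Cmod_R, Hz.
  set (d := (R0 - r) / (2 * r)) in *.
  assert (Hd : r + 2 * d * r = R0) by (unfold d; field; lra).
  assert (Hd0 : 0 < d) by (apply Rdiv_lt_0_compat; lra).
  assert (P := Cmod_ge_0 (w - z0)). assert (P1 := Rabs_pos (1 - t)).
  assert (Rabs (1 - t) * Cmod (w - z0) <= Rabs (1 - t) * r) by nra.
  assert (Rabs (1 - t) + Rabs t < 1 + 2 * d).
  { unfold Rabs. destruct (Rcase_abs (1 - t)), (Rcase_abs t); lra. }
  nra.
Qed.

(** On the circle dzeta = i (zeta - z0) du, so this is the usual contour integral divided by i. The
    circle is shrunk to [w] along straight lines; at the end only the kernel integral remains. *)
Lemma cauchy_formula (f : C -> C) (z0 w : C) (r R0 : R) :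
  0 < r -> r < R0 -> (forall z, disc z0 R0 z -> hol f z) -> disc z0 r w ->
  is_CInt (fun u => f (circ z0 r u) * ((circ z0 r u - z0) / (circ z0 r u - w)))%C
    (RtoC (2 * PI) * f w)%C.
Proof.
  intros Hr HR Hf Hw. destruct (hol_derivative _ f Hf) as [f' Hf'].
  set (k := fun u => ((circ z0 r u - z0) / (circ z0 r u - w))%C).
  set (g := fun t u => (w + t * (circ z0 r u - w))%C).
  set (d := (R0 - r) / (2 * r)).
  assert (Hd : 0 < d) by (apply Rdiv_lt_0_compat; lra).
  assert (In : forall t u : R, - d < t < 1 + d -> disc z0 R0 (g (RtoC t) (RtoC u))).
  { intros t u Ht. apply (disc_segment z0 w _ r); auto. apply circ_mod. lra. }
  assert (Ck : forall u : R, ccont k (RtoC u)).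
  { intros u. unfold k.
    apply ccont_div; [apply ccont_minus; [apply circ_cont|apply ccont_const]| |].
    - apply ccont_minus; [apply circ_cont|apply ccont_const].
    - apply circ_neq; auto; lra. }
  assert (Dgu : forall (t u : R), cderiv (g (RtoC t)) (RtoC u)
     (RtoC t * (Ci * (circ z0 r u - z0)))%C).
  { intros t u. unfold g. eapply cderiv_eq.
    - apply cderiv_plus; [apply cderiv_const|]. apply cderiv_scal.
      apply cderiv_plus; [apply circ_deriv|apply cderiv_const].
    - ring. }
  assert (CH : forall t u : R, - d < t < 1 + d ->
    ccont (fun u => f (g (RtoC t) u) * k u)%C (RtoC u)).
  { intros t u Ht. apply ccont_mult; [|apply Ck].
    apply (ccont_comp f (g (RtoC t))).
    - eapply cderiv_cont, Dgu.
    - apply hol_cont, Hf, In, Ht. }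
  assert (K : CInt (fun u => f (g (RtoC 0) u) * k u)%C =
              CInt (fun u => f (g (RtoC 1) u) * k u)%C).
  { apply (CInt_param_const (fun t u => f (g t u) * k u)%C
      (fun t u => f' (g t u) * (circ z0 r u - z0))%C (- d) (1 + d)); try lra.
    - intros t u Ht. eapply cderiv_eq.
      + apply cderiv_mult; [|apply cderiv_const].
        apply (cderiv_comp f (fun t => g t (RtoC u))).
        * unfold g. apply cderiv_plus; [apply cderiv_const|].
          apply (cderiv_ext (fun s => (circ z0 r (RtoC u) - w) * s)%C).
          { apply filter_forall. intros. ring. }
          apply cderiv_scal, cderiv_id.
        * apply Hf', In, Ht.
      + unfold k. field. apply circ_neq; auto; lra.
    - intros t u Ht.
      assert (Tc : ctends (locally ((t, u) : R * R)) (fun p => circ z0 r (RtoC (snd p)))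
        (circ z0 r (RtoC u))).
      { apply ctends_comp; [apply locally_filter|apply ctends_snd|apply circ_cont]. }
      apply ctends_mult; [typeclasses eauto| |].
      + apply (ctends_comp (locally ((t, u) : R * R))
          (fun p => g (RtoC (fst p)) (RtoC (snd p))) f').
        * unfold g. apply ctends_plus;
            [typeclasses eauto|apply ctends_const; typeclasses eauto|].
          apply ctends_mult; [typeclasses eauto|apply ctends_fst|].
          apply ctends_plus;
            [typeclasses eauto|exact Tc|apply ctends_const; typeclasses eauto].
        * apply Hf', In, Ht.
      + apply ctends_plus;
          [typeclasses eauto|exact Tc|apply ctends_const; typeclasses eauto].
    - intros t u Ht. now apply CH.
    (* The primitive in [u] is f(g t u)/(i t). At t = 0 this is meaningless, but the t-derivative is
       then f'(w) (zeta - z0) with a constant first factor, and f'(w) zeta / i serves instead. *)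
    - intros t Ht. destruct (Req_dec t 0) as [E|N].
      + exists (fun u => (f' w / Ci) * circ z0 r u)%C. split.
        * intros u. eapply cderiv_eq; [apply cderiv_scal, circ_deriv|].
          subst t. unfold g. replace (w + RtoC 0 * (circ z0 r (RtoC u) - w))%C with w by ring.
          field. apply Ci_nz.
        * now rewrite circ_period.
      + assert (N' : RtoC t <> 0) by (intros E; apply RtoC_inj in E; lra).
        exists (fun u => (/ (Ci * RtoC t)) * f (g (RtoC t) u))%C. split.
        * intros u. eapply cderiv_eq.
          -- apply cderiv_scal. apply (cderiv_comp f (g (RtoC t))); [apply Dgu|].
             apply Hf', In, Ht.
          -- field. split; [auto|apply Ci_nz].
        * unfold g. now rewrite circ_period. }
  assert (E0 : CInt (fun u => f (g (RtoC 0) u) * k u)%C = (RtoC (2 * PI) * f w)%C).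
  { rewrite <- (cauchy_kernel z0 w r Hr Hw), (Cmult_comm _ (f w)).
    eapply is_CInt_unique.
    - apply CInt_correct. intros u. apply CH. lra.
    - apply (is_CInt_ext (fun u => f w * k u)%C).
      + intros u. unfold g.
        now replace (w + RtoC 0 * (circ z0 r (RtoC u) - w))%C with w by ring.
      + apply is_CInt_scal. apply CInt_correct. exact Ck. }
  rewrite <- E0, K.
  apply (is_CInt_ext (fun u => f (g (RtoC 1) u) * k u)%C).
  - intros u. unfold g, k. do 2 f_equal. ring.
  - apply CInt_correct. intros u. apply CH. lra.
Qed.

(** * Weierstrass' theorem and the identity theorem *)

Lemma circ_dist (z0 w : C) (r : R) (u : R) :
  0 <= r -> Cmod (w - z0) <= r / 2 -> r / 2 <= Cmod (circ z0 r (RtoC u) - w).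
Proof.
  intros Hr Hw. generalize (Cmod_triangle3 (circ z0 r (RtoC u)) w z0).
  rewrite circ_mod by auto. lra.
Qed.

Lemma Cmod_two_pi (z : C) (M : R) :
  Cmod (RtoC (2 * PI) * z) <= 4 * PI * M -> Cmod z <= 2 * M.
Proof.
  assert (P := PI_RGT_0). rewrite Cmod_mult, Cmod_R, Rabs_pos_eq by lra. intros H.
  apply Rmult_le_reg_l with (2 * PI); lra.
Qed.

(** [g] is the Cauchy integral with squared kernel, and the remainder comes from 1/(zeta - w') -
    1/(zeta - w) - (w' - w)/(zeta - w)^2 = (w' - w)^2/((zeta - w)^2 (zeta - w')). On the circle of
    radius R0/2 each of zeta - w and zeta - w' has modulus at least R0/4. Both bounds are linear in
    [M], so they can be summed over the terms of a series. *)
Lemma cauchy_quadratic (f : C -> C) (z0 : C) (R0 M : R) :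
  0 < R0 -> (forall z, disc z0 R0 z -> hol f z) ->
  (forall z, disc z0 R0 z -> Cmod (f z) <= M) ->
  exists g : C -> C, forall w, disc z0 (R0 / 4) w ->
    Cmod (g w) <= 16 / R0 * M /\
    forall w', disc z0 (R0 / 4) w' ->
      Cmod (f w' - f w - g w * (w' - w)) <=
      64 / (R0 * R0) * M * (Cmod (w' - w) * Cmod (w' - w)).
Proof.
  intros HR Hf HM. assert (P := PI_RGT_0).
  assert (HM0 : 0 <= M).
  { eapply Rle_trans; [apply Cmod_ge_0|apply (HM z0)]. now apply disc_center. }
  set (r := R0 / 2). assert (Hr : 0 < r) by (unfold r; lra).
  assert (Hin : forall u : R, disc z0 R0 (circ z0 r (RtoC u))).
  { intros u. unfold disc. rewrite circ_mod; unfold r; lra. }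
  set (k := fun w u => (f (circ z0 r u) *
    ((circ z0 r u - z0) * (/ (circ z0 r u - w) * / (circ z0 r u - w))))%C).
  set (g := fun w => (CInt (k w) / RtoC (2 * PI))%C).
  assert (P2 : RtoC (2 * PI) <> 0) by (intros E; apply RtoC_inj in E; lra).
  assert (Cf : forall u : R, ccont (fun u => f (circ z0 r u)) (RtoC u)).
  { intros u. apply ccont_comp; [apply circ_cont|apply hol_cont, Hf, Hin]. }
  assert (Ci : forall w (u : R), disc z0 (R0 / 4) w ->
    ccont (fun u => / (circ z0 r u - w))%C (RtoC u) /\
    (circ z0 r u - w)%C <> 0 /\ Cmod (/ (circ z0 r u - w)) <= 4 / R0).
  { intros w u Hw. unfold disc in Hw.
    assert (D := circ_dist z0 w r u ltac:(lra) ltac:(unfold r; lra)).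
    assert (N : (circ z0 r u - w)%C <> 0).
    { apply Cmod_gt_0. lra. }
    split; [|split; auto].
    - apply (ccont_comp Cinv); [|now apply ccont_inv].
      apply ccont_minus; [apply circ_cont|apply ccont_const].
    - rewrite Cmod_inv by auto. replace (4 / R0) with (/ (r / 2)) by (unfold r; field; lra).
      apply Rinv_le_contravar; lra. }
  assert (Ck : forall w (u : R), disc z0 (R0 / 4) w -> ccont (k w) (RtoC u)).
  { intros w u Hw. destruct (Ci w u Hw) as [C1 _]. unfold k.
    apply ccont_mult; auto. apply ccont_mult.
    - apply ccont_minus; [apply circ_cont|apply ccont_const].
    - now apply ccont_mult. }
  exists g. intros w Hw.
  assert (Kg := CInt_correct _ (fun u => Ck w u Hw)).
  assert (Eg : CInt (k w) = (RtoC (2 * PI) * g w)%C) by (unfold g; field; auto).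
  rewrite Eg in Kg.
  split.
  - replace (16 / R0 * M) with (2 * (M * (r * (4 / R0 * (4 / R0)))))
      by (unfold r; field; lra).
    apply Cmod_two_pi. apply (is_CInt_bound _ _ _ Kg). intros u _. unfold k.
    destruct (Ci w u Hw) as [_ [_ B]]. rewrite !Cmod_mult, circ_mod by lra.
    apply Rmult_le_compat; [apply Cmod_ge_0| |now apply HM|].
    + apply Rmult_le_pos; [lra|]. apply Rmult_le_pos; apply Cmod_ge_0.
    + apply Rmult_le_compat_l; [lra|].
      apply Rmult_le_compat; auto; apply Cmod_ge_0.
  - intros w' Hw'.
    assert (HrR : r < R0) by (unfold r; lra).
    assert (K1 := cauchy_formula f z0 w r R0 Hr HrR Hf ltac:(unfold disc, r in *; lra)).
    assert (K2 := cauchy_formula f z0 w' r R0 Hr HrR Hf ltac:(unfold disc, r in *; lra)).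
    assert (K := is_CInt_plus _ _ _ _ K2 (is_CInt_plus _ _ _ _
      (is_CInt_scal (RtoC (-1)) _ _ K1) (is_CInt_scal (- (w' - w)) _ _ Kg))).
    replace (RtoC (2 * PI) * f w' + (RtoC (-1) * (RtoC (2 * PI) * f w) +
      - (w' - w) * (RtoC (2 * PI) * g w)))%C
      with (RtoC (2 * PI) * (f w' - f w - g w * (w' - w)))%C in K by ring.
    set (D := Cmod (w' - w) * Cmod (w' - w)).
    assert (HD : 0 <= D) by (apply Rmult_le_pos; apply Cmod_ge_0).
    replace (64 / (R0 * R0) * M * D)
      with (2 * (M * (r * (D * (4 / R0 * (4 / R0 * (4 / R0)))))))
      by (unfold r; field; lra).
    apply Cmod_two_pi. apply (is_CInt_bound _ _ _ K). intros u _.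
    destruct (Ci w u Hw) as [_ [N B]]. destruct (Ci w' u Hw') as [_ [N' B']].
    match goal with |- Cmod ?e <= _ => replace e with
      (f (circ z0 r u) * ((circ z0 r u - z0) * ((w' - w) * (w' - w) *
       (/ (circ z0 r u - w) * (/ (circ z0 r u - w) * / (circ z0 r u - w'))))))%C end.
    2:{ unfold k. field. auto. }
    rewrite !Cmod_mult, circ_mod by lra. fold D.
    assert (G := Cmod_ge_0).
    apply Rmult_le_compat; [apply G| |now apply HM|].
    { repeat apply Rmult_le_pos; auto; try lra. }
    apply Rmult_le_compat_l; [lra|]. apply Rmult_le_compat_l; [auto|].
    apply Rmult_le_compat; auto. { apply Rmult_le_pos; auto. }
    apply Rmult_le_compat; auto.
Qed.

(** Only the terms below [n] are summed, whereas [sum_n] includes the term of index [n]; hence the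
    successor in comparisons of the two. *)
Fixpoint Csum (a : nat -> C) (n : nat) : C :=
  match n with O => RtoC 0 | S n => (Csum a n + a n)%C end.

Definition cseries (a : nat -> C) (s : C) : Prop := ctends eventually (Csum a) s.

Lemma ctends_Cmod_le {X : Type} (F : (X -> Prop) -> Prop) {FF : ProperFilter F}
  (f : X -> C) (l : C) (K : R) :
  ctends F f l -> F (fun x => Cmod (f x) <= K) -> Cmod l <= K.
Proof.
  intros H B. destruct (Rle_dec (Cmod l) K) as [|N]; auto. exfalso.
  assert (He : 0 < Cmod l - K) by lra.
  destruct (filter_ex _ (filter_and _ _ (H _ He) B)) as [x [H1 H2]].
  generalize (Cmod_rev_triangle l (f x)). rewrite Cmod_minus_sym. lra.
Qed.

Lemma ctends_unique {X : Type} (F : (X -> Prop) -> Prop) {FF : ProperFilter F}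
  (f : X -> C) (l m : C) : ctends F f l -> ctends F f m -> l = m.
Proof.
  intros H K. apply Ceq_minus, Cmod_eq_0.
  apply Rle_antisym; [|apply Cmod_ge_0].
  apply (ctends_Cmod_le F (fun x => f x - f x)%C).
  - apply ctends_minus; auto. typeclasses eauto.
  - apply filter_forall. intros x. replace (f x - f x)%C with (RtoC 0) by ring.
    rewrite Cmod_0. lra.
Qed.

Lemma Re_Csum (a : nat -> C) (n : nat) :
  Re (Csum a (S n)) = sum_n (fun k => Re (a k)) n.
Proof.
  induction n as [|n IH].
  - rewrite sum_O. apply Rplus_0_l.
  - rewrite sum_Sn, <- IH. reflexivity.
Qed.

Lemma Im_Csum (a : nat -> C) (n : nat) :
  Im (Csum a (S n)) = sum_n (fun k => Im (a k)) n.
Proof.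
  induction n as [|n IH].
  - rewrite sum_O. apply Rplus_0_l.
  - rewrite sum_Sn, <- IH. reflexivity.
Qed.

Lemma cseries_of_is_series (a : nat -> C) (s : C) :
  is_series (fun k => Re (a k)) (Re s) -> is_series (fun k => Im (a k)) (Im s) ->
  cseries a s.
Proof.
  intros H1 H2 e He.
  assert (He2 : 0 < e / 2) by lra.
  assert (F1 : eventually (fun n => ball (Re s) (e / 2) (sum_n (fun k => Re (a k)) n)))
    by exact (H1 _ (locally_ball _ (mkposreal _ He2))).
  assert (F2 : eventually (fun n => ball (Im s) (e / 2) (sum_n (fun k => Im (a k)) n)))
    by exact (H2 _ (locally_ball _ (mkposreal _ He2))).
  destruct (filter_and _ _ F1 F2) as [N HN].
  exists (S N). intros n Hn. destruct n as [|n]; [lia|].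
  destruct (HN n ltac:(lia)) as [K1 K2].
  rewrite <- Re_Csum in K1. rewrite <- Im_Csum in K2.
  eapply Rle_lt_trans; [apply Cmod_le_Rabs|].
  change (Rabs (Re (Csum a (S n)) - Re s) < e / 2) in K1.
  change (Rabs (Im (Csum a (S n)) - Im s) < e / 2) in K2.
  change (Rabs (Re (Csum a (S n)) - Re s) + Rabs (Im (Csum a (S n)) - Im s) < e).
  lra.
Qed.

Lemma cseries_exists (a : nat -> C) (M : nat -> R) :
  (forall n, Cmod (a n) <= M n) -> ex_series M -> exists s, cseries a s.
Proof.
  intros H HM.
  destruct (ex_series_le (V := R_CompleteNormedModule) (fun k => Re (a k)) M) as [x Hx]; auto.
  { intros n. eapply Rle_trans; [apply Rabs_Re_le|apply H]. }
  destruct (ex_series_le (V := R_CompleteNormedModule) (fun k => Im (a k)) M) as [y Hy]; auto.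
  { intros n. eapply Rle_trans; [apply Rabs_Im_le|apply H]. }
  exists (x, y). now apply cseries_of_is_series.
Qed.

Lemma Csum_bound (a : nat -> C) (M : nat -> R) (n : nat) :
  (forall n, Cmod (a n) <= M n) -> ex_series M -> Cmod (Csum a n) <= Series M.
Proof.
  intros H HM.
  assert (PM : forall n, 0 <= M n).
  { intros k. eapply Rle_trans; [apply Cmod_ge_0|apply H]. }
  assert (S0 : forall n, Cmod (Csum a (S n)) <= sum_n M n).
  { intros k. induction k as [|k IH].
    - rewrite sum_O. simpl. rewrite Cplus_0_l. apply H.
    - rewrite sum_Sn. eapply Rle_trans; [apply Cmod_triangle|].
      apply Rplus_le_compat; auto. }
  assert (SM : forall n, sum_n M n <= Series M).
  { intros k. apply is_series_partial_pos || idtac.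
    apply (is_lim_seq_incr_compare (sum_n M)).
    - exact (Series_correct _ HM).
    - intros j. rewrite sum_Sn. unfold plus; simpl. generalize (PM (S j)). lra. }
  destruct n as [|n].
  - simpl. rewrite Cmod_0. eapply Rle_trans; [apply (PM 0%nat)|].
    generalize (SM 0%nat). now rewrite sum_O.
  - eapply Rle_trans; [apply S0|apply SM].
Qed.

Lemma cseries_bound (a : nat -> C) (M : nat -> R) (s : C) :
  (forall n, Cmod (a n) <= M n) -> ex_series M -> cseries a s -> Cmod s <= Series M.
Proof.
  intros H HM Hs. apply (ctends_Cmod_le eventually (Csum a)); auto.
  apply filter_forall. intros n. now apply Csum_bound.
Qed.

Lemma Csum_lin (a b g : nat -> C) (c : C) (n : nat) :
  Csum (fun k => a k - b k - g k * c)%C n = (Csum a n - Csum b n - Csum g n * c)%C.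
Proof. induction n as [|n IH]; simpl; [ring|rewrite IH; ring]. Qed.

(** The termwise expansions of [cauchy_quadratic] are summed: the series of derivatives converges,
    and the quadratic remainder survives with a constant proportional to the sum of [M]. *)
Lemma weierstrass_center (f : nat -> C -> C) (M : nat -> R) (s : C -> C) (z0 : C) (R0 : R) :
  0 < R0 -> (forall n z, disc z0 R0 z -> hol (f n) z) ->
  (forall n z, disc z0 R0 z -> Cmod (f n z) <= M n) -> ex_series M ->
  (forall z, disc z0 R0 z -> cseries (fun n => f n z) (s z)) -> hol s z0.
Proof.
  intros HR Hf HM EM Hs.
  destruct (choice (fun n g => forall w, disc z0 (R0 / 4) w ->
    Cmod (g w) <= 16 / R0 * M n /\
    forall w', disc z0 (R0 / 4) w' ->
      Cmod (f n w' - f n w - g w * (w' - w)) <=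
      64 / (R0 * R0) * M n * (Cmod (w' - w) * Cmod (w' - w)))) as [g Hg].
  { intros n. apply cauchy_quadratic; auto. }
  destruct (choice (fun w l => disc z0 (R0 / 4) w -> cseries (fun n => g n w) l)) as [G HG].
  { intros w. destruct (excluded_middle_informative (disc z0 (R0 / 4) w)) as [Hw|Hw].
    - destruct (cseries_exists (fun n => g n w) (fun n => 16 / R0 * M n)) as [l Hl].
      + intros n. now apply Hg.
      + now apply (ex_series_scal (V := R_NormedModule)).
      + now exists l.
    - exists (RtoC 0). tauto. }
  set (B := 64 / (R0 * R0) * Series M).
  assert (Q : forall w w', disc z0 (R0 / 4) w -> disc z0 (R0 / 4) w' ->
    Cmod (s w' - s w - G w * (w' - w)) <= B * (Cmod (w' - w) * Cmod (w' - w))).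
  { intros w w' Hw Hw'.
    set (D := Cmod (w' - w) * Cmod (w' - w)).
    assert (In : forall v, disc z0 (R0 / 4) v -> disc z0 R0 v).
    { intros v. unfold disc. lra. }
    replace (B * D) with (Series (fun n => (64 / (R0 * R0) * D) * M n)).
    2:{ rewrite Series_scal_l. unfold B. ring. }
    apply (cseries_bound (fun n => f n w' - f n w - g n w * (w' - w))%C).
    - intros n. replace (64 / (R0 * R0) * D * M n) with (64 / (R0 * R0) * M n * D) by ring.
      now apply Hg.
    - now apply (ex_series_scal (V := R_NormedModule)).
    - apply (ctends_ext _ (fun n => Csum (fun n => f n w') n - Csum (fun n => f n w) n
        - Csum (fun n => g n w) n * (w' - w))%C).
      { apply filter_forall. intros n. symmetry. apply Csum_lin. }
      apply ctends_minus; [typeclasses eauto| |].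
      + apply ctends_minus; [typeclasses eauto| |]; apply Hs; auto.
      + apply ctends_mult; [typeclasses eauto|now apply HG|].
        apply ctends_const. typeclasses eauto. }
  assert (HR4 : 0 < R0 / 4) by lra.
  exists G. exists (R0 / 4). split; [auto|]. intros w Hw. split.
  - apply (cderiv_of_quadratic _ _ _ B).
    generalize (nbhd_open_disc _ _ _ Hw). apply filter_imp. intros w' Hw'.
    now apply Q.
  - intros e He. set (N := 2 * Rabs B + 1).
    assert (HN : 0 < N) by (unfold N; generalize (Rabs_pos B); lra).
    assert (HeN : 0 < e / N) by now apply Rdiv_lt_0_compat.
    assert (V : nbhd w (disc w (e / N))) by (exists (e / N); auto).
    generalize (filter_and _ _ V (nbhd_open_disc _ _ _ Hw)).
    apply filter_imp. intros w' [D Hw'].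
    destruct (excluded_middle_informative (w' = w)) as [E|E].
    { subst. replace (G w - G w)%C with (RtoC 0) by ring. now rewrite Cmod_0. }
    assert (Hp : 0 < Cmod (w' - w)) by now apply Cmod_gt_0, Cminus_eq_contra.
    assert (Q1 := Q w w' Hw Hw'). assert (Q2 := Q w' w Hw' Hw).
    rewrite (Cmod_minus_sym w w') in Q2.
    (* Adding the expansions from w to w' and from w' to w cancels the values of [s] and shows that
       [G] is Lipschitz on the small disc. *)
    assert (K : Cmod ((G w' - G w) * (w' - w)) <= 2 * B * (Cmod (w' - w) * Cmod (w' - w))).
    { replace ((G w' - G w) * (w' - w))%C
        with ((s w' - s w - G w * (w' - w)) + (s w - s w' - G w' * (w - w')))%C by ring.
      eapply Rle_trans; [apply Cmod_triangle|]. lra. }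
    rewrite Cmod_mult, <- Rmult_assoc in K. apply Rmult_le_reg_r in K; auto.
    apply Rlt_div_r in D; auto.
    assert (2 * B <= N) by (unfold N; generalize (Rle_abs B); lra).
    eapply Rle_lt_trans; [exact K|]. nra.
Qed.

Lemma weierstrass (U : C -> Prop) (f : nat -> C -> C) (M : nat -> R) :
  (forall z, U z -> nbhd z U) -> (forall n z, U z -> hol (f n) z) ->
  (forall n z, U z -> Cmod (f n z) <= M n) -> ex_series M ->
  exists s : C -> C, forall z, U z -> cseries (fun n => f n z) (s z) /\ hol s z.
Proof.
  intros HU Hf HM EM.
  destruct (choice (fun z l => U z -> cseries (fun n => f n z) l)) as [s Hs].
  { intros z. destruct (excluded_middle_informative (U z)) as [Hz|Hz].
    - destruct (cseries_exists (fun n => f n z) M) as [l Hl]; auto. now exists l.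
    - exists (RtoC 0). tauto. }
  exists s. intros z Hz. split; auto.
  destruct (HU z Hz) as [d [Hd K]].
  apply (weierstrass_center f M s z d); auto.
Qed.

(** [h K w] is 2 pi times the Taylor remainder of order K, divided by (w - z0)^K. Accumulating zeros
    kill [h K z0] for every K, so that 2 pi f(w) = (w - z0)^K h K w throughout. As |h K w| is at
    most a constant times r^(-K) and |w - z0| < r/2, the right side tends to 0. *)
Lemma local_identity (f : C -> C) (z0 : C) (R0 : R) :
  0 < R0 -> (forall z, disc z0 R0 z -> hol f z) ->
  (forall d, 0 < d -> exists w, w <> z0 /\ disc z0 d w /\ f w = 0) ->
  forall w, disc z0 (R0 / 4) w -> f w = 0.
Proof.
  intros HR Hf Z. assert (P := PI_RGT_0).
  set (r := R0 / 2). assert (Hr : 0 < r) by (unfold r; lra).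
  assert (HrR : r < R0) by (unfold r; lra).
  assert (Hin : forall u : R, disc z0 R0 (circ z0 r (RtoC u))).
  { intros u. unfold disc. rewrite circ_mod; unfold r; lra. }
  assert (Cf : forall u : R, ccont (fun u => f (circ z0 r u)) (RtoC u)).
  { intros u. apply ccont_comp; [apply circ_cont|apply hol_cont, Hf, Hin]. }
  destruct (continuity_ab_maj (fun u : R => Cmod (f (circ z0 r (RtoC u)))) 0 (2 * PI))
    as [um [Hum _]]; [lra| |].
  { intros u _. apply continuity_pt_filterlim.
    apply (ccont_Re_continuous (fun u => RtoC (Cmod (f (circ z0 r u))))).
    apply (ccont_comp (fun z => RtoC (Cmod z)) (fun u => f (circ z0 r u))); auto.
    apply ccont_Cmod. }
  cbv beta in Hum. set (M := Cmod (f (circ z0 r (RtoC um)))) in *.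
  assert (HM0 : 0 <= M) by apply Cmod_ge_0.
  set (k := fun (K : nat) w u => (f (circ z0 r u) *
    ((circ z0 r u - z0) / (circ z0 r u - w)) * (/ (circ z0 r u - z0)) ^ K)%C).
  set (h := fun K w => CInt (k K w)).
  assert (Nd : forall w (u : R), disc z0 (R0 / 4) w -> (circ z0 r u - w)%C <> 0).
  { intros w u Hw. apply circ_neq; [lra|]. unfold disc, r in *. lra. }
  assert (Nc := fun u => circ_neq_center z0 r u Hr).
  assert (Cpw : forall (K : nat) (u : R),
    ccont (fun u => (/ (circ z0 r u - z0)) ^ K)%C (RtoC u)).
  { intros K u. induction K as [|K IH]; simpl; [apply ccont_const|].
    apply ccont_mult; auto. apply (ccont_comp Cinv); [|now apply ccont_inv].
    apply ccont_minus; [apply circ_cont|apply ccont_const]. }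
  assert (Ck : forall K w (u : R), disc z0 (R0 / 4) w -> ccont (k K w) (RtoC u)).
  { intros K w u Hw. unfold k. apply ccont_mult; [apply ccont_mult|]; auto.
    apply ccont_div; [| |now apply Nd];
      apply ccont_minus; first [apply circ_cont|apply ccont_const]. }
  assert (Hh : forall K w, disc z0 (R0 / 4) w -> is_CInt (k K w) (h K w)).
  { intros K w Hw. apply CInt_correct. intros u. now apply Ck. }
  assert (Bh : forall K w, disc z0 (R0 / 4) w -> Cmod (h K w) <= 4 * PI * (M * 2 * (/ r) ^ K)).
  { intros K w Hw. apply (is_CInt_bound _ _ _ (Hh K w Hw)). intros u Hu. unfold k.
    rewrite !Cmod_mult, Cmod_pow, Cmod_inv, Cmod_div, circ_mod by (auto; lra).
    assert (Pr : 0 <= (/ r) ^ K) by (apply pow_le; left; now apply Rinv_0_lt_compat).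
    apply Rmult_le_compat_r; auto.
    apply Rmult_le_compat; [apply Cmod_ge_0| |now apply Hum|].
    - apply Rdiv_le_0_compat; [lra|]. apply Cmod_gt_0. now apply Nd.
    - apply Rle_div_l; [apply Rlt_gt, Cmod_gt_0; now apply Nd|].
      assert (D := circ_dist z0 w r u ltac:(lra) ltac:(unfold disc, r in *; lra)). lra. }
  assert (Hc : disc z0 (R0 / 4) z0) by (apply disc_center; lra).
  assert (Rec : forall K w, disc z0 (R0 / 4) w ->
    h K w = (h K z0 + (w - z0) * h (S K) w)%C).
  { intros K w Hw. eapply is_CInt_unique; [now apply Hh|].
    apply (is_CInt_ext (fun u => k K z0 u + (w - z0) * k (S K) w u)%C).
    - intros u. unfold k. simpl. field. split; [now apply Nd|apply Nc].
    - apply is_CInt_plus; [now apply Hh|]. apply is_CInt_scal. now apply Hh. }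
  assert (Pow : forall K w, disc z0 (R0 / 4) w ->
    (RtoC (2 * PI) * f w)%C = ((w - z0) ^ K * h K w)%C).
  { induction K as [|K IH]; intros w Hw.
    - simpl. rewrite Cmult_1_l. eapply is_CInt_unique; [|now apply Hh].
      apply (is_CInt_ext (fun u => f (circ z0 r u) *
        ((circ z0 r u - z0) / (circ z0 r u - w)))%C).
      + intros u. unfold k. simpl. ring.
      + apply (cauchy_formula f z0 w r R0); auto. unfold disc, r in *; lra.
    (* A zero v close to z0 has h K v = 0, hence |h K z0| = |v - z0| |h (S K) v|, which is
       arbitrarily small because [h (S K)] is bounded. *)
    - assert (H0 : h K z0 = 0).
      { apply Cmod_eq_0. apply Rle_antisym; [|apply Cmod_ge_0].
        apply Rnot_lt_le. intros Hpos.
        set (A := 4 * PI * (M * 2 * (/ r) ^ S K) + 1).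
        assert (HA : 0 < A).
        { unfold A. assert (0 < (/ r) ^ S K) by (apply pow_lt, Rinv_0_lt_compat; lra).
          assert (0 <= 4 * PI * (M * 2 * (/ r) ^ S K)); [|lra].
          apply Rmult_le_pos; [lra|]. apply Rmult_le_pos; lra. }
        destruct (Z (Rmin (R0 / 4) (Cmod (h K z0) / A))) as [v [Nv [Dv Fv]]].
        { apply Rmin_glb_lt; [lra|now apply Rdiv_lt_0_compat]. }
        assert (D1 : disc z0 (R0 / 4) v).
        { unfold disc in *. eapply Rlt_le_trans; [exact Dv|apply Rmin_l]. }
        assert (D2 : Cmod (v - z0) < Cmod (h K z0) / A).
        { eapply Rlt_le_trans; [exact Dv|apply Rmin_r]. }
        apply Rlt_div_r in D2; auto.
        assert (Nv' : (v - z0)%C <> 0) by now apply Cminus_eq_contra.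
        assert (E1 := IH v D1). rewrite Fv, Cmult_0_r in E1.
        assert (E2 : h K v = 0).
        { replace (h K v) with (/ ((v - z0) ^ K) * ((v - z0) ^ K * h K v))%C
            by (field; now apply Cpow_nz).
          rewrite <- E1. ring. }
        assert (E3 := Rec K v D1). rewrite E2 in E3.
        assert (E4 : h K z0 = (- ((v - z0) * h (S K) v))%C).
        { replace (h K z0) with ((h K z0 + (v - z0) * h (S K) v) - (v - z0) * h (S K) v)%C
            by ring. rewrite <- E3. ring. }
        assert (E5 : Cmod (h K z0) = Cmod (v - z0) * Cmod (h (S K) v)).
        { rewrite E4, Cmod_opp, Cmod_mult. reflexivity. }
        assert (E6 := Bh (S K) v D1).
        assert (Cmod (v - z0) * Cmod (h (S K) v) <= Cmod (v - z0) * A).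
        { apply Rmult_le_compat_l; [apply Cmod_ge_0|]. unfold A. lra. }
        lra. }
      rewrite (IH w Hw), (Rec K w Hw), H0. simpl. ring. }
  intros w Hw. apply Cmod_eq_0. apply Rle_antisym; [|apply Cmod_ge_0].
  set (q := Cmod (w - z0) / r).
  assert (Hq : Rabs q < 1).
  { unfold q. rewrite Rabs_pos_eq.
    - apply Rlt_div_l; auto. unfold disc, r in *. lra.
    - apply Rdiv_le_0_compat; [apply Cmod_ge_0|auto]. }
  apply Rnot_lt_le. intros Hpos.
  assert (He : 0 < Cmod (f w) / (4 * M + 1)) by (apply Rdiv_lt_0_compat; lra).
  destruct (pow_lt_1_zero q Hq _ He) as [N HN]. specialize (HN N (Nat.le_refl _)).
  assert (E := Pow N w Hw). apply (f_equal Cmod) in E.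
  rewrite !Cmod_mult, Cmod_pow, Cmod_R, Rabs_pos_eq in E by lra.
  assert (B := Bh N w Hw).
  assert (Hqp : 0 <= q ^ N).
  { apply pow_le. unfold q. apply Rdiv_le_0_compat; [apply Cmod_ge_0|auto]. }
  assert (Q : Cmod (w - z0) ^ N * (4 * PI * (M * 2 * (/ r) ^ N)) = 2 * PI * (4 * M * q ^ N)).
  { unfold q, Rdiv. rewrite Rpow_mult_distr. ring. }
  assert (L : 2 * PI * Cmod (f w) <= 2 * PI * (4 * M * q ^ N)).
  { rewrite E, <- Q. apply Rmult_le_compat_l; [apply pow_le, Cmod_ge_0|exact B]. }
  apply Rmult_le_reg_l in L; [|lra].
  rewrite Rabs_pos_eq in HN by auto. apply Rlt_div_r in HN; [|lra]. nra.
Qed.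

Definition star_shaped (p : C) (U : C -> Prop) : Prop :=
  forall (z : C) (t : R), U z -> 0 <= t <= 1 -> U (p + RtoC t * (z - p))%C.

(** On the segment from [p] to the target, let [T] be the supremum of the times up to which [f]
    vanishes. Zeros accumulate at the point reached at time [T], so [f] vanishes near it and [T]
    cannot be less than 1. *)
Lemma identity_theorem (U : C -> Prop) (f : C -> C) (p : C) :
  (forall z, U z -> nbhd z U) -> star_shaped p U -> (forall z, U z -> hol f z) ->
  (forall d, 0 < d -> exists w, w <> p /\ disc p d w /\ f w = 0) ->
  forall z, U z -> f z = 0.
Proof.
  intros HU Hst Hf Z q Hq.
  assert (Loc : forall z, U z ->
    (forall d, 0 < d -> exists w, w <> z /\ disc z d w /\ f w = 0) ->
    nbhd z (fun w => f w = 0)).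
  { intros z Hz Zz. destruct (HU z Hz) as [d [Hd K]].
    exists (d / 4). split; [lra|]. apply (local_identity f z d); auto. }
  set (g := fun t : R => (p + RtoC t * (q - p))%C).
  assert (Gd : forall s t : R, Cmod (g s - g t) = Rabs (s - t) * Cmod (q - p)).
  { intros s t. unfold g.
    replace (p + RtoC s * (q - p) - (p + RtoC t * (q - p)))%C
      with (RtoC (s - t) * (q - p))%C by (rewrite RtoC_minus; ring).
    now rewrite Cmod_mult, Cmod_R. }
  assert (G0 : g 0 = p) by (unfold g; ring).
  assert (G1 : g 1 = q) by (unfold g; ring).
  assert (Up : U p) by (rewrite <- G0; apply Hst; [auto|lra]).
  destruct (excluded_middle_informative (q = p)) as [->|Npq].
  { exact (nbhd_self _ _ (Loc p Up Z)). }
  assert (Dpq : 0 < Cmod (q - p)) by now apply Cmod_gt_0, Cminus_eq_contra.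
  set (E := fun t => 0 <= t <= 1 /\ forall s, 0 <= s <= t -> f (g s) = 0).
  assert (fp : f p = 0) by exact (nbhd_self _ _ (Loc p Up Z)).
  assert (E0 : E 0).
  { split; [lra|]. intros s Hs. replace s with 0 by lra. now rewrite G0. }
  destruct (completeness E) as [T [Tub Tlub]].
  { exists 1. intros t [Ht _]. lra. }
  { now exists 0. }
  assert (T0 : 0 <= T) by (apply Tub; exact E0).
  assert (T1 : T <= 1) by (apply Tlub; intros t [Ht _]; lra).
  assert (Below : forall s, 0 <= s < T -> f (g s) = 0).
  { intros s Hs. destruct (excluded_middle_informative (exists t, E t /\ s < t)) as [[t [Et Hst']]|N].
    - apply Et. lra.
    - exfalso. assert (T <= s); [|lra]. apply Tlub. intros t Et.
      apply Rnot_lt_le. intros K. apply N. now exists t. }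
  assert (UT : U (g T)) by (apply Hst; auto; lra).
  destruct (Loc (g T) UT) as [d [Hd Hz]].
  { destruct (Req_dec T 0) as [->|NT]; [now rewrite G0|].
    intros d Hd. set (s := Rmax 0 (T - d / (2 * Cmod (q - p)))).
    assert (Hdd : 0 < d / (2 * Cmod (q - p))) by (apply Rdiv_lt_0_compat; lra).
    assert (Hs : 0 <= s < T).
    { unfold s. split; [apply Rmax_l|]. apply Rmax_lub_lt; lra. }
    assert (Hs2 : T - s <= d / (2 * Cmod (q - p))).
    { unfold s. generalize (Rmax_r 0 (T - d / (2 * Cmod (q - p)))). lra. }
    exists (g s). split; [|split; [|now apply Below]].
    - intros K. assert (K2 := Gd s T). rewrite K in K2.
      replace (g T - g T)%C with (RtoC 0) in K2 by ring. rewrite Cmod_0 in K2.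
      rewrite Rabs_left in K2 by lra. nra.
    - unfold disc. rewrite Gd, Rabs_left by lra.
      apply Rle_lt_trans with (d / (2 * Cmod (q - p)) * Cmod (q - p)).
      + apply Rmult_le_compat_r; lra.
      + replace (d / (2 * Cmod (q - p)) * Cmod (q - p)) with (d / 2) by (field; lra). lra. }
  set (e := d / (2 * Cmod (q - p))).
  assert (He : 0 < e) by (apply Rdiv_lt_0_compat; lra).
  assert (Near : forall s, T <= s <= T + e -> f (g s) = 0).
  { intros s Hs. apply Hz. unfold disc. rewrite Gd, Rabs_pos_eq by lra.
    apply Rle_lt_trans with (e * Cmod (q - p)); [apply Rmult_le_compat_r; lra|].
    unfold e. replace (d / (2 * Cmod (q - p)) * Cmod (q - p)) with (d / 2) by (field; lra). lra. }
  destruct (Rlt_dec T 1) as [L|L].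
  - exfalso. assert (Emin : E (Rmin 1 (T + e))).
    { split; [split; [apply Rmin_glb; lra|apply Rmin_l]|].
      intros s Hs. assert (s <= T + e) by (eapply Rle_trans; [apply Hs|apply Rmin_r]).
      destruct (Rlt_dec s T); [apply Below; lra|apply Near; lra]. }
    apply Tub in Emin. unfold Rmin in Emin. destruct (Rle_dec 1 (T + e)); lra.
  - rewrite <- G1. apply Near. lra.
Qed.

Lemma identity_from_reals (U : C -> Prop) (f g : C -> C) (p d : R) :
  (forall z, U z -> nbhd z U) -> star_shaped (RtoC p) U ->
  (forall z, U z -> hol f z) -> (forall z, U z -> hol g z) ->
  0 < d -> (forall x : R, Rabs (x - p) < d -> f (RtoC x) = g (RtoC x)) ->
  forall z, U z -> f z = g z.
Proof.
  intros HU Hst Hf Hg Hd E z Hz. apply Ceq_minus.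
  apply (identity_theorem U (fun w => f w - g w)%C (RtoC p)); auto.
  - intros w Hw. apply hol_minus; auto.
  - intros e He. set (h := Rmin (d / 2) (e / 2)).
    assert (Hh : 0 < h) by (apply Rmin_glb_lt; lra).
    assert (H1 := Rmin_l (d / 2) (e / 2)). assert (H2 := Rmin_r (d / 2) (e / 2)).
    fold h in H1, H2.
    exists (RtoC (p + h)). split; [|split].
    + intros K. apply RtoC_inj in K. lra.
    + unfold disc. rewrite <- RtoC_minus, Cmod_R.
      replace (p + h - p) with h by ring. rewrite Rabs_pos_eq; lra.
    + rewrite E; [ring|]. replace (p + h - p) with h by ring. rewrite Rabs_pos_eq; lra.
Qed.

(** * Extension to half-planes *)

Lemma sum_n_Csum (c : nat -> C) (n : nat) :
  @sum_n C_R_NormedModule c n = Csum c (S n).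
Proof.
  induction n as [|n IH].
  - rewrite sum_O. simpl. now rewrite Cplus_0_l.
  - rewrite sum_Sn, IH. reflexivity.
Qed.

Lemma is_pseries_cseries (a : nat -> C) (h : R) (l : C) :
  @is_pseries R_AbsRing C_R_NormedModule a h l ->
  cseries (fun n => a n * RtoC h ^ n)%C l.
Proof.
  intros H e He. assert (He2 : 0 < e / 2) by lra.
  assert (F : eventually (fun n => @ball C_R_NormedModule l (mkposreal _ He2)
    (@sum_n C_R_NormedModule (fun k => scal (pow_n h k) (a k)) n)))
    by exact (H _ (locally_ball _ (mkposreal _ He2))).
  destruct F as [N HN]. exists (S N). intros n Hn. destruct n as [|n]; [lia|].
  specialize (HN n ltac:(lia)). rewrite sum_n_Csum in HN.
  replace (Csum (fun n => a n * RtoC h ^ n)%C (S n))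
    with (Csum (fun k => @scal R_AbsRing C_R_NormedModule (pow_n h k) (a k)) (S n)).
  - eapply Rle_lt_trans; [apply Cmod_le_Rabs|]. destruct HN as [H1 H2].
    replace e with (e / 2 + e / 2) by lra. apply Rplus_lt_compat; [exact H1|exact H2].
  - generalize (S n). intros m. induction m as [|m IH]; simpl; auto. rewrite IH.
    f_equal. rewrite scal_R_Cmult, Cmult_comm. f_equal.
    now rewrite <- RtoC_pow.
Qed.

Lemma cseries_terms_bounded (b : nat -> C) (l : C) :
  cseries b l -> exists B, forall n, Cmod (b n) <= B.
Proof.
  intros H. destruct (H 1 Rlt_0_1) as [N HN].
  assert (F : forall m, exists B, forall n, (n < m)%nat -> Cmod (b n) <= B).
  { induction m as [|m [B IH]].
    - exists 0. intros n Hn. lia.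
    - exists (Rmax B (Cmod (b m))). intros n Hn.
      destruct (Nat.eq_dec n m) as [->|]; [apply Rmax_r|].
      eapply Rle_trans; [apply IH; lia|apply Rmax_l]. }
  destruct (F N) as [B HB]. exists (Rmax B 2). intros n.
  destruct (Nat.lt_ge_cases n N) as [L|L].
  - eapply Rle_trans; [now apply HB|apply Rmax_l].
  - eapply Rle_trans; [|apply Rmax_r].
    assert (H1 := HN n L). assert (H2 := HN (S n) ltac:(lia)).
    replace (b n) with ((Csum b (S n) - l) - (Csum b n - l))%C by (simpl; ring).
    eapply Rle_trans; [apply Cmod_triangle|]. rewrite Cmod_opp. lra.
Qed.

Lemma hol_pow (f : C -> C) (n : nat) (z : C) : hol f z -> hol (fun w => f w ^ n)%C z.
Proof.
  intros H. induction n as [|n IH]; simpl; [apply hol_const|now apply hol_mult].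
Qed.

(** Convergence at x0 + r/2 bounds |a n| (r/2)^n by some B, so on the disc of radius r/4 the terms
    are dominated by B 2^(-n). *)
Lemma real_analytic_extension (D : R -> Prop) (f : R -> C) (x0 : R) :
  real_analytic_on D f -> D x0 ->
  exists (P : C -> C) (r : R), 0 < r /\
    (forall z, disc (RtoC x0) r z -> hol P z) /\
    (forall x : R, Rabs (x - x0) < r -> P (RtoC x) = f x).
Proof.
  intros H Hx. destruct (H x0 Hx) as [a [r [Hr Ha]]].
  destruct (cseries_terms_bounded _ _
    (is_pseries_cseries a (r / 2) (f (x0 + r / 2)) ltac:(
       replace (r / 2) with (x0 + r / 2 - x0) at 1 by ring; apply Ha;
       replace (x0 + r / 2 - x0) with (r / 2) by ring; rewrite Rabs_pos_eq; lra)))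
    as [B HB].
  destruct (weierstrass (disc (RtoC x0) (r / 4)) (fun n z => a n * (z - RtoC x0) ^ n)%C
    (fun n => B * (/ 2) ^ n)) as [P HP].
  - intros z Hz. now apply nbhd_open_disc.
  - intros n z _. apply hol_mult; [apply hol_const|].
    apply (hol_pow (fun z => z - RtoC x0)%C).
    apply hol_minus; [apply hol_id|apply hol_const].
  - intros n z Hz. specialize (HB n). rewrite Cmod_mult, Cmod_pow in *.
    rewrite Cmod_R, Rabs_pos_eq in HB by lra.
    assert (K : Cmod (z - RtoC x0) ^ n <= (r / 2) ^ n * (/ 2) ^ n).
    { rewrite <- Rpow_mult_distr. apply pow_incr. unfold disc in Hz.
      split; [apply Cmod_ge_0|]. lra. }
    apply Rle_trans with (Cmod (a n) * ((r / 2) ^ n * (/ 2) ^ n)).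
    + apply Rmult_le_compat_l; [apply Cmod_ge_0|auto].
    + rewrite <- Rmult_assoc. apply Rmult_le_compat_r; auto. apply pow_le. lra.
  - apply (ex_series_scal (V := R_NormedModule)). apply ex_series_geom.
    rewrite Rabs_pos_eq; lra.
  - exists P, (r / 4). split; [lra|]. split.
    + intros z Hz. now apply HP.
    + intros x Hx'.
      assert (Dx : disc (RtoC x0) (r / 4) (RtoC x)).
      { unfold disc. now rewrite <- RtoC_minus, Cmod_R. }
      eapply (ctends_unique eventually); [apply HP, Dx|].
      assert (K := is_pseries_cseries a (x - x0) (f x) (Ha x ltac:(lra))).
      rewrite RtoC_minus in K. exact K.
Qed.

Lemma Rpower_le_antitone (a b c : R) : 0 <= c -> 0 < a <= b -> Rpower b (- c) <= Rpower a (- c).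
Proof.
  intros Hc Hab. rewrite !Rpower_Ropp. apply Rinv_le_contravar.
  - apply exp_pos.
  - now apply Rle_Rpower_l.
Qed.

(** Comparison of x^(-c-1) with the integral of the same power over [x - 1, x], obtained from 1 + u
    <= exp u. Being telescoping, it gives both the convergence of the series below and the size of
    its sum. *)
Lemma Rpower_telescope (c x : R) :
  0 < c -> 1 < x -> Rpower x (- c - 1) <= / c * (Rpower (x - 1) (- c) - Rpower x (- c)).
Proof.
  intros Hc Hx.
  assert (E : Rpower (x - 1) (- c) = Rpower x (- c) * exp (- c * ln (1 - / x))).
  { unfold Rpower. rewrite <- exp_plus. f_equal.
    rewrite <- Rmult_plus_distr_l. f_equal. rewrite <- ln_mult; [f_equal; field; lra|lra|].
    assert (/ x < 1) by (rewrite <- Rinv_1; apply Rinv_lt_contravar; lra). lra. }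
  assert (Hi : 0 < / x < 1).
  { split; [apply Rinv_0_lt_compat; lra|].
    rewrite <- Rinv_1 at 1. apply Rinv_lt_contravar; lra. }
  assert (L : ln (1 - / x) <= - / x).
  { rewrite <- (ln_exp (- / x)). apply ln_le; [lra|].
    generalize (exp_ineq1_le (- / x)). lra. }
  assert (X : 1 + c * / x <= exp (- c * ln (1 - / x))).
  { eapply Rle_trans; [apply exp_ineq1_le|]. apply exp_le. nra. }
  assert (P : Rpower x (- c - 1) = Rpower x (- c) * / x).
  { unfold Rminus. rewrite Rpower_plus, Rpower_Ropp with (y := 1), Rpower_1 by lra.
    reflexivity. }
  assert (Q : 0 < Rpower x (- c)) by apply exp_pos.
  rewrite E, P. set (e := exp (- c * ln (1 - / x))) in *.
  apply Rmult_le_reg_l with c; auto.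
  replace (c * (/ c * (Rpower x (- c) * e - Rpower x (- c))))
    with (Rpower x (- c) * (e - 1)) by (field; lra).
  replace (c * (Rpower x (- c) * / x)) with (Rpower x (- c) * (c * / x)) by ring.
  apply Rmult_le_compat_l; lra.
Qed.

(** * The equation on the positive half-line and its series in a right half-plane *)

Section RealEquation.
Variables (s : C) (psi : R -> C).
Hypothesis Hs : 0 < Re s.
Let w : C := (- (RtoC 2 * s))%C.
Let c : R := 2 * Re s.
Hypothesis Heq : forall x : R, 0 < x ->
  psi x = (psi (x + 1)%R + Cpower_pos (x + 1) w * psi (x / (x + 1))%R)%C.
Hypothesis Hgrowth : forall eps : R, 0 < eps -> exists X : R, forall x : R, X < x ->
  Cmod (psi x) <= eps * Rpower x (Rmin 0 (1 - 2 * Re s)).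

Lemma three_term_iterate (N : nat) (x : R) : 0 < x ->
  (psi x - psi (x + INR N))%C =
  Csum (fun n => Cpower_pos (x + INR n + 1) w * psi ((x + INR n) / (x + INR n + 1)))%C N.
Proof.
  intros Hx. induction N as [|N IH].
  - simpl. rewrite Rplus_0_r. ring.
  - simpl Csum. rewrite <- IH, S_INR.
    rewrite (Heq (x + INR N)) by (generalize (pos_INR N); lra).
    rewrite <- Rplus_assoc. ring.
Qed.

Lemma Re_w : Re w = - c.
Proof. unfold w, c. simpl. unfold Re. ring. Qed.

Lemma Cmod_Cpower_pos (x : R) (v : C) : Cmod (Cpower_pos x v) = Rpower x (Re v).
Proof. unfold Cpower_pos. rewrite Cmod_Cexp, re_scal_r. reflexivity. Qed.

Lemma Csum_near (a : nat -> C) (l : C) (d : R) (n : nat) :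
  (forall k, (k < n)%nat -> Cmod (a k - l) <= d) ->
  Cmod (Csum a n - RtoC (INR n) * l) <= INR n * d.
Proof.
  induction n as [|n IH]; intros H.
  - simpl. replace (0 - 0 * l)%C with (RtoC 0) by ring. rewrite Cmod_0. lra.
  - rewrite S_INR. simpl Csum.
    replace (Csum a n + a n - RtoC (INR n + 1) * l)%C
      with ((Csum a n - RtoC (INR n) * l) + (a n - l))%C by (rewrite RtoC_plus; ring).
    eapply Rle_trans; [apply Cmod_triangle|].
    assert (Cmod (Csum a n - RtoC (INR n) * l) <= INR n * d) by (apply IH; intros; apply H; lia).
    assert (Cmod (a n - l) <= d) by (apply H; lia). lra.
Qed.

(* If [psi 1 <> 0] then the [k] terms of [psi x - psi (x + k)] with [x = m k]
   are nearly parallel and their sum is of size [x^(1 - 2 sigma)], against the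
   growth condition. *)
Lemma psi_one_eq_0 :
  (forall eps : R, 0 < eps -> exists d : R, 0 < d /\
     forall x : R, Rabs (x - 1) < d -> Cmod (psi x - psi 1) <= eps) ->
  psi 1 = 0.
Proof.
  intros Hc. apply Cmod_eq_0. apply Rle_antisym; [|apply Cmod_ge_0].
  apply Rnot_lt_le. intros Ha. set (a := Cmod (psi 1)) in *.
  destruct (Hc (a / 8)) as [d [Hd Hpsi]]; [lra|].
  (* Over the window [x, x + k] with x = m k the logarithm varies by at most 1/m, so this [m] makes
     the exponent [h] below at most 1/68 in modulus, ample for |exp h - 1| <= 1/4. *)
  destruct (nfloor_ex (68 * Cmod w + 1)) as [m0 Hm0].
  { generalize (Cmod_ge_0 w). lra. }
  set (m := INR (S m0)).
  assert (Hm : 68 * Cmod w + 1 < m) by (unfold m; rewrite S_INR; lra).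
  assert (Gw := Cmod_ge_0 w).
  (* After multiplication by x^(2 sigma), this tolerance bounds the difference of the two values of
     [psi] by 2 (a/(8 m)) x = k a/4, half of the lower bound k a/2. *)
  destruct (Hgrowth (a / (8 * m))) as [X HX]; [apply Rdiv_lt_0_compat; lra|].
  set (Y := Rmax 0 (Rmax X (/ d))).
  destruct (nfloor_ex Y) as [k0 Hk0]; [apply Rmax_l|].
  set (k := S k0). assert (Hk : Y < INR k) by (unfold k; rewrite S_INR; lra).
  assert (HY0 : 0 <= Y) by apply Rmax_l.
  assert (HYX : X <= Y) by (eapply Rle_trans; [|apply Rmax_r]; apply Rmax_l).
  assert (HYd : / d <= Y) by (eapply Rle_trans; [|apply Rmax_r]; apply Rmax_r).
  assert (Hk1 : 1 <= INR k).
  { unfold k. rewrite S_INR. generalize (pos_INR k0). lra. }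
  set (x := m * INR k).
  assert (Hxk : INR k <= x) by (unfold x; nra).
  assert (I := three_term_iterate k x ltac:(lra)).
  (* Multiplying by x^(2s) brings every term of the window close to [psi 1]. *)
  set (b := fun n => (Cpower_pos x (- w) *
    (Cpower_pos (x + INR n + 1) w * psi ((x + INR n) / (x + INR n + 1))))%C).
  assert (Eb : Csum b k = (Cpower_pos x (- w) * (psi x - psi (x + INR k)%R))%C).
  { rewrite I. generalize k. intros j. unfold b. induction j as [|j IH]; simpl; [ring|].
    rewrite IH. ring. }
  assert (Near : Cmod (Csum b k - RtoC (INR k) * psi 1) <= INR k * (a / 2)).
  { apply Csum_near. intros n Hn. unfold b. set (y := x + INR n + 1).
    assert (Hn1 : INR n + 1 <= INR k) by (rewrite <- S_INR; apply le_INR; lia).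
    assert (Pn := pos_INR n).
    set (h := (w * RtoC (ln y - ln x))%C).
    assert (Eh : (Cpower_pos x (- w) * Cpower_pos y w)%C = Cexp h).
    { unfold Cpower_pos. rewrite <- Cexp_plus. f_equal. unfold h.
      rewrite RtoC_minus. ring. }
    assert (Lh : 0 <= ln y - ln x <= / m).
    { split; [assert (ln x <= ln y) by (apply ln_le; unfold y; lra); lra|].
      rewrite <- ln_div by (unfold y; lra).
      rewrite <- (ln_exp (/ m)). apply ln_le; [apply Rdiv_lt_0_compat; unfold y; lra|].
      eapply Rle_trans; [|apply exp_ineq1_le].
      apply Rle_div_l; [lra|].
      replace ((1 + / m) * x) with (x + INR k) by (unfold x; field; lra). unfold y. lra. }
    assert (Hh : Cmod h <= / 68).
    { unfold h. rewrite Cmod_mult, Cmod_R, Rabs_pos_eq by lra.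
      apply Rle_trans with (Cmod w * / m); [apply Rmult_le_compat_l; lra|].
      apply Rmult_le_reg_r with m; [lra|]. rewrite Rmult_assoc, Rinv_l by lra. lra. }
    assert (Eq := Cexp_quadratic h ltac:(lra)).
    assert (E1 : Cmod (Cexp h - 1) <= / 4).
    { replace (Cexp h - 1)%C with ((Cexp h - 1 - h) + h)%C by ring.
      eapply Rle_trans; [apply Cmod_triangle|]. generalize (Cmod_ge_0 h). nra. }
    assert (Py : Cmod (psi ((x + INR n) / y)%R - psi 1) <= a / 8).
    { apply Hpsi. replace ((x + INR n) / y - 1) with (- / y) by (unfold y; field; lra).
      rewrite Rabs_Ropp, Rabs_pos_eq by (left; apply Rinv_0_lt_compat; unfold y; lra).
      rewrite <- (Rinv_inv d). apply Rinv_lt_contravar; [|unfold y; lra].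
      apply Rmult_lt_0_compat; [now apply Rinv_0_lt_compat|unfold y; lra]. }
    set (p := psi ((x + INR n) / y)%R) in *.
    rewrite Cmult_assoc, Eh.
    replace (Cexp h * p - psi 1)%C with ((Cexp h - 1) * p + (p - psi 1))%C by ring.
    eapply Rle_trans; [apply Cmod_triangle|]. rewrite Cmod_mult.
    assert (Cmod p <= 9 / 8 * a).
    { generalize (Cmod_rev_triangle p (psi 1)). fold a. lra. }
    assert (Cmod (Cexp h - 1) * Cmod p <= / 4 * (9 / 8 * a)).
    { apply Rmult_le_compat; auto; apply Cmod_ge_0. }
    lra. }
  set (mu := Rmin 0 (1 - 2 * Re s)) in *.
  assert (Hmu : mu <= 0 /\ mu <= 1 - c) by (unfold mu, c; split; [apply Rmin_l|apply Rmin_r]).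
  assert (Big : INR k * (a / 2) <= Cmod (Csum b k)).
  { assert (T := Cmod_rev_triangle (RtoC (INR k) * psi 1) (Csum b k)).
    rewrite Cmod_minus_sym, Cmod_mult, Cmod_R, Rabs_pos_eq in T by lra. fold a in T. lra. }
  assert (Small : Cmod (Csum b k) <= 2 * (a / (8 * m)) * x).
  { rewrite Eb, Cmod_mult, Cmod_Cpower_pos.
    replace (Re (- w)) with c.
    2:{ unfold w, c. simpl. unfold Re. ring. }
    assert (D : Cmod (psi x - psi (x + INR k)%R) <= 2 * (a / (8 * m)) * Rpower x mu).
    { eapply Rle_trans; [apply Cmod_triangle|]. rewrite Cmod_opp.
      assert (H1 := HX x ltac:(lra)). assert (H2 := HX (x + INR k) ltac:(lra)).
      assert (H3 : Rpower (x + INR k) mu <= Rpower x mu).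
      { replace mu with (- (- mu)) by ring. apply Rpower_le_antitone; lra. }
      assert (0 < a / (8 * m)) by (apply Rdiv_lt_0_compat; lra). nra. }
    assert (D2 : Rpower x c * Rpower x mu <= x).
    { rewrite <- Rpower_plus. rewrite <- (Rpower_1 x) at 2 by lra. apply Rle_Rpower; lra. }
    assert (0 < a / (8 * m)) by (apply Rdiv_lt_0_compat; lra).
    assert (0 < Rpower x c) by apply exp_pos.
    apply Rle_trans with (Rpower x c * (2 * (a / (8 * m)) * Rpower x mu)).
    - apply Rmult_le_compat_l; lra.
    - nra. }
  replace (2 * (a / (8 * m)) * x) with (INR k * (a / 4)) in Small by (unfold x; field; lra).
  nra.
Qed.

(** Replaces |z + n + 1| by the real quantity |z| + n + 1, to which the telescoping bound applies,
    at the cost of a factor 2. *)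
Lemma Cmod_plus_INR (z : C) (n : nat) :
  0 <= Re z -> (Cmod z + INR n + 1) / 2 <= Cmod (z + RtoC (INR n + 1)).
Proof.
  intros Hz. assert (Pn := pos_INR n). assert (G := Cmod_ge_0 z).
  apply Rsqr_incr_0; [|lra|apply Cmod_ge_0]. unfold Rsqr.
  rewrite Cmod_sqr. assert (Q := Cmod_sqr z).
  change (Re (z + RtoC (INR n + 1))) with (Re z + (INR n + 1)).
  change (Im (z + RtoC (INR n + 1))) with (Im z + 0).
  nra.
Qed.

(** [P] continues [psi] near 1 and is evaluated at 1 - 1/(z + n + 1). Since [P] vanishes at 1, the
    n-th term is O((|z| + n + 1)^(-2 sigma - 1)), and the telescoping bound sums these to O(|z|^(-2
    sigma)). *)
Lemma half_plane_extension (P : C -> C) (r : R) :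
  0 < r -> (forall z, disc 1 r z -> hol P z) ->
  (forall x : R, Rabs (x - 1) < r -> P (RtoC x) = psi x) ->
  exists (G : C -> C) (R1 K : R), 1 <= R1 /\
    (forall z, R1 < Re z -> hol G z /\ Cmod (G z) <= K * Rpower (Cmod z) (- (2 * Re s))) /\
    (forall x : R, R1 < x -> G (RtoC x) = psi x).
Proof.
  intros Hr HP HPx. fold c.
  assert (Hc0 : 0 < c) by (unfold c; lra).
  assert (P1 : P 1 = 0).
  { rewrite HPx by (rewrite Rminus_diag, Rabs_R0; auto). apply psi_one_eq_0.
    intros e He. destruct (hol_cont P 1 (HP 1 (disc_center 1 r Hr)) e He) as [d [Hd K]].
    exists (Rmin d r). split; [now apply Rmin_glb_lt|]. intros x Hx.
    assert (H1 := Rlt_le_trans _ _ _ Hx (Rmin_l _ _)).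
    assert (H2 := Rlt_le_trans _ _ _ Hx (Rmin_r _ _)).
    rewrite <- (HPx x H2), <- (HPx 1) by (rewrite Rminus_diag, Rabs_R0; auto).
    left. apply K. unfold disc. now rewrite <- RtoC_minus, Cmod_R. }
  assert (Lin : exists A r1, 0 < A /\ 0 < r1 <= r /\
    forall v, Cmod v < r1 -> Cmod (P (1 - v)%C) <= A * Cmod v).
  { destruct (HP 1 (disc_center 1 r Hr)) as [P' HP'].
    destruct (nbhd_self _ _ HP') as [[q [Hq [Cq Eq]]] _].
    destruct (filter_and _ _ Eq (ctends_bound _ _ _ Cq)) as [d [Hd H]].
    exists (Cmod (q 1) + 1), (Rmin d r). repeat split.
    - generalize (Cmod_ge_0 (q 1)). lra.
    - now apply Rmin_glb_lt.
    - apply Rmin_r.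
    - intros v Hv. destruct (H (1 - v)%C) as [H1 H2].
      { unfold disc. replace (1 - v - 1)%C with (- v)%C by ring. rewrite Cmod_opp.
        eapply Rlt_le_trans; [exact Hv|apply Rmin_l]. }
      rewrite P1 in H1. replace (P (1 - v)%C) with (P (1 - v) - 0)%C by ring.
      rewrite H1. replace (1 - v - 1)%C with (- v)%C by ring.
      rewrite Cmod_mult, Cmod_opp. apply Rmult_le_compat_r; [apply Cmod_ge_0|exact H2]. }
  destruct Lin as [A [r1 [HA [Hr1 Lin]]]].
  (* For Re z beyond 1/r1, every 1/(z + n + 1) has modulus below [r1] and falls under the linear
     bound. *)
  set (R1 := Rmax 1 (/ r1)).
  assert (HR1 : 1 <= R1) by apply Rmax_l.
  assert (HR1' : / r1 <= R1) by apply Rmax_r.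
  set (Z := fun (n : nat) z => (z + RtoC (INR n + 1))%C).
  set (f := fun n z => (Cpow_principal (Z n z) w * P (1 - / Z n z))%C).
  set (E := exp (PI * Rabs (Im w))).
  set (B := E * A * Rpower 2 (c + 1)).
  assert (HE : 0 < E) by apply exp_pos.
  assert (HB : 0 < B).
  { unfold B. apply Rmult_lt_0_compat; [now apply Rmult_lt_0_compat|apply exp_pos]. }
  assert (ZRe : forall n z, Re (Z n z) = Re z + (INR n + 1)) by reflexivity.
  assert (Zin : forall n z, R1 < Re z ->
    0 < Re (Z n z) /\ Z n z <> 0 /\ Cmod (/ Z n z) < r1).
  { intros n z Hz. assert (Pn := pos_INR n).
    assert (H0 : 0 < Re (Z n z)) by (rewrite ZRe; lra).
    assert (N : Z n z <> 0) by now apply slit_plane_neq_0, slit_plane_Re.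
    repeat split; auto. rewrite Cmod_inv by auto.
    rewrite <- (Rinv_inv r1).
    assert (R1 < Cmod (Z n z)).
    { eapply Rlt_le_trans; [|eapply Rle_trans; [apply Rle_abs|apply Rabs_Re_le]].
      rewrite ZRe. lra. }
    apply Rinv_lt_contravar; [|lra].
    apply Rmult_lt_0_compat; [apply Rinv_0_lt_compat|]; lra. }
  assert (Bf : forall n z, R1 < Re z ->
    Cmod (f n z) <= B * Rpower (Cmod z + INR n + 1) (- c - 1)).
  { intros n z Hz. destruct (Zin n z Hz) as [H0 [N Hs1]]. unfold f. rewrite Cmod_mult.
    assert (Pn := pos_INR n).
    assert (Hzm : 1 < Cmod z).
    { eapply Rlt_le_trans; [|eapply Rle_trans; [apply Rle_abs|apply Rabs_Re_le]]. lra. }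
    assert (D := Cmod_plus_INR z n ltac:(lra)). fold (Z n z) in D.
    set (y := Cmod z + INR n + 1) in *. assert (Hy : 1 < y) by (unfold y; lra).
    assert (Hm : 0 < Cmod (Z n z)) by lra.
    apply Rle_trans with (E * Rpower (Cmod (Z n z)) (- c) * (A * / Cmod (Z n z))).
    { apply Rmult_le_compat; try apply Cmod_ge_0.
      - eapply Rle_trans; [apply Cmod_Cpow_le|]. fold E. rewrite Re_w. lra.
      - eapply Rle_trans; [apply Lin; auto|]. rewrite Cmod_inv by auto. lra. }
    replace (E * Rpower (Cmod (Z n z)) (- c) * (A * / Cmod (Z n z)))
      with (E * A * Rpower (Cmod (Z n z)) (- (c + 1))).
    2:{ replace (- (c + 1)) with (- c + - (1)) by ring.
        rewrite Rpower_plus, (Rpower_Ropp _ 1), Rpower_1 by lra. ring. }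
    unfold B. rewrite Rmult_assoc with (r1 := E * A). apply Rmult_le_compat_l; [nra|].
    eapply Rle_trans; [apply Rpower_le_antitone with (a := y / 2); lra|].
    right. replace (- c - 1) with (- (c + 1)) by ring.
    rewrite !Rpower_Ropp. unfold Rdiv.
    rewrite <- Rpower_mult_distr by lra.
    rewrite Rinv_mult. rewrite <- Rpower_Ropp with (x := / 2).
    replace (Rpower (/ 2) (- (c + 1))) with (Rpower 2 (c + 1)); [ring|].
    unfold Rpower. rewrite ln_Rinv by lra. f_equal. ring. }
  assert (Tel : forall y n, 1 <= y ->
    B * Rpower (y + INR n + 1) (- c - 1) <=
    B * / c * (Rpower (y + INR n) (- c) - Rpower (y + INR (S n)) (- c))).
  { intros y n Hy. assert (Pn := pos_INR n). rewrite Rmult_assoc.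
    apply Rmult_le_compat_l; [lra|].
    eapply Rle_trans; [apply Rpower_telescope; lra|].
    rewrite S_INR. replace (y + INR n + 1 - 1) with (y + INR n) by ring.
    rewrite Rplus_assoc. lra. }
  assert (BE : ex_series (fun n => B * Rpower (1 + INR n + 1) (- c - 1))).
  { apply ex_finite_lim_seq_incr with (M := B * / c * Rpower 1 (- c)).
    - intros n. rewrite sum_Sn. unfold plus; simpl.
      assert (0 < Rpower (1 + INR (S n) + 1) (- c - 1)) by apply exp_pos.
      change (match n with O => 1 | S _ => INR n + 1 end) with (INR (S n)). nra.
    - assert (T : forall n, sum_n (fun n => B * Rpower (1 + INR n + 1) (- c - 1)) n <=
        B * / c * (Rpower 1 (- c) - Rpower (1 + INR (S n)) (- c))).
      { induction n as [|n IH].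
        - rewrite sum_O. eapply Rle_trans; [apply Tel; lra|].
          change (INR 0) with 0. rewrite Rplus_0_r. lra.
        - rewrite sum_Sn. unfold plus; cbn [AbelianMonoid.plus].
          eapply Rle_trans; [apply Rplus_le_compat; [exact IH|apply Tel; lra]|]. lra. }
      intros n. eapply Rle_trans; [apply T|]. apply Rmult_le_compat_l.
      + apply Rmult_le_pos; [lra|left; now apply Rinv_0_lt_compat].
      + assert (0 < Rpower (1 + INR (S n)) (- c)) by apply exp_pos. lra. }
  assert (Zm : forall z, R1 < Re z -> 1 <= Cmod z).
  { intros z Hz. left. eapply Rlt_le_trans; [|eapply Rle_trans; [apply Rle_abs|apply Rabs_Re_le]].
    lra. }
  destruct (weierstrass (fun z => R1 < Re z) f
    (fun n => B * Rpower (1 + INR n + 1) (- c - 1))) as [G HG]; auto.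
  { intros z Hz. exists (Re z - R1). split; [lra|]. intros v Hv. unfold disc in Hv.
    assert (K := Rabs_Re_le (v - z)). change (Re (v - z)) with (Re v - Re z) in K.
    apply Rabs_le_between in K. lra. }
  { intros n z Hz. destruct (Zin n z Hz) as [H0 [N Hs1]].
    assert (HZ : hol (Z n) z) by (apply hol_plus; [apply hol_id|apply hol_const]).
    unfold f. apply hol_mult.
    - apply (hol_comp (fun v => Cpow_principal v w) (Z n)); auto.
      apply hol_Cpow, slit_plane_Re, H0.
    - apply (hol_comp P (fun z => 1 - / Z n z)%C).
      + apply hol_minus; [apply hol_const|]. apply (hol_comp Cinv); auto. now apply hol_inv.
      + apply HP. unfold disc.
        replace (1 - / Z n z - 1)%C with (- / Z n z)%C by ring. rewrite Cmod_opp. lra. }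
  { intros n z Hz. eapply Rle_trans; [now apply Bf|].
    apply Rmult_le_compat_l; [lra|]. replace (- c - 1) with (- (c + 1)) by ring.
    assert (Pn := pos_INR n). assert (Q := Zm z Hz). apply Rpower_le_antitone; lra. }
  exists G, R1, (B * / c). split; [auto|]. split.
  - intros z Hz. destruct (HG z Hz) as [H1 H2]. split; auto.
    apply (ctends_Cmod_le eventually (Csum (fun n => f n z))); auto.
    apply filter_forall. intros n.
    assert (Q := Zm z Hz).
    assert (T : Cmod (Csum (fun n => f n z) n) <=
      B * / c * (Rpower (Cmod z) (- c) - Rpower (Cmod z + INR n) (- c))).
    { induction n as [|n IH].
      - simpl. rewrite Cmod_0, Rplus_0_r. lra.
      - simpl Csum. eapply Rle_trans; [apply Cmod_triangle|].
        eapply Rle_trans; [apply Rplus_le_compat; [exact IH|]|].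
        + eapply Rle_trans; [now apply Bf|now apply Tel].
        + lra. }
    eapply Rle_trans; [exact T|]. apply Rmult_le_compat_l.
    + apply Rmult_le_pos; [lra|left; now apply Rinv_0_lt_compat].
    + assert (0 < Rpower (Cmod z + INR n) (- c)) by apply exp_pos. lra.
  - intros x Hx.
    destruct (HG (RtoC x)) as [H1 _]; [exact Hx|].
    apply (ctends_unique eventually _ _ _ H1).
    (* By the iterated equation the partial sums are psi x - psi (x + N); the growth exponent is at
       most 0, so psi (x + N) tends to 0. *)
    apply (ctends_ext eventually (fun N => psi x - psi (x + INR N)%R)%C).
    + apply filter_forall. intros N. rewrite three_term_iterate by lra.
      induction N as [|N IH]; simpl; [auto|]. rewrite IH. f_equal.
      assert (PN := pos_INR N).
      assert (EZ : Z N (RtoC x) = RtoC (x + INR N + 1)).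
      { unfold Z. rewrite <- RtoC_plus. f_equal. ring. }
      destruct (Zin N (RtoC x)) as [H0 [Nz Hs1]]; [exact Hx|].
      unfold f. rewrite EZ in *. rewrite Cpow_RtoC by lra. f_equal.
      rewrite <- RtoC_inv in * by lra. rewrite <- RtoC_minus.
      replace (1 - / (x + INR N + 1)) with ((x + INR N) / (x + INR N + 1)) by (field; lra).
      symmetry. apply HPx.
      replace ((x + INR N) / (x + INR N + 1) - 1) with (- / (x + INR N + 1)) by (field; lra).
      rewrite Rabs_Ropp. rewrite Cmod_R in Hs1. lra.
    + replace (psi x) with (psi x - 0)%C at 1 by ring.
      apply ctends_minus; [typeclasses eauto|apply ctends_const; typeclasses eauto|].
      intros e He. assert (He2 : 0 < e / 2) by lra.
      destruct (Hgrowth (e / 2) He2) as [X HX].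
      destruct (nfloor_ex (Rmax 0 X)) as [N0 HN0]; [apply Rmax_l|].
      exists (S N0). intros n Hn.
      assert (Hn' : Rmax 0 X < INR n).
      { apply Rlt_le_trans with (INR (S N0)); [rewrite S_INR; lra|now apply le_INR]. }
      assert (M1 := Rmax_l 0 X). assert (M2 := Rmax_r 0 X).
      replace (psi (x + INR n)%R - 0)%C with (psi (x + INR n)%R) by ring.
      eapply Rle_lt_trans; [apply HX; lra|].
      assert (Rpower (x + INR n) (Rmin 0 (1 - 2 * Re s)) <= 1).
      { rewrite <- (Rpower_O (x + INR n)) by lra. apply Rle_Rpower; [lra|apply Rmin_l]. }
      nra.
Qed.

End RealEquation.

(** * From a wedge to the slit plane *)

Lemma Re_div (p q : C) : q <> 0 ->
  Re (p / q) = (Re p * Re q + Im p * Im q) / (Cmod q * Cmod q).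
Proof.
  intros H. apply Cmod_gt_0 in H. assert (Q := Cmod_sqr q).
  assert (0 < Re q * Re q + Im q * Im q) by nra. rewrite Q.
  destruct p, q; simpl in *. field. lra.
Qed.

Lemma Im_div (p q : C) : q <> 0 ->
  Im (p / q) = (Im p * Re q - Re p * Im q) / (Cmod q * Cmod q).
Proof.
  intros H. apply Cmod_gt_0 in H. assert (Q := Cmod_sqr q).
  assert (0 < Re q * Re q + Im q * Im q) by nra. rewrite Q.
  destruct p, q; simpl in *. field. lra.
Qed.

Lemma slit_plane_plus_1 (z : C) : slit_plane z -> slit_plane (z + 1).
Proof. unfold slit_plane. simpl. unfold Re, Im in *. intros H [H1 H2]. apply H. lra. Qed.

(** The arguments of [p] and [q] are less than pi/2 in absolute value, so their difference cannot be
    pi; the proof reads this off the real and imaginary parts of p times the conjugate of q. *)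
Lemma slit_plane_div (p q : C) : 0 < Re p -> 0 < Re q -> slit_plane (p / q).
Proof.
  intros Hp Hq.
  assert (N : q <> 0) by now apply slit_plane_neq_0, slit_plane_Re.
  assert (M : 0 < Cmod q * Cmod q) by (apply Cmod_gt_0 in N; nra).
  unfold slit_plane. rewrite Re_div, Im_div by auto. intros [H1 H2].
  assert (E1 : Im p * Re q - Re p * Im q = 0).
  { apply (f_equal (fun t => t * (Cmod q * Cmod q))) in H1.
    unfold Rdiv in H1. rewrite Rmult_assoc, Rinv_l, Rmult_0_l in H1 by lra. lra. }
  assert (E2 : Re p * Re q + Im p * Im q <= 0).
  { apply (Rmult_le_compat_r (Cmod q * Cmod q)) in H2; [|lra].
    unfold Rdiv in H2. rewrite Rmult_assoc, Rinv_l, Rmult_0_l in H2 by lra. lra. }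
  assert (Im p * Im q * (Re q * Re p) = (Re p * Im q) * (Re p * Im q)).
  { replace (Im p * Im q * (Re q * Re p)) with ((Im p * Re q) * (Re p * Im q)) by ring.
    replace (Im p * Re q) with (Re p * Im q) by lra. reflexivity. }
  assert (0 < Re q * Re p) by nra.
  assert (0 <= Im p * Im q) by nra. nra.
Qed.

Lemma slit_plane_S (z : C) : slit_plane z -> slit_plane (z / (z + 1)).
Proof.
  intros H. assert (N := slit_plane_neq_0 _ (slit_plane_plus_1 z H)).
  assert (M : 0 < Cmod (z + 1) * Cmod (z + 1)) by (apply Cmod_gt_0 in N; nra).
  destruct (Req_dec (Im z) 0) as [E|E].
  - assert (0 < Re z) by (apply Rnot_le_lt; intros K; now apply H).
    apply slit_plane_div; simpl; unfold Re in *; lra.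
  - apply slit_plane_Im. rewrite Im_div by auto.
    replace (Im z * Re (z + 1) - Re z * Im (z + 1)) with (Im z)
      by (destruct z; simpl; ring).
    apply Rmult_integral_contrapositive. split; auto. apply Rinv_neq_0_compat. lra.
Qed.

Lemma slit_plane_inv (z : C) : slit_plane z -> slit_plane (/ z).
Proof.
  intros H. assert (N := slit_plane_neq_0 _ H).
  replace (/ z)%C with (1 / z)%C by (field; auto).
  assert (M : 0 < Cmod z * Cmod z) by (apply Cmod_gt_0 in N; nra).
  destruct (Req_dec (Im z) 0) as [E|E].
  - assert (0 < Re z) by (apply Rnot_le_lt; intros K; now apply H).
    apply slit_plane_div; simpl; unfold Re in *; lra.
  - apply slit_plane_Im. rewrite Im_div by auto. simpl.
    unfold Im in *. rewrite Rmult_0_l, Rmult_1_l.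
    apply Rmult_integral_contrapositive. split; [lra|]. apply Rinv_neq_0_compat. lra.
Qed.

Definition three_term (s : C) (U : C -> Prop) (F : C -> C) : Prop :=
  forall z, U z ->
    F z = (F (z + 1) + Cpow_principal (z + 1) (- (RtoC 2 * s)) * F (z / (z + 1)))%C.

Lemma hol_plus_1 (z : C) : hol (fun z => z + 1)%C z.
Proof. apply hol_plus; [apply hol_id|apply hol_const]. Qed.

Lemma hol_S (z : C) : slit_plane z -> hol (fun z => z / (z + 1))%C z.
Proof.
  intros H. apply hol_div; [apply hol_id|apply hol_plus_1|].
  now apply slit_plane_neq_0, slit_plane_plus_1.
Qed.

Lemma hol_three_term (w : C) (F : C -> C) (z : C) :
  slit_plane z -> hol F (z + 1)%C -> hol F (z / (z + 1))%C ->
  hol (fun z => F (z + 1) + Cpow_principal (z + 1) w * F (z / (z + 1)))%C z.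
Proof.
  intros H H1 H2. apply hol_plus.
  - apply (hol_comp F (fun z => z + 1)%C); auto. apply hol_plus_1.
  - apply hol_mult.
    + apply (hol_comp (fun v => Cpow_principal v w) (fun z => z + 1)%C); [apply hol_plus_1|].
      apply hol_Cpow. now apply slit_plane_plus_1.
    + apply (hol_comp F (fun z => z / (z + 1))%C); auto. now apply hol_S.
Qed.

Definition wedge (k : R) (z : C) : Prop := Rabs (Im z) < k * Re z.

Lemma wedge_Re (k : R) (z : C) : 0 < k -> wedge k z -> 0 < Re z.
Proof. unfold wedge. generalize (Rabs_pos (Im z)). nra. Qed.

Lemma wedge_slit (k : R) (z : C) : 0 < k -> wedge k z -> slit_plane z.
Proof. intros. apply slit_plane_Re. eapply wedge_Re; eauto. Qed.

Lemma wedge_RtoC (k x : R) : 0 < k -> 0 < x -> wedge k (RtoC x).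
Proof. intros. unfold wedge. simpl. rewrite Rabs_R0. nra. Qed.

Lemma wedge_open (k : R) (z : C) : 0 < k -> wedge k z -> nbhd z (wedge k).
Proof.
  unfold wedge. intros Hk H. exists ((k * Re z - Rabs (Im z)) / (1 + k)).
  split; [apply Rdiv_lt_0_compat; lra|]. intros v Hv. unfold disc in Hv.
  apply Rlt_div_r in Hv; [|lra].
  assert (K1 := Rabs_Re_le (v - z)). assert (K2 := Rabs_Im_le (v - z)).
  change (Re (v - z)) with (Re v - Re z) in K1.
  change (Im (v - z)) with (Im v - Im z) in K2.
  apply Rabs_le_between in K1.
  assert (Rabs (Im v) <= Rabs (Im v - Im z) + Rabs (Im z)).
  { eapply Rle_trans; [|apply Rabs_triang]. right. f_equal. ring. }
  nra.
Qed.

Lemma wedge_plus_1 (k : R) (z : C) : 0 < k -> wedge k z -> wedge k (z + 1).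
Proof.
  unfold wedge. change (Re (z + 1)) with (Re z + 1). change (Im (z + 1)) with (Im z + 0).
  rewrite Rplus_0_r. nra.
Qed.

(** Over the common denominator |z + 1|^2 the imaginary part is still Im z, while the real part has
    grown to Re z + |z|^2. *)
Lemma wedge_S (k : R) (z : C) : 0 < k -> wedge k z -> wedge k (z / (z + 1)).
Proof.
  intros Hk H. assert (Hs := wedge_slit k z Hk H). assert (Hr := wedge_Re k z Hk H).
  assert (N := slit_plane_neq_0 _ (slit_plane_plus_1 z Hs)).
  assert (M : 0 < Cmod (z + 1) * Cmod (z + 1)) by (apply Cmod_gt_0 in N; nra).
  unfold wedge in *. rewrite Re_div, Im_div by auto.
  change (Re (z + 1)) with (Re z + 1). change (Im (z + 1)) with (Im z + 0).
  replace (Im z * (Re z + 1) - Re z * (Im z + 0)) with (Im z) by ring.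
  unfold Rdiv. rewrite Rabs_mult, (Rabs_pos_eq (/ _)) by (left; now apply Rinv_0_lt_compat).
  rewrite <- Rmult_assoc. apply Rmult_lt_compat_r; [now apply Rinv_0_lt_compat|].
  nra.
Qed.

Lemma wedge_star (k : R) : 0 < k -> star_shaped 1 (wedge k).
Proof.
  intros Hk z t H Ht. unfold wedge in *.
  replace (Im (1 + RtoC t * (z - 1))) with (t * Im z) by (destruct z; simpl; ring).
  replace (Re (1 + RtoC t * (z - 1))) with ((1 - t) + t * Re z) by (destruct z; simpl; ring).
  rewrite Rabs_mult, Rabs_pos_eq by lra.
  destruct (Req_dec t 0) as [->|]; [lra|nra].
Qed.

Section WedgeToSlitPlane.
Variables (s : C) (k : R) (F : C -> C).
Hypothesis Hk : 0 < k.
Hypothesis HF : forall z, wedge k z -> hol F z.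
Hypothesis Heq : three_term s (wedge k) F.

(** All 2^n words of length [n] must end in the wedge, since these are the points at which
    [unfolding n] evaluates [F]. The slit plane is required at each stage so that the powers met on
    the way are holomorphic. *)
Fixpoint reach (n : nat) (z : C) : Prop :=
  match n with
  | O => wedge k z
  | S n => slit_plane z /\ reach n (z + 1)%C /\ reach n (z / (z + 1))%C
  end.

Fixpoint unfolding (n : nat) (z : C) : C :=
  match n with
  | O => F z
  | S n => (unfolding n (z + 1) +
            Cpow_principal (z + 1) (- (RtoC 2 * s)) * unfolding n (z / (z + 1)))%C
  end.

Lemma reach_slit (n : nat) (z : C) : reach n z -> slit_plane z.
Proof. destruct n; simpl; [now apply wedge_slit|tauto]. Qed.

Lemma reach_S (n : nat) (z : C) : reach n z -> reach (S n) z.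
Proof.
  revert z. induction n as [|n IH]; intros z H.
  - simpl in *. repeat split; [eapply wedge_slit; eauto|now apply wedge_plus_1|now apply wedge_S].
  - destruct H as [H1 [H2 H3]]. split; [auto|]. split; now apply IH.
Qed.

Lemma reach_mono (n m : nat) (z : C) : (n <= m)%nat -> reach n z -> reach m z.
Proof. intros H R. induction H; auto. now apply reach_S. Qed.

(** Inside the wedge [F] satisfies the equation, so a further unfolding changes nothing. Values
    obtained at different depths therefore agree, and the extension is well defined. *)
Lemma unfolding_S (n : nat) (z : C) : reach n z -> unfolding (S n) z = unfolding n z.
Proof.
  revert z. induction n as [|n IH]; intros z H.
  - simpl. symmetry. now apply Heq.
  - destruct H as [H1 [H2 H3]].
    change (unfolding (S (S n)) z) with (unfolding (S n) (z + 1) +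
      Cpow_principal (z + 1) (- (RtoC 2 * s)) * unfolding (S n) (z / (z + 1)))%C.
    rewrite IH, IH by auto. reflexivity.
Qed.

Lemma unfolding_mono (n m : nat) (z : C) :
  (n <= m)%nat -> reach n z -> unfolding m z = unfolding n z.
Proof.
  intros H R. induction H; auto. rewrite unfolding_S; auto. now apply (reach_mono n).
Qed.

Lemma reach_open (n : nat) (z : C) : reach n z -> nbhd z (reach n).
Proof.
  revert z. induction n as [|n IH]; intros z H.
  - now apply wedge_open.
  - destruct H as [H1 [H2 H3]]. simpl.
    apply filter_and; [now apply slit_plane_open|]. apply filter_and.
    + apply (nbhd_comp (fun z => z + 1)%C); [|now apply IH]. apply hol_cont, hol_plus_1.
    + apply (nbhd_comp (fun z => z / (z + 1))%C); [|now apply IH].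
      now apply hol_cont, hol_S.
Qed.

Lemma unfolding_hol (n : nat) (z : C) : reach n z -> hol (unfolding n) z.
Proof.
  revert z. induction n as [|n IH]; intros z H.
  - now apply HF.
  - destruct H as [H1 [H2 H3]]. simpl. apply hol_three_term; auto.
Qed.

(* Write [z = p / q] with [p], [q] in the right half-plane.  Both maps
   [z + 1 = (p + q) / q] and [z / (z + 1) = p / (p + q)] preserve
   [Im p Re q - Re p Im q] while [Re p Re q] grows by at least [m^2]. *)
Lemma reach_quotient (m D : R) (n : nat) (p q : C) :
  0 < m -> m <= Re p -> m <= Re q -> Im p * Re q - Re p * Im q = D ->
  Rabs D * (1 + / k) + 1 - INR n * (m * m) <= Re p * Re q -> reach n (p / q).
Proof.
  intros Hm. revert p q. induction n as [|n IH]; intros p q Hp Hq HD HL.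
  - simpl in *. assert (N : q <> 0) by (apply slit_plane_neq_0, slit_plane_Re; lra).
    assert (M : 0 < Cmod q * Cmod q) by (apply Cmod_gt_0 in N; nra).
    unfold wedge. rewrite Re_div, Im_div, HD by auto.
    unfold Rdiv. rewrite Rabs_mult, (Rabs_pos_eq (/ _)) by (left; now apply Rinv_0_lt_compat).
    rewrite <- Rmult_assoc. apply Rmult_lt_compat_r; [now apply Rinv_0_lt_compat|].
    rewrite Rmult_0_l, Rminus_0_r in HL.
    assert (Pk : 0 < / k) by now apply Rinv_0_lt_compat.
    assert (PD := Rabs_pos D).
    assert (L1 : Rabs D <= Re p * Re q) by nra.
    (* 4 (Re p Re q)(Im p Im q) + D^2 is the square of Im p Re q + Re p Im q; with Re p Re q >= |D|
       this bounds Im p Im q from below. *)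
    assert (Q : - Rabs D / 4 <= Im p * Im q).
    { apply Rnot_lt_le. intros K.
      assert (D2 : D * D = Rabs D * Rabs D) by (rewrite <- Rabs_mult, Rabs_pos_eq; nra).
      assert (D3 : - (4 * (Re p * Re q) * (Im p * Im q)) <= D * D).
      { rewrite <- HD. generalize (Rle_0_sqr (Im p * Re q + Re p * Im q)). unfold Rsqr. lra. }
      assert (0 < Re p * Re q) by nra. nra. }
    assert (L2 : k * (Rabs D * (1 + / k) + 1) <= k * (Re p * Re q)) by (apply Rmult_le_compat_l; lra).
    replace (k * (Rabs D * (1 + / k) + 1)) with (k * Rabs D + Rabs D + k) in L2 by (field; lra).
    nra.
  - rewrite S_INR in HL. assert (N : q <> 0) by (apply slit_plane_neq_0, slit_plane_Re; lra).
    assert (N2 : (p + q)%C <> 0).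
    { apply slit_plane_neq_0, slit_plane_Re. change (Re (p + q)) with (Re p + Re q). lra. }
    split; [apply slit_plane_div; lra|]. split.
    + replace (p / q + 1)%C with ((p + q) / q)%C by (field; auto).
      apply IH; auto; change (Re (p + q)) with (Re p + Re q);
        change (Im (p + q)) with (Im p + Im q); [lra|lra|nra].
    + replace (p / q / (p / q + 1))%C with (p / (p + q))%C by (field; auto).
      apply IH; auto; change (Re (p + q)) with (Re p + Re q);
        change (Im (p + q)) with (Im p + Im q); [lra|lra|nra].
Qed.

Lemma reach_exhausts (z : C) : slit_plane z -> exists n, reach n z.
Proof.
  intros H. assert (Hp := slit_plane_pos z H).
  assert (Hz : 0 < Cmod z) by now apply Cmod_gt_0, slit_plane_neq_0.
  (* This is q = 1 + conj z / |z|, so that p = z q = z + |z|; both have positive real part because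
     |z| + Re z > 0 off the cut. *)
  set (q := (Re z / Cmod z + 1, - (Im z / Cmod z)) : C).
  set (p := (z * q)%C).
  assert (Rq : 0 < Re q).
  { simpl. replace (Re z / Cmod z + 1) with ((Cmod z + Re z) / Cmod z) by (field; lra).
    now apply Rdiv_lt_0_compat. }
  assert (Rp : Re p = Cmod z + Re z).
  { unfold p. change (Re (z * q)) with (Re z * (Re z / Cmod z + 1) - Im z * - (Im z / Cmod z)).
    assert (Q := Cmod_sqr z).
    replace (Re z * (Re z / Cmod z + 1) - Im z * - (Im z / Cmod z))
      with ((Re z * Re z + Im z * Im z) / Cmod z + Re z) by (field; lra).
    rewrite <- Q. field. lra. }
  assert (N : q <> 0) by now apply slit_plane_neq_0, slit_plane_Re.
  replace z with (p / q)%C by (unfold p; field; auto).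
  set (m := Rmin (Re p) (Re q)).
  assert (Hm : 0 < m) by (apply Rmin_glb_lt; lra).
  set (D := Im p * Re q - Re p * Im q).
  set (L := Rabs D * (1 + / k) + 1).
  assert (HL : 0 <= L).
  { assert (0 < / k) by now apply Rinv_0_lt_compat. unfold L.
    generalize (Rabs_pos D). nra. }
  assert (Hmm : 0 < m * m) by nra.
  destruct (nfloor_ex (L / (m * m))) as [n Hn]; [now apply Rdiv_le_0_compat|].
  exists (S n). apply (reach_quotient m D); auto; [apply Rmin_l|apply Rmin_r|].
  fold L. rewrite S_INR. destruct Hn as [_ Hn]. apply Rlt_div_l in Hn; [|lra].
  assert (0 < Re p * Re q) by nra. lra.
Qed.

(** The depth [N z] may vary with the point, but near each point a fixed depth works by [reach_open]
    and gives the same values; holomorphy is therefore that of a single [unfolding]. *)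
Lemma slit_plane_extension : exists Psi : C -> C,
  (forall z, slit_plane z -> hol Psi z) /\ three_term s slit_plane Psi /\
  (forall z, wedge k z -> Psi z = F z).
Proof.
  set (N := fun z => epsilon (inhabits 0%nat) (fun n => reach n z)).
  assert (HN : forall z, slit_plane z -> reach (N z) z).
  { intros z Hz. apply epsilon_spec. now apply reach_exhausts. }
  set (Psi := fun z => unfolding (N z) z).
  assert (HPsi : forall n z, reach n z -> Psi z = unfolding n z).
  { intros n z Hn. unfold Psi. assert (K := HN z (reach_slit n z Hn)).
    destruct (Nat.le_ge_cases n (N z)).
    - now apply unfolding_mono.
    - symmetry. now apply unfolding_mono. }
  exists Psi. split; [|split].
  - intros z Hz. apply (hol_ext (unfolding (N z))).
    + generalize (reach_open _ _ (HN z Hz)). apply filter_imp. intros v Hv.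
      symmetry. now apply HPsi.
    + apply unfolding_hol. now apply HN.
  - intros z Hz. assert (K := reach_S _ _ (HN z Hz)).
    rewrite (HPsi _ _ K). destruct K as [_ [K1 K2]].
    rewrite (HPsi _ _ K1), (HPsi _ _ K2). reflexivity.
  - intros z Hz. now rewrite (HPsi 0%nat z).
Qed.

End WedgeToSlitPlane.

Lemma disc_convex (c p z : C) (r t : R) :
  disc c r p -> disc c r z -> 0 <= t <= 1 -> disc c r (p + RtoC t * (z - p)).
Proof.
  unfold disc. intros Hp Hz Ht.
  replace (p + RtoC t * (z - p) - c)%C
    with (RtoC (1 - t) * (p - c) + RtoC t * (z - c))%C by (rewrite RtoC_minus; ring).
  eapply Rle_lt_trans; [apply Cmod_triangle|].
  rewrite !Cmod_mult, !Cmod_R, !Rabs_pos_eq by lra.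
  destruct (Req_dec t 0) as [->|]; [lra|].
  assert (t * Cmod (z - c) < t * r) by (apply Rmult_lt_compat_l; lra).
  assert ((1 - t) * Cmod (p - c) <= (1 - t) * r) by (apply Rmult_le_compat_l; lra).
  lra.
Qed.

(** A point of positive real part lies in the wedge exactly when it lies in the disc of radius k Re
    z about Re z, so the local extension centred at Re z has a meaningful value at z. For nearby
    centres two such discs overlap in a convex set containing a real interval, where the two
    extensions coincide. *)
Lemma wedge_gluing (psi : R -> C) (k : R) :
  0 < k ->
  (forall x : R, 0 < x -> exists P : C -> C,
     (forall z, disc (RtoC x) (k * x) z -> hol P z) /\
     (forall y : R, Rabs (y - x) < k * x -> P (RtoC y) = psi y)) ->
  exists F : C -> C, (forall z, wedge k z -> hol F z) /\
    (forall x : R, 0 < x -> F (RtoC x) = psi x).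
Proof.
  intros Hk H.
  destruct (choice (fun (x : R) (P : C -> C) => 0 < x ->
     (forall z, disc (RtoC x) (k * x) z -> hol P z) /\
     (forall y : R, Rabs (y - x) < k * x -> P (RtoC y) = psi y))) as [P HP].
  { intros x. destruct (excluded_middle_informative (0 < x)) as [Hx|Hx].
    - destruct (H x Hx) as [P HP]. now exists P.
    - exists (fun _ => RtoC 0). tauto. }
  assert (In : forall z, wedge k z -> disc (RtoC (Re z)) (k * Re z) z).
  { intros z Hz. unfold disc.
    replace (z - RtoC (Re z))%C with (Ci * RtoC (Im z))%C.
    - rewrite Cmod_mult, Cmod_Ci, Cmod_R, Rmult_1_l. exact Hz.
    - destruct z; apply C_ext; simpl; ring. }
  exists (fun z => P (Re z) z). split.
  - intros z0 Hz0. assert (Hx0 := wedge_Re k z0 Hk Hz0).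
    apply (hol_ext (P (Re z0))); [|apply (HP _ Hx0), In, Hz0].
    generalize (filter_and _ _ (nbhd_open_disc _ _ _ (In z0 Hz0)) (wedge_open k z0 Hk Hz0)).
    apply filter_imp. intros z [Hd Hz]. assert (Hx := wedge_Re k z Hk Hz).
    set (x0 := Re z0) in *. set (x := Re z) in *.
    assert (Hxx : Rabs (x - x0) < k * x0).
    { eapply Rle_lt_trans; [|exact Hd]. exact (Rabs_Re_le (z - RtoC x0)). }
    apply (identity_from_reals (fun v => disc (RtoC x0) (k * x0) v /\ disc (RtoC x) (k * x) v)
      (P x0) (P x) x (Rmin (k * x) (k * x0 - Rabs (x - x0)))).
    + intros v [H1 H2]. apply filter_and; now apply nbhd_open_disc.
    + intros v t [H1 H2] Ht. split; apply disc_convex; auto.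
      * unfold disc. now rewrite <- RtoC_minus, Cmod_R.
      * apply disc_center. nra.
    + intros v [H1 _]. now apply (HP x0).
    + intros v [_ H2]. now apply (HP x).
    + apply Rmin_glb_lt; [nra|lra].
    + intros y Hy.
      assert (Y1 := Rlt_le_trans _ _ _ Hy (Rmin_l _ _)).
      assert (Y2 := Rlt_le_trans _ _ _ Hy (Rmin_r _ _)).
      rewrite (proj2 (HP x Hx)), (proj2 (HP x0 Hx0)); auto.
      replace (y - x0) with ((y - x) + (x - x0)) by ring.
      eapply Rle_lt_trans; [apply Rabs_triang|]. lra.
    + split; [exact Hd|exact (In z Hz)].
  - intros x Hx. simpl. apply (HP x Hx). rewrite Rminus_diag, Rabs_R0. nra.
Qed.

(** * Growth estimates *)

Lemma slit_plane_star : star_shaped 1 slit_plane.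
Proof.
  intros z t H Ht [H1 H2].
  replace (Im (1 + RtoC t * (z - 1))) with (t * Im z) in H1 by (destruct z; simpl; ring).
  replace (Re (1 + RtoC t * (z - 1))) with ((1 - t) + t * Re z) in H2
    by (destruct z; simpl; ring).
  destruct (Req_dec t 0) as [->|N]; [lra|].
  assert (E : Im z = 0) by nra.
  assert (0 < Re z) by (apply Rnot_le_lt; intros K; now apply H). nra.
Qed.

(** Both sides are holomorphic on the slit plane and agree on the reals near 1, which avoids case
    distinctions on arguments; the same reasoning serves [Clog_S]. *)
Lemma Clog_inv (z : C) : slit_plane z -> Clog (/ z) = (- Clog z)%C.
Proof.
  apply (identity_from_reals slit_plane (fun z => Clog (/ z)) (fun z => - Clog z)%C 1 (1 / 2)).
  - apply slit_plane_open.
  - apply slit_plane_star.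
  - intros v Hv. apply (hol_comp Clog Cinv).
    + apply hol_inv. now apply slit_plane_neq_0.
    + now apply hol_Clog, slit_plane_inv.
  - intros v Hv. now apply hol_opp, hol_Clog.
  - lra.
  - intros x Hx. apply Rabs_lt_between in Hx.
    rewrite <- RtoC_inv, !Clog_RtoC, ln_Rinv, RtoC_opp by
      (try apply Rinv_0_lt_compat; lra). reflexivity.
Qed.

Lemma Clog_S (z : C) :
  slit_plane z -> Clog (z / (z + 1)) = (Clog z - Clog (z + 1))%C.
Proof.
  apply (identity_from_reals slit_plane (fun z => Clog (z / (z + 1)))
    (fun z => Clog z - Clog (z + 1))%C 1 (1 / 2)).
  - apply slit_plane_open.
  - apply slit_plane_star.
  - intros v Hv. apply (hol_comp Clog (fun z => z / (z + 1))%C); [now apply hol_S|].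
    now apply hol_Clog, slit_plane_S.
  - intros v Hv. apply hol_minus; [now apply hol_Clog|].
    apply (hol_comp Clog (fun z => z + 1)%C); [apply hol_plus_1|].
    now apply hol_Clog, slit_plane_plus_1.
  - lra.
  - intros x Hx. apply Rabs_lt_between in Hx.
    rewrite <- RtoC_plus, <- RtoC_div, !Clog_RtoC, <- RtoC_minus by
      (try apply Rdiv_lt_0_compat; lra).
    f_equal. apply ln_div; lra.
Qed.

Lemma Cpow_inv_mult (z w : C) :
  slit_plane z -> (Cpow_principal (/ z) w * Cpow_principal z w)%C = 1.
Proof.
  intros H. unfold Cpow_principal. rewrite Clog_inv, <- Cexp_plus by auto.
  rewrite <- Cexp_0. f_equal. ring.
Qed.

Lemma Cpow_S (z w : C) : slit_plane z ->
  (Cpow_principal (z + 1) w * Cpow_principal (z / (z + 1)) w)%C = Cpow_principal z w.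
Proof.
  intros H. unfold Cpow_principal. rewrite Clog_S, <- Cexp_plus by auto.
  f_equal. ring.
Qed.

(** The gauge records at each point both a radius on which [F] oscillates by less than 1 and the
    reciprocal of |F| + 1. Compactness supplies nearby tags at which the gauge has a uniform
    positive lower bound, and this bounds [F]. *)
Lemma rectangle_bounded (F : C -> C) (a b a' b' : R) :
  (forall z, a <= Re z <= b -> a' <= Im z <= b' -> ccont F z) ->
  exists B, forall z, a <= Re z <= b -> a' <= Im z <= b' -> Cmod (F z) <= B.
Proof.
  intros H.
  destruct (choice (fun (z : C) (d : posreal) => a <= Re z <= b -> a' <= Im z <= b' ->
    d <= / (Cmod (F z) + 1) /\ forall v, Cmod (v - z) < 2 * d -> Cmod (F v - F z) < 1))
    as [dl Hdl].
  { intros z. destruct (excluded_middle_informative (a <= Re z <= b /\ a' <= Im z <= b'))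
      as [[H1 H2]|N].
    - destruct (H z H1 H2 1 Rlt_0_1) as [d [Hd K]].
      assert (P : 0 < / (Cmod (F z) + 1)).
      { apply Rinv_0_lt_compat. generalize (Cmod_ge_0 (F z)). lra. }
      assert (Q : 0 < Rmin (d / 2) (/ (Cmod (F z) + 1))) by (apply Rmin_glb_lt; lra).
      exists (mkposreal _ Q). intros _ _. simpl. split; [apply Rmin_r|].
      intros v Hv. apply K. unfold disc.
      generalize (Rmin_l (d / 2) (/ (Cmod (F z) + 1))). lra.
    - exists (mkposreal 1 Rlt_0_1). tauto. }
  destruct (compactness_value_2d a b a' b' (fun u v => dl (u, v))) as [d Hd].
  exists (/ d + 1). intros z H1 H2. apply NNPP. intros N.
  apply (Hd (Re z) (Im z) H1 H2). intros [u [v [Hu [Hv [Du [Dv Dd]]]]]].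
  apply N. destruct (Hdl (u, v) Hu Hv) as [K1 K2].
  assert (Z : Cmod (z - (u, v)) < 2 * dl (u, v)).
  { eapply Rle_lt_trans; [apply Cmod_le_Rabs|].
    change (Re (z - (u, v))) with (Re z - u). change (Im (z - (u, v))) with (Im z - v). lra. }
  specialize (K2 z Z).
  assert (G := Cmod_ge_0 (F (u, v))).
  assert (L : d <= / (Cmod (F (u, v)) + 1)) by lra.
  apply Rinv_le_contravar in L; [|apply cond_pos]. rewrite Rinv_inv in L.
  generalize (Cmod_rev_triangle (F z) (F (u, v))). lra.
Qed.

Lemma Cmod_plus_ge (z : C) (x : R) :
  0 <= Re z -> 0 <= x -> Cmod z * Cmod z + x * x <= Cmod (z + RtoC x) * Cmod (z + RtoC x).
Proof.
  intros H Hx. rewrite !Cmod_sqr.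
  change (Re (z + RtoC x)) with (Re z + x). change (Im (z + RtoC x)) with (Im z + 0). nra.
Qed.

Lemma Re_minus_2s (s : C) : Re (- (RtoC 2 * s)) = - (2 * Re s).
Proof. destruct s; simpl; ring. Qed.

(** Descent in unit steps of Re z: the equation expresses [F] at z by its value at z + 1, already
    controlled, and at z/(z + 1), which stays in a fixed compact set. Each step enlarges the
    constant, and finitely many reach Re z >= 0. *)
Lemma right_half_plane_decay (s : C) (F : C -> C) (R1 K : R) :
  0 < Re s -> three_term s slit_plane F -> (forall z, 0 < Re z -> ccont F z) ->
  (forall z, R1 < Re z -> Cmod (F z) <= K * Rpower (Cmod z) (- (2 * Re s))) ->
  exists K', 0 <= K' /\ forall z, 0 <= Re z -> 1 <= Cmod z ->
    Cmod (F z) <= K' * Rpower (Cmod z) (- (2 * Re s)).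
Proof.
  intros Hs Heq HF HK. set (c := 2 * Re s) in *. assert (Hc : 0 < c) by (unfold c; lra).
  (* For Re z >= 0 and |z| >= 1 one has |z + 1|^2 >= 2, so 1/(z + 1) has modulus at most 3/4 and
     z/(z + 1) = 1 - 1/(z + 1) falls into this rectangle. *)
  destruct (rectangle_bounded F (/ 4) 2 (-1) 1) as [B HB].
  { intros z Hz _. apply HF. lra. }
  assert (HB0 : 0 <= B).
  { eapply Rle_trans; [apply Cmod_ge_0|apply (HB (RtoC 1))]; simpl; lra. }
  set (E := exp (PI * Rabs (Im (- (RtoC 2 * s))))).
  assert (HE : 0 < E) by apply exp_pos.
  assert (St : forall n : nat, (exists K', 0 <= K' /\ forall z, INR (S n) <= Re z -> 1 <= Cmod z ->
      Cmod (F z) <= K' * Rpower (Cmod z) (- c)) ->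
    exists K', 0 <= K' /\ forall z, INR n <= Re z -> 1 <= Cmod z ->
      Cmod (F z) <= K' * Rpower (Cmod z) (- c)).
  { intros n [K' [HK0 HK']]. exists (K' + E * B). split; [nra|]. intros z Hz Hz1.
    assert (Pn := pos_INR n). rewrite S_INR in HK'.
    assert (G := Cmod_plus_ge z 1 ltac:(lra) ltac:(lra)).
    assert (L : Cmod z <= Cmod (z + 1)) by (apply Rsqr_incr_0; [unfold Rsqr; lra|lra|apply Cmod_ge_0]).
    assert (Sz : slit_plane z).
    { intros [H1 H2]. assert (Q := Cmod_sqr z). rewrite H1 in Q. nra. }
    assert (N : (z + 1)%C <> 0) by (apply Cmod_gt_0; lra).
    rewrite (Heq z Sz). eapply Rle_trans; [apply Cmod_triangle|].
    assert (RL : Rpower (Cmod (z + 1)) (- c) <= Rpower (Cmod z) (- c))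
      by (apply Rpower_le_antitone; lra).
    assert (T1 : Cmod (F (z + 1)%C) <= K' * Rpower (Cmod z) (- c)).
    { eapply Rle_trans; [apply HK'|].
      - change (Re (z + 1)) with (Re z + 1). lra.
      - lra.
      - now apply Rmult_le_compat_l. }
    assert (T2 : Cmod (F (z / (z + 1))%C) <= B).
    { set (v := (/ (z + 1))%C).
      assert (Ev : (z / (z + 1))%C = (1 - v)%C) by (unfold v; field; auto).
      assert (Hv : Cmod v <= 3 / 4).
      { unfold v. rewrite Cmod_inv by auto. rewrite <- (Rinv_inv (3 / 4)).
        apply Rinv_le_contravar; [lra|].
        apply Rsqr_incr_0; [unfold Rsqr|lra|apply Cmod_ge_0]. nra. }
      assert (V1 := Rabs_Re_le v). assert (V2 := Rabs_Im_le v).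
      apply Rabs_le_between in V1. apply Rabs_le_between in V2.
      rewrite Ev. apply HB.
      - change (Re (1 - v)) with (1 - Re v). lra.
      - change (Im (1 - v)) with (0 - Im v). lra. }
    rewrite Cmod_mult.
    assert (T3 := Cmod_Cpow_le (z + 1) (- (RtoC 2 * s))).
    fold E in T3. rewrite Re_minus_2s in T3. fold c in T3.
    assert (T4 : Cmod (Cpow_principal (z + 1) (- (RtoC 2 * s))) * Cmod (F (z / (z + 1))%C) <=
      (E * Rpower (Cmod z) (- c)) * B).
    { apply Rmult_le_compat; try apply Cmod_ge_0; auto.
      eapply Rle_trans; [exact T3|]. apply Rmult_le_compat_l; lra. }
    lra. }
  destruct (nfloor_ex (Rmax 0 R1)) as [n Hn]; [apply Rmax_l|].
  assert (Base : exists K', 0 <= K' /\ forall z, INR (S n) <= Re z -> 1 <= Cmod z ->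
    Cmod (F z) <= K' * Rpower (Cmod z) (- c)).
  { exists (Rmax 0 K). split; [apply Rmax_l|]. intros z Hz Hz1. rewrite S_INR in Hz.
    eapply Rle_trans; [apply HK; generalize (Rmax_r 0 R1); lra|].
    apply Rmult_le_compat_r; [left; apply exp_pos|apply Rmax_r]. }
  assert (All : exists K', 0 <= K' /\ forall z, INR 0 <= Re z -> 1 <= Cmod z ->
    Cmod (F z) <= K' * Rpower (Cmod z) (- c)).
  { revert Base. generalize (S n). intros m. induction m as [|m IH]; auto. }
  exact All.
Qed.

Lemma Rpower_div_sqr (y m a : R) : 0 < y -> 0 < m ->
  Rpower (y / (m * m)) a = Rpower y a * Rpower m (- (2 * a)).
Proof.
  intros Hy Hm. unfold Rpower. rewrite <- exp_plus. f_equal.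
  rewrite ln_div, ln_mult by nra. ring.
Qed.

Lemma Rpower_le_1 (y a : R) : 0 < y <= 1 -> 0 <= a -> Rpower y a <= 1.
Proof.
  intros Hy Ha. apply Rle_trans with (Rpower 1 a); [now apply Rle_Rpower_l|].
  unfold Rpower. rewrite ln_1, Rmult_0_r, exp_0. lra.
Qed.

Lemma Rpower_base_le_1 (y a b : R) : 0 < y <= 1 -> a <= b -> Rpower y b <= Rpower y a.
Proof.
  intros Hy Hab. unfold Rpower. apply exp_le.
  assert (ln y <= 0) by (rewrite <- ln_1; apply ln_le; lra). nra.
Qed.

(** * The region Re z < 0 above the real axis *)

Section LeftHalfPlane.
Variables (s : C) (Phi : C -> C) (K : R).
Let sg : R := Re s.
Let w : C := (- (RtoC 2 * s))%C.
Let t : R := Rabs (Im w).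
Let E : R := exp (PI * t).
Hypothesis Hs : 0 < Re s.
Hypothesis Heq : three_term s (fun z => 0 < Im z) Phi.
Hypothesis HK0 : 0 <= K.
Hypothesis Hbig : forall z, 0 < Im z -> 0 <= Re z -> 1 <= Cmod z ->
  Cmod (Phi z) <= K * Rpower (Cmod z) (- (2 * sg)).
Hypothesis Hsmall : forall z, 0 < Im z -> 0 <= Re z -> Cmod z <= 1 -> Cmod (Phi z) <= K.

Let J (z : C) : C := (- / z)%C.
(** A weight adapted to z -> -1/z: since Im(-1/z) = Im z / |z|^2, passing to -1/z multiplies the
    weight by |z|^(-2 sigma), the size of the factor z^(-2s) in [f]. *)
Let hnorm (F : C -> C) (z : C) : R := Rpower (Im z) sg * Cmod (F z).
Let f (z : C) : C := (Phi z + Cpow_principal z w * Phi (J z))%C.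

Lemma upper_neq_0 (z : C) : 0 < Im z -> z <> 0.
Proof. intros H. apply slit_plane_neq_0, slit_plane_Im. lra. Qed.

Lemma upper_Cmod (z : C) : 0 < Im z -> 0 < Cmod z.
Proof. intros H. now apply Cmod_gt_0, upper_neq_0. Qed.

Lemma Im_J (z : C) : 0 < Im z -> Im (J z) = Im z / (Cmod z * Cmod z).
Proof.
  intros H. assert (N := upper_neq_0 z H). unfold J.
  replace (- / z)%C with (RtoC (-1) / z)%C by (field; auto).
  rewrite Im_div by auto. f_equal. simpl. unfold Re, Im. ring.
Qed.

Lemma Re_J (z : C) : 0 < Im z -> Re (J z) = - Re z / (Cmod z * Cmod z).
Proof.
  intros H. assert (N := upper_neq_0 z H). unfold J.
  replace (- / z)%C with (RtoC (-1) / z)%C by (field; auto).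
  rewrite Re_div by auto. f_equal. simpl. unfold Re, Im. ring.
Qed.

Lemma Im_J_pos (z : C) : 0 < Im z -> 0 < Im (J z).
Proof.
  intros H. rewrite Im_J by auto. assert (M := upper_Cmod z H).
  apply Rdiv_lt_0_compat; nra.
Qed.

Lemma Cmod_J (z : C) : 0 < Im z -> Cmod (J z) = / Cmod z.
Proof. intros H. unfold J. rewrite Cmod_opp, Cmod_inv; auto. now apply upper_neq_0. Qed.

Lemma J_J (z : C) : 0 < Im z -> J (J z) = z.
Proof. intros H. unfold J. field. now apply upper_neq_0. Qed.

Lemma hnorm_J (z : C) (F : C -> C) : 0 < Im z ->
  hnorm F (J z) = Rpower (Im z) sg * Rpower (Cmod z) (- (2 * sg)) * Cmod (F (J z)).
Proof.
  intros H. unfold hnorm. rewrite Im_J by auto. rewrite Rpower_div_sqr; auto.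
  now apply upper_Cmod.
Qed.

Lemma Cmod_Cpow_E (z : C) : Cmod (Cpow_principal z w) <= E * Rpower (Cmod z) (- (2 * sg)).
Proof.
  unfold E, t, sg. rewrite <- Re_minus_2s. apply Cmod_Cpow_le.
Qed.

(** As Im z <= |z|, the weight is absorbed by |z|^(-2 sigma) when |z| >= 1, and it is at most 1
    otherwise. *)
Lemma hnorm_right (z : C) : 0 < Im z -> 0 <= Re z -> hnorm Phi z <= K.
Proof.
  intros Hy Hx. unfold hnorm. assert (M := upper_Cmod z Hy).
  assert (L := Rabs_Im_le z). rewrite Rabs_pos_eq in L by lra.
  assert (P := exp_pos (sg * ln (Im z))). fold (Rpower (Im z) sg) in P.
  assert (Hsg : 0 < sg) by exact Hs.
  destruct (Rle_dec 1 (Cmod z)) as [H|H].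
  - apply Rle_trans with (Rpower (Im z) sg * (K * Rpower (Cmod z) (- (2 * sg)))).
    { apply Rmult_le_compat_l; [lra|now apply Hbig]. }
    assert (Rpower (Im z) sg * Rpower (Cmod z) (- (2 * sg)) <= 1); [|nra].
    apply Rle_trans with (Rpower (Cmod z) sg * Rpower (Cmod z) (- (2 * sg))).
    + apply Rmult_le_compat_r; [left; apply exp_pos|]. apply Rle_Rpower_l; lra.
    + rewrite <- Rpower_plus. rewrite <- (Rpower_O (Cmod z)) by lra.
      apply Rle_Rpower; lra.
  - assert (Rpower (Im z) sg <= 1) by (apply Rpower_le_1; lra).
    assert (Q := Hsmall z Hy Hx ltac:(lra)). generalize (Cmod_ge_0 (Phi z)). nra.
Qed.

(** Expand [Phi] at -1/(z + 1) by the equation: the two images of this point are z/(z + 1) and -1/z.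
    The term at z/(z + 1) recombines with the one at z + 1 into [Phi z], and the powers in the other
    multiply to z^(-2s). *)
Lemma f_period (z : C) : 0 < Im z -> f (z + 1)%C = f z.
Proof.
  intros Hy. assert (N := upper_neq_0 z Hy).
  assert (Hy1 : 0 < Im (z + 1)).
  { change (Im (z + 1)) with (Im z + 0). lra. }
  assert (N1 := upper_neq_0 _ Hy1).
  assert (V := Im_J_pos _ Hy1).
  assert (E1 : (J (z + 1) + 1)%C = (z / (z + 1))%C) by (unfold J; field; auto).
  assert (E2 : (J (z + 1) / (J (z + 1) + 1))%C = J z).
  { rewrite E1. unfold J. field. auto. }
  assert (H1 := Heq _ V). assert (H2 := Heq _ Hy). rewrite E2, E1 in H1.
  fold w in H1, H2. unfold f. rewrite H1, H2.
  rewrite <- (Cpow_S z w) by (apply slit_plane_Im; lra). ring.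
Qed.

Lemma f_period_Z (z : C) (q : Z) : 0 < Im z -> f (z + RtoC (IZR q))%C = f z.
Proof.
  assert (Nat : forall (n : nat) v, 0 < Im v -> f (v + RtoC (INR n))%C = f v).
  { induction n as [|n IH]; intros v Hv.
    - simpl. f_equal. ring.
    - rewrite S_INR, RtoC_plus, Cplus_assoc, f_period; [now apply IH|].
      change (Im (v + RtoC (INR n))) with (Im v + 0). lra. }
  intros Hy. destruct (Z.le_gt_cases 0 q) as [H|H].
  - rewrite <- (Z2Nat.id q H), <- INR_IZR_INZ. now apply Nat.
  - rewrite <- (Nat (Z.to_nat (- q)) (z + RtoC (IZR q))%C).
    + rewrite INR_IZR_INZ, Z2Nat.id, opp_IZR, RtoC_opp by lia. f_equal. ring.
    + change (Im (z + RtoC (IZR q))) with (Im z + 0). lra.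
Qed.

(** By periodicity 0 <= Re z <= 1 may be assumed. One use of the equation at -1/z then suffices,
    since both images lie in the closed right half-plane. For the first this means |z|^2 >= Re z,
    which holds from height 1/2 on because (Re z - 1/2)^2 >= 0; for the second it means Re z <=
    1. *)
Lemma f_high : exists M, 0 <= M /\ forall z, / 2 <= Im z -> hnorm f z <= M.
Proof.
  assert (HE : 0 < E) by apply exp_pos.
  exists (K + E * (K + E * K)). split.
  { assert (0 <= E * K) by nra. nra. }
  assert (Red : forall z, / 2 <= Im z -> 0 <= Re z <= 1 -> hnorm f z <= K + E * (K + E * K)).
  { intros z Hy Hx. assert (Hy0 : 0 < Im z) by lra.
    assert (N := upper_neq_0 z Hy0). assert (M := upper_Cmod z Hy0).
    assert (P : 0 < Rpower (Im z) sg) by apply exp_pos.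
    assert (H1 := hnorm_right z Hy0 ltac:(lra)).
    set (v := J z). assert (Hv : 0 < Im v) by now apply Im_J_pos.
    assert (Hv1 : 0 < Im (v + 1)) by (change (Im (v + 1)) with (Im v + 0); lra).
    assert (Nv1 := upper_neq_0 _ Hv1).
    assert (Q := Cmod_sqr z).
    assert (R1 : 0 <= Re (v + 1)).
    { change (Re (v + 1)) with (Re v + 1). unfold v. rewrite Re_J by auto.
      replace (- Re z / (Cmod z * Cmod z) + 1)
        with ((Cmod z * Cmod z - Re z) / (Cmod z * Cmod z)) by (field; lra).
      apply Rdiv_le_0_compat; [|nra]. rewrite Q.
      assert (/ 4 <= Im z * Im z) by nra.
      generalize (Rle_0_sqr (Re z - / 2)). unfold Rsqr. lra. }
    assert (Iv : Im (v / (v + 1)) = Im v / (Cmod (v + 1) * Cmod (v + 1))).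
    { rewrite Im_div by auto. f_equal.
      change (Re (v + 1)) with (Re v + 1). change (Im (v + 1)) with (Im v + 0). ring. }
    assert (Mv1 := upper_Cmod _ Hv1).
    assert (Hv2 : 0 < Im (v / (v + 1))) by (rewrite Iv; apply Rdiv_lt_0_compat; nra).
    assert (R2 : 0 <= Re (v / (v + 1))).
    { rewrite Re_div by auto. apply Rdiv_le_0_compat; [|nra].
      change (Re (v + 1)) with (Re v + 1). change (Im (v + 1)) with (Im v + 0).
      unfold v. rewrite Re_J, Im_J by auto.
      set (m := Cmod z * Cmod z) in *. assert (Hm : 0 < m) by (unfold m; nra).
      replace (- Re z / m * (- Re z / m + 1) + Im z / m * (Im z / m + 0))
        with ((Re z * Re z + Im z * Im z - Re z * m) / (m * m)) by (field; lra).
      rewrite <- Q. apply Rdiv_le_0_compat; [|nra].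
      replace (m - Re z * m) with (m * (1 - Re z)) by ring. apply Rmult_le_pos; lra. }
    assert (H2 := hnorm_right _ Hv1 R1). assert (H3 := hnorm_right _ Hv2 R2).
    unfold hnorm in H2, H3. rewrite Iv, Rpower_div_sqr in H3 by auto.
    change (Im (v + 1)) with (Im v + 0) in H2. rewrite Rplus_0_r in H2.
    assert (H4 : hnorm Phi v <= K + E * K).
    { unfold hnorm. rewrite (Heq v Hv). fold w.
      assert (Pv : 0 < Rpower (Im v) sg) by apply exp_pos.
      apply Rle_trans with (Rpower (Im v) sg * (Cmod (Phi (v + 1)%C) +
        E * Rpower (Cmod (v + 1)) (- (2 * sg)) * Cmod (Phi (v / (v + 1))%C))).
      - apply Rmult_le_compat_l; [lra|]. eapply Rle_trans; [apply Cmod_triangle|].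
        apply Rplus_le_compat_l. rewrite Cmod_mult.
        apply Rmult_le_compat_r; [apply Cmod_ge_0|apply Cmod_Cpow_E].
      - assert (E * (Rpower (Im v) sg * Rpower (Cmod (v + 1)) (- (2 * sg)) *
          Cmod (Phi (v / (v + 1))%C)) <= E * K) by (apply Rmult_le_compat_l; lra). lra. }
    unfold v in H4. rewrite hnorm_J in H4 by auto.
    unfold hnorm, f.
    apply Rle_trans with (Rpower (Im z) sg * (Cmod (Phi z) +
      E * Rpower (Cmod z) (- (2 * sg)) * Cmod (Phi (J z)))).
    - apply Rmult_le_compat_l; [lra|]. eapply Rle_trans; [apply Cmod_triangle|].
      apply Rplus_le_compat_l. rewrite Cmod_mult.
      apply Rmult_le_compat_r; [apply Cmod_ge_0|apply Cmod_Cpow_E].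
    - unfold hnorm in H1.
      assert (E * (Rpower (Im z) sg * Rpower (Cmod z) (- (2 * sg)) * Cmod (Phi (J z))) <=
        E * (K + E * K)) by (apply Rmult_le_compat_l; lra). lra. }
  intros z Hy. destruct (base_Int_part (Re z)) as [I1 I2].
  set (q := Int_part (Re z)) in *.
  assert (F := f_period_Z z (- q) ltac:(lra)). rewrite opp_IZR in F.
  set (v := (z + RtoC (- IZR q))%C) in *.
  assert (Iv : Im v = Im z) by (unfold v; simpl; unfold Im; ring).
  assert (Rv : Re v = Re z - IZR q) by (unfold v; simpl; unfold Re; ring).
  assert (H := Red v ltac:(lra) ltac:(lra)). unfold hnorm in *. now rewrite F, Iv in H.
Qed.

Lemma Cpow_small_angle (z : C) (e : R) : 0 < Im z -> 0 <= Re z -> Rabs e <= t ->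
  exp (e * Carg z) <= exp (2 * t * (Im z / Cmod z)).
Proof.
  intros Hy Hx He. apply exp_le. eapply Rle_trans; [apply Rle_abs|].
  rewrite Rabs_mult. assert (A := Carg_small z Hx Hy).
  generalize (Rabs_pos e) (Rabs_pos (Carg z)). nra.
Qed.

(** If z^(-2s) and (-1/z)^(-2s) were inverse to each other, [f z] would be z^(-2s) times [f (J z)].
    The defect multiplies [Phi] at z or at -1/z, and can be placed at whichever of the two lies in
    the right half-plane, where [Phi] is already estimated. *)
Lemma f_step : exists A, 0 <= A /\ forall z, 0 < Im z -> - / 2 <= Re z <= / 2 -> Im z < / 2 ->
  hnorm f z <= exp (2 * t * (Im z / Cmod z)) * hnorm f (J z) + A * Rpower (Im z) sg.
Proof.
  assert (HE : 0 < E) by apply exp_pos.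
  exists ((1 + E * E) * K + 2 * E * K). split.
  { assert (0 <= E * K) by nra. assert (0 <= E * E * K) by nra. nra. }
  intros z Hy Hx Hy2. assert (M := upper_Cmod z Hy). assert (Q := Cmod_sqr z).
  assert (M1 : Cmod z <= 1) by nra.
  assert (Hv := Im_J_pos z Hy). assert (Mv := Cmod_J z Hy).
  rewrite hnorm_J by auto. unfold hnorm.
  set (v := J z) in *. set (P := Rpower (Im z) sg).
  assert (HP : 0 < P) by apply exp_pos.
  set (N := Rpower (Cmod z) (- (2 * sg))). assert (HN : 0 < N) by apply exp_pos.
  set (X := exp (2 * t * (Im z / Cmod z))).
  assert (EJ : J v = z) by (apply J_J; auto).
  assert (Nv : Rpower (Cmod v) (- (2 * sg)) = / N).
  { unfold N. rewrite Mv. unfold Rpower. rewrite ln_Rinv, <- exp_Ropp by auto. f_equal. ring. }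
  assert (Cz := Cmod_Cpow_E z). fold N in Cz.
  assert (Cv := Cmod_Cpow_E v). rewrite Nv in Cv.
  assert (HNi : 0 < / N) by now apply Rinv_0_lt_compat.
  destruct (Rle_dec 0 (Re z)) as [Hr|Hr].
  - assert (F : f z = (Cpow_principal z w * f v +
      (1 - Cpow_principal z w * Cpow_principal v w) * Phi z)%C).
    { unfold f. rewrite EJ. fold v. ring. }
    assert (B1 : Cmod (Cpow_principal z w) <= N * X).
    { rewrite Cmod_Cpow. replace (Re w) with (- (2 * sg)) by (symmetry; apply Re_minus_2s).
      fold N. apply Rmult_le_compat_l; [lra|]. apply Cpow_small_angle; auto.
      rewrite Rabs_Ropp. unfold t. lra. }
    assert (B2 : Cmod (1 - Cpow_principal z w * Cpow_principal v w) <= 1 + E * E).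
    { eapply Rle_trans; [apply Cmod_triangle|]. rewrite Cmod_opp, Cmod_1, Cmod_mult.
      apply Rplus_le_compat_l.
      replace (E * E) with ((E * N) * (E * / N)) by (field; lra).
      apply Rmult_le_compat; auto; apply Cmod_ge_0. }
    assert (B3 := Hsmall z Hy Hr M1).
    assert (B4 : Cmod (f z) <= N * X * Cmod (f v) + (1 + E * E) * K).
    { rewrite F. eapply Rle_trans; [apply Cmod_triangle|]. rewrite !Cmod_mult.
      apply Rplus_le_compat.
      - apply Rmult_le_compat_r; [apply Cmod_ge_0|auto].
      - apply Rmult_le_compat; auto; apply Cmod_ge_0. }
    assert (0 <= E * K) by nra.
    apply Rle_trans with (P * (N * X * Cmod (f v) + (1 + E * E) * K)); [nra|]. nra.
  (* For Re z < 0 the transition factor is taken as the inverse of (-1/z)^(-2s), because the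
     small-angle estimate is available at -1/z; the ratio of imaginary part to modulus is the same
     at both points. *)
  - assert (Hrv : 0 <= Re v).
    { unfold v. rewrite Re_J by auto. apply Rdiv_le_0_compat; nra. }
    assert (Cn := Cpow_neq_0 v w).
    assert (F : f z = (/ Cpow_principal v w * f v +
      (Cpow_principal z w - / Cpow_principal v w) * Phi v)%C).
    { unfold f. rewrite EJ. fold v. field. auto. }
    assert (Mi : Cmod (/ Cpow_principal v w) = N * exp (Im w * Carg v)).
    { rewrite Cmod_inv, Cmod_Cpow by auto.
      replace (Re w) with (- (2 * sg)) by (symmetry; apply Re_minus_2s).
      rewrite Nv, Rinv_mult, Rinv_inv, <- exp_Ropp. do 2 f_equal. ring. }
    assert (Rat : Im v / Cmod v = Im z / Cmod z).
    { unfold v. rewrite Im_J, Cmod_J by auto. field. lra. }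
    assert (B1 : Cmod (/ Cpow_principal v w) <= N * X).
    { rewrite Mi. apply Rmult_le_compat_l; [lra|]. unfold X. rewrite <- Rat.
      apply Cpow_small_angle; auto. unfold t. lra. }
    assert (B1' : Cmod (/ Cpow_principal v w) <= E * N).
    { rewrite Mi, Rmult_comm. apply Rmult_le_compat_r; [lra|]. apply exp_le.
      eapply Rle_trans; [apply Rle_abs|]. rewrite Rabs_mult. fold t.
      generalize (Carg_bound v) (Rabs_pos (Im w)). fold t. nra. }
    assert (B3 : Cmod (Phi v) <= K * / N).
    { rewrite <- Nv. apply Hbig; auto. rewrite Mv, <- Rinv_1.
      apply Rinv_le_contravar; lra. }
    assert (B4 : Cmod (f z) <= N * X * Cmod (f v) + 2 * E * K).
    { rewrite F. eapply Rle_trans; [apply Cmod_triangle|]. rewrite !Cmod_mult.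
      apply Rplus_le_compat.
      - apply Rmult_le_compat_r; [apply Cmod_ge_0|auto].
      - replace (2 * E * K) with ((2 * E * N) * (K * / N)) by (field; lra).
        apply Rmult_le_compat; auto; try apply Cmod_ge_0.
        eapply Rle_trans; [apply Cmod_triangle|]. rewrite Cmod_opp. lra. }
    assert (0 <= (1 + E * E) * K) by nra.
    apply Rle_trans with (P * (N * X * Cmod (f v) + 2 * E * K)); [nra|]. nra.
Qed.

(* The heights [Im z] at least double at each step [z -> -1/z] after a
   translation to [|Re z| <= 1/2], so the errors of [f_step] sum like a
   geometric series; the factor [exp (- A (Im z)^mu)] does the bookkeeping. *)
Lemma f_bounded : exists Q, 0 <= Q /\ forall z, 0 < Im z -> hnorm f z <= Q.
Proof.
  destruct f_high as [M0 [HM0 Hhigh]]. destruct f_step as [C0 [HC0 Hstep]].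
  assert (Hsg : 0 < sg) by exact Hs.
  (* One exponent for both errors: y^sigma <= y^mu, and y/|z| <= y^(1/2) <= y^mu because (y/|z|)^2 =
     y Im(-1/z), used only when Im(-1/z) < 1/2. *)
  set (mu := Rmin sg (/ 2)).
  assert (Hmu : 0 < mu) by (apply Rmin_glb_lt; lra).
  assert (Hmu1 : mu <= sg) by apply Rmin_l.
  assert (Hmu2 : mu <= / 2) by apply Rmin_r.
  assert (Ht : 0 <= t) by apply Rabs_pos.
  assert (H2 : 1 < Rpower 2 mu).
  { rewrite <- (Rpower_O 2) by lra. apply Rpower_lt; lra. }
  (* With this [A] the cost (2 t + C0) y^mu of a step is A (2^mu - 1) y^mu, which is at most the
     gain A ((Im v)^mu - y^mu) since Im v >= 2 y. *)
  set (A := (2 * t + C0) / (Rpower 2 mu - 1)).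
  assert (HA : 0 <= A) by (apply Rdiv_le_0_compat; lra).
  set (B := exp (2 * t) * M0 + C0 + 1).
  assert (HB : 1 <= B).
  { assert (0 <= exp (2 * t) * M0) by (apply Rmult_le_pos; [left; apply exp_pos|auto]).
    unfold B. lra. }
  set (Q := B * exp A).
  assert (HQ : 0 < Q) by (apply Rmult_lt_0_compat; [lra|apply exp_pos]).
  (* Adding 1 to the norm lets the additive error be absorbed into the factor exp(C0 y^mu). The
     index [n] bounds the number of doublings before height 1/2; for n = 0 the assumptions are
     contradictory. *)
  assert (Ind : forall n z, (/ 2) ^ n <= Im z -> Im z < / 2 ->
    hnorm f z + 1 <= Q * exp (- (A * Rpower (Im z) mu))).
  { induction n as [|n IH]; intros z0 Hn Hz0; [simpl in Hn; lra|].
    assert (Hpn : 0 < (/ 2) ^ n) by (apply pow_lt; lra).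
    simpl in Hn. assert (Hy0 : 0 < Im z0) by lra.
    destruct (base_Int_part (Re z0 + / 2)) as [I1 I2].
    set (q := Int_part (Re z0 + / 2)) in *.
    assert (F := f_period_Z z0 (- q) Hy0). rewrite opp_IZR in F.
    set (z := (z0 + RtoC (- IZR q))%C) in *.
    assert (Iz : Im z = Im z0) by (unfold z; simpl; unfold Im; ring).
    assert (Rz : Re z = Re z0 - IZR q) by (unfold z; simpl; unfold Re; ring).
    assert (Eh : hnorm f z0 = hnorm f z) by (unfold hnorm; now rewrite F, Iz).
    assert (Hx : - / 2 <= Re z <= / 2) by lra.
    rewrite Eh. rewrite <- Iz in *. clearbody z. clear Eh F Iz I1 I2 Rz.
    assert (M := upper_Cmod z Hy0). assert (Sq := Cmod_sqr z).
    assert (Hst := Hstep z Hy0 Hx Hz0).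
    set (y := Im z) in *. set (v := J z) in *.
    assert (Iv : Im v = y / (Cmod z * Cmod z)) by now apply Im_J.
    (* In the strip |Re z| <= 1/2 below height 1/2, |z|^2 is at most 1/4 + 1/4; hence the doubling
       of the height. *)
    assert (Hm2 : Cmod z * Cmod z <= / 2) by
      (rewrite Sq; assert (Re z * Re z <= / 4) by nra; assert (y * y <= / 4) by nra; lra).
    assert (Hmm : 0 < Cmod z * Cmod z) by nra.
    assert (Iv2 : 2 * y <= Im v).
    { rewrite Iv. apply Rmult_le_reg_r with (Cmod z * Cmod z); [lra|].
      replace (y / (Cmod z * Cmod z) * (Cmod z * Cmod z)) with y by (field; lra).
      apply Rle_trans with (2 * y * / 2); [apply Rmult_le_compat_l; lra|lra]. }
    assert (Ym : Rpower y mu <= 1) by (apply Rpower_le_1; lra).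
    assert (Ysg : Rpower y sg <= Rpower y mu) by (apply Rpower_base_le_1; lra).
    assert (Yp : 0 < Rpower y mu) by apply exp_pos.
    assert (Ysp : 0 < Rpower y sg) by apply exp_pos.
    assert (Hv0 : 0 <= hnorm f v).
    { apply Rmult_le_pos; [left; apply exp_pos|apply Cmod_ge_0]. }
    assert (Yr : 0 <= y / Cmod z <= 1).
    { split; [apply Rdiv_le_0_compat; lra|]. apply Rle_div_l; [lra|].
      generalize (Rabs_Im_le z). fold y. rewrite Rabs_pos_eq; lra. }
    destruct (Rle_dec (/ 2) (Im v)) as [Hv|Hv].
    - assert (L : hnorm f z + 1 <= B).
      { assert (K1 := Hhigh v Hv).
        assert (K2 : exp (2 * t * (y / Cmod z)) <= exp (2 * t)) by (apply exp_le; nra).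
        assert (exp (2 * t * (y / Cmod z)) * hnorm f v <= exp (2 * t) * M0).
        { apply Rmult_le_compat; auto. left; apply exp_pos. }
        assert (C0 * Rpower y sg <= C0 * 1) by (apply Rmult_le_compat_l; lra).
        unfold B. lra. }
      eapply Rle_trans; [exact L|]. unfold Q. rewrite Rmult_assoc, <- exp_plus.
      rewrite <- (Rmult_1_r B) at 1. apply Rmult_le_compat_l; [lra|].
      rewrite <- exp_0. apply exp_le. nra.
    - assert (IHv := IH v ltac:(lra) ltac:(lra)).
      assert (Yq : y / Cmod z <= Rpower y mu).
      { apply Rle_trans with (Rpower y (/ 2)); [|apply Rpower_base_le_1; lra].
        rewrite Rpower_sqrt by lra. apply Rsqr_incr_0; [|lra|apply sqrt_pos].
        rewrite Rsqr_sqrt by lra. unfold Rsqr.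
        replace (y / Cmod z * (y / Cmod z)) with (y * Im v) by (rewrite Iv; field; lra).
        nra. }
      assert (Vm : Rpower 2 mu * Rpower y mu <= Rpower (Im v) mu).
      { rewrite Rpower_mult_distr by lra. apply Rle_Rpower_l; lra. }
      set (Y := Rpower y mu) in *.
      assert (S1 : hnorm f z + 1 <= exp (2 * t * Y) * hnorm f v + C0 * Y + 1).
      { assert (exp (2 * t * (y / Cmod z)) <= exp (2 * t * Y)) by (apply exp_le; nra).
        assert (exp (2 * t * (y / Cmod z)) * hnorm f v <= exp (2 * t * Y) * hnorm f v)
          by (apply Rmult_le_compat_r; auto).
        assert (C0 * Rpower y sg <= C0 * Y) by (apply Rmult_le_compat_l; auto).
        lra. }
      assert (S2 : exp (2 * t * Y) * hnorm f v + C0 * Y + 1 <=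
        exp ((2 * t + C0) * Y) * (hnorm f v + 1)).
      { rewrite Rmult_plus_distr_r, exp_plus.
        assert (X1 : 1 <= exp (2 * t * Y)) by (rewrite <- exp_0; apply exp_le; nra).
        assert (X2 : 1 + C0 * Y <= exp (C0 * Y)) by apply exp_ineq1_le.
        assert (X3 : 0 <= C0 * Y) by nra.
        set (a := exp (2 * t * Y)) in *. set (b := exp (C0 * Y)) in *.
        set (hv := hnorm f v) in *.
        assert (a * (1 + C0 * Y) * (hv + 1) <= a * b * (hv + 1)).
        { apply Rmult_le_compat_r; [lra|]. apply Rmult_le_compat_l; lra. }
        assert (0 <= a * (C0 * Y) * hv) by (apply Rmult_le_pos; [apply Rmult_le_pos|]; lra).
        assert (C0 * Y <= a * (C0 * Y)) by nra.
        lra. }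
      eapply Rle_trans; [exact S1|]. eapply Rle_trans; [exact S2|].
      apply Rle_trans with (exp ((2 * t + C0) * Y) * (Q * exp (- (A * Rpower (Im v) mu)))).
      { apply Rmult_le_compat_l; [left; apply exp_pos|auto]. }
      rewrite (Rmult_comm Q), <- Rmult_assoc, <- exp_plus, (Rmult_comm Q).
      apply Rmult_le_compat_r; [lra|]. apply exp_le.
      assert (EA : 2 * t + C0 = A * (Rpower 2 mu - 1)) by (unfold A; field; lra).
      rewrite EA.
      assert (A * (Rpower 2 mu * Y) <= A * Rpower (Im v) mu) by (apply Rmult_le_compat_l; auto).
      lra. }
  exists (Rmax M0 Q). split; [eapply Rle_trans; [|apply Rmax_l]; auto|].
  intros z Hy. destruct (Rle_dec (/ 2) (Im z)) as [H|H].
  - eapply Rle_trans; [now apply Hhigh|apply Rmax_l].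
  - eapply Rle_trans; [|apply Rmax_r].
    destruct (pow_lt_1_zero (/ 2) ltac:(rewrite Rabs_pos_eq; lra) (Im z) Hy) as [n Hn].
    specialize (Hn n (Nat.le_refl _)). rewrite Rabs_pos_eq in Hn by (apply pow_le; lra).
    assert (L := Ind n z ltac:(lra) ltac:(lra)).
    assert (exp (- (A * Rpower (Im z) mu)) <= 1).
    { rewrite <- exp_0. apply exp_le.
      assert (0 < Rpower (Im z) mu) by apply exp_pos. nra. }
    nra.
Qed.

(** For Re z < 0 the point -1/z has positive real part, so both terms of Phi z = f z - z^(-2s)
    Phi(-1/z) are controlled in the weighted norm; dividing by the weight gives the exponent
    -sigma. *)
Lemma left_half_plane_bound : exists K', 0 <= K' /\ forall z, 0 < Im z -> Re z < 0 ->
  Cmod (Phi z) <= K' * Rpower (Im z) (- sg).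
Proof.
  destruct f_bounded as [Q [HQ Hf]].
  assert (HE : 0 < E) by apply exp_pos.
  exists (Q + E * K). split; [nra|]. intros z Hy Hx.
  assert (M := upper_Cmod z Hy).
  assert (H1 := Hf z Hy).
  assert (H2 := hnorm_right (J z) (Im_J_pos z Hy)
    ltac:(rewrite Re_J by auto; apply Rdiv_le_0_compat; nra)).
  rewrite hnorm_J in H2 by auto. unfold hnorm in H1.
  set (P := Rpower (Im z) sg) in *. assert (HP : 0 < P) by apply exp_pos.
  rewrite Rpower_Ropp. fold P.
  apply Rmult_le_reg_l with P; auto.
  replace (P * ((Q + E * K) * / P)) with (Q + E * K) by (field; lra).
  replace (Phi z) with (f z - Cpow_principal z w * Phi (J z))%C by (unfold f; ring).
  apply Rle_trans with (P * (Cmod (f z) +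
    E * Rpower (Cmod z) (- (2 * sg)) * Cmod (Phi (J z)))).
  - apply Rmult_le_compat_l; [lra|]. eapply Rle_trans; [apply Cmod_triangle|].
    apply Rplus_le_compat_l. rewrite Cmod_opp, Cmod_mult.
    apply Rmult_le_compat_r; [apply Cmod_ge_0|apply Cmod_Cpow_E].
  - assert (E * (P * Rpower (Cmod z) (- (2 * sg)) * Cmod (Phi (J z))) <= E * K)
      by (apply Rmult_le_compat_l; lra). lra.
Qed.

End LeftHalfPlane.

(** * The involution [x -> 1/x] and the extension of [psi] *)

Lemma Cpower_pos_mult (x y : R) (w : C) : 0 < x -> 0 < y ->
  (Cpower_pos x w * Cpower_pos y w)%C = Cpower_pos (x * y) w.
Proof.
  intros Hx Hy. unfold Cpower_pos. rewrite <- Cexp_plus, ln_mult by auto.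
  f_equal. rewrite RtoC_plus. ring.
Qed.

Definition inverted (s : C) (psi : R -> C) (x : R) : C :=
  (Cpower_pos x (- (RtoC 2 * s)) * psi (/ x)%R)%C.

(** In the equation at 1/x the two terms exchange roles: 1/x + 1 is the inverse of x/(x + 1), and
    (1/x)/(1/x + 1) is the inverse of x + 1. *)
Lemma inverted_three_term (s : C) (psi : R -> C) :
  (forall x : R, 0 < x -> psi x = (psi (x + 1)%R
     + Cpower_pos (x + 1) (- (RtoC 2 * s)) * psi (x / (x + 1))%R)%C) ->
  forall x : R, 0 < x -> inverted s psi x = (inverted s psi (x + 1)%R
     + Cpower_pos (x + 1) (- (RtoC 2 * s)) * inverted s psi (x / (x + 1))%R)%C.
Proof.
  intros H x Hx. unfold inverted. set (w := (- (RtoC 2 * s))%C).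
  assert (Hi : 0 < / x) by now apply Rinv_0_lt_compat.
  assert (Hq : 0 < x / (x + 1)) by (apply Rdiv_lt_0_compat; lra).
  rewrite (H (/ x) Hi). fold w.
  replace (/ x / (/ x + 1)) with (/ (x + 1)) by (field; lra).
  replace (/ (x / (x + 1))) with (/ x + 1) by (field; lra).
  rewrite (Cmult_assoc (Cpower_pos (x + 1) w)), Cpower_pos_mult by lra.
  replace ((x + 1) * (x / (x + 1))) with x by (field; lra).
  replace (Cpower_pos (x + 1) w) with (Cpower_pos x w * Cpower_pos (/ x + 1) w)%C; [ring|].
  rewrite Cpower_pos_mult by lra. f_equal. field. lra.
Qed.

(** The exponents match because -2 sigma + min(2 sigma, 1) = min(0, 1 - 2 sigma): the growth
    hypothesis at 0 becomes exactly the one at infinity. *)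
Lemma inverted_growth (s : C) (psi : R -> C) :
  (forall eps : R, 0 < eps -> exists d : R, 0 < d /\ forall x : R, 0 < x < d ->
     Cmod (psi x) <= eps * Rpower x (- Rmin (2 * Re s) 1)) ->
  forall eps : R, 0 < eps -> exists X : R, forall x : R, X < x ->
     Cmod (inverted s psi x) <= eps * Rpower x (Rmin 0 (1 - 2 * Re s)).
Proof.
  intros H eps He. destruct (H eps He) as [d [Hd K]]. exists (/ d). intros x Hx.
  assert (Hd' : 0 < / d) by now apply Rinv_0_lt_compat.
  assert (Hi : 0 < / x < d).
  { split; [apply Rinv_0_lt_compat; lra|]. rewrite <- (Rinv_inv d).
    apply Rinv_lt_contravar; [|lra]. apply Rmult_lt_0_compat; lra. }
  unfold inverted. rewrite Cmod_mult, Cmod_Cpower_pos, Re_minus_2s.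
  set (c := 2 * Re s).
  assert (P : 0 < Rpower x (- c)) by apply exp_pos.
  apply Rle_trans with (Rpower x (- c) * (eps * Rpower (/ x) (- Rmin c 1))).
  { apply Rmult_le_compat_l; [lra|now apply K]. }
  right. replace (Rpower (/ x) (- Rmin c 1)) with (Rpower x (Rmin c 1)).
  2:{ unfold Rpower. rewrite ln_Rinv by lra. f_equal. ring. }
  replace (Rmin 0 (1 - c)) with (- c + Rmin c 1).
  - rewrite Rpower_plus. ring.
  - unfold Rmin. destruct (Rle_dec c 1), (Rle_dec 0 (1 - c)); lra.
Qed.

Lemma hol_inverted (s : C) (P : C -> C) (z : C) :
  slit_plane z -> hol P (/ z)%C ->
  hol (fun z => Cpow_principal z (- (RtoC 2 * s)) * P (/ z))%C z.
Proof.
  intros Hz HP. apply hol_mult; [now apply hol_Cpow|].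
  apply (hol_comp P Cinv); auto. now apply hol_inv, slit_plane_neq_0.
Qed.

Lemma inverted_inverted (s : C) (psi : R -> C) (x : R) : 0 < x ->
  (Cpower_pos x (- (RtoC 2 * s)) * inverted s psi (/ x)%R)%C = psi x.
Proof.
  intros Hx. unfold inverted. rewrite Rinv_inv, Cmult_assoc, Cpower_pos_mult
    by (auto; now apply Rinv_0_lt_compat).
  rewrite Rinv_r by lra. unfold Cpower_pos. rewrite ln_1, Cmult_0_r, Cexp_0. ring.
Qed.

Lemma half_plane_identity (R1 : R) (F G : C -> C) :
  (forall z, R1 < Re z -> hol F z) -> (forall z, R1 < Re z -> hol G z) ->
  (forall x : R, R1 < x -> F (RtoC x) = G (RtoC x)) ->
  forall z, R1 < Re z -> F z = G z.
Proof.
  intros HF HG HFG.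
  apply (identity_from_reals (fun z => R1 < Re z) F G (R1 + 1) 1); auto; [| |lra|].
  - intros z Hz. exists (Re z - R1). split; [lra|]. intros v Hv. unfold disc in Hv.
    assert (K := Rabs_Re_le (v - z)). change (Re (v - z)) with (Re v - Re z) in K.
    apply Rabs_le_between in K. lra.
  - intros z t Hz Ht.
    replace (Re (RtoC (R1 + 1) + RtoC t * (z - RtoC (R1 + 1))))
      with ((1 - t) * (R1 + 1) + t * Re z) by (destruct z; simpl; ring).
    destruct (Req_dec t 0) as [->|]; [lra|]. nra.
  - intros x Hx. apply HFG. apply Rabs_lt_between in Hx. lra.
Qed.

Lemma compact_uniform_radius (psi : R -> C) (a b : R) :
  0 < a -> real_analytic_on (fun x : R => 0 < x) psi ->
  exists d, 0 < d /\ forall x, a <= x <= b -> exists P : C -> C,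
    (forall z, disc (RtoC x) d z -> hol P z) /\
    (forall y : R, Rabs (y - x) < d -> P (RtoC y) = psi y).
Proof.
  intros Ha H.
  (* The gauge is half of an admissible radius, so a disc of radius at most [r t] about a point
     within [r t] of [t] still lies in the domain of the extension at [t]. *)
  destruct (choice (fun (x : R) (r : posreal) => 0 < x -> exists P : C -> C,
    (forall z, disc (RtoC x) (2 * r) z -> hol P z) /\
    (forall y : R, Rabs (y - x) < 2 * r -> P (RtoC y) = psi y))) as [r Hr].
  { intros x. destruct (excluded_middle_informative (0 < x)) as [Hx|Hx].
    - destruct (real_analytic_extension _ psi x H Hx) as [P [r [Hr [H1 H2]]]].
      assert (Hr2 : 0 < r / 2) by lra. exists (mkposreal _ Hr2). intros _. exists P.
      simpl. replace (2 * (r / 2)) with r by field. auto.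
    - exists (mkposreal 1 Rlt_0_1). tauto. }
  destruct (compactness_value_1d a b r) as [d Hd].
  exists d. split; [apply cond_pos|]. intros x Hx. apply NNPP. intros N.
  apply (Hd x Hx). intros [t [Ht [D1 D2]]]. apply N.
  destruct (Hr t) as [P [H1 H2]]; [lra|]. exists P. split.
  - intros z Hz. apply H1. unfold disc in *.
    eapply Rle_lt_trans; [apply (Cmod_triangle3 z (RtoC x))|].
    rewrite <- RtoC_minus, Cmod_R. lra.
  - intros y Hy. apply H2. replace (y - t) with ((y - x) + (x - t)) by ring.
    eapply Rle_lt_trans; [apply Rabs_triang|]. lra.
Qed.

Lemma inv_near_1 (z : C) (r : R) :
  Cmod (z - 1) < Rmin (/ 2) (r / 2) -> 0 < Re z /\ Cmod (/ z - 1) < r.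
Proof.
  intros H. assert (H1 := Rlt_le_trans _ _ _ H (Rmin_l _ _)).
  assert (H2 := Rlt_le_trans _ _ _ H (Rmin_r _ _)).
  assert (K := Rabs_Re_le (z - 1)). change (Re (z - 1)) with (Re z - 1) in K.
  apply Rabs_le_between in K.
  assert (Hr : 0 < Re z) by lra. split; auto.
  assert (N : z <> 0) by now apply slit_plane_neq_0, slit_plane_Re.
  assert (L : / 2 < Cmod z).
  { eapply Rlt_le_trans; [|eapply Rle_trans; [apply Rle_abs|apply Rabs_Re_le]]. lra. }
  replace (/ z - 1)%C with ((1 - z) / z)%C by (field; auto).
  rewrite Cmod_div, Cmod_minus_sym by auto.
  apply Rmult_lt_reg_r with (Cmod z); [lra|].
  replace (Cmod (z - 1) / Cmod z * Cmod z) with (Cmod (z - 1)) by (field; lra).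
  assert (0 <= Cmod (z - 1)) by apply Cmod_ge_0. nra.
Qed.

Section Extension.
Variables (s : C) (psi : R -> C).
Let w : C := (- (RtoC 2 * s))%C.
Hypothesis Hs : 0 < Re s.
Hypothesis Hanalytic : real_analytic_on (fun x : R => 0 < x) psi.
Hypothesis Heq : forall x : R, 0 < x ->
  psi x = (psi (x + 1)%R + Cpower_pos (x + 1) w * psi (x / (x + 1))%R)%C.
Hypothesis Hzero : forall eps : R, 0 < eps -> exists d : R, 0 < d /\
  forall x : R, 0 < x < d -> Cmod (psi x) <= eps * Rpower x (- Rmin (2 * Re s) 1).
Hypothesis Hinfty : forall eps : R, 0 < eps -> exists X : R, forall x : R, X < x ->
  Cmod (psi x) <= eps * Rpower x (Rmin 0 (1 - 2 * Re s)).

(** The decay of the inverted function is kept in the conclusion because it turns into the bound for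
    [Psi] near 0. *)
Lemma holomorphic_extension : exists (Psi : C -> C) (R1 K : R),
  (forall x : R, 0 < x -> Psi (RtoC x) = psi x) /\
  (forall z, slit_plane z -> hol Psi z) /\ three_term s slit_plane Psi /\
  (forall z, R1 < Re z -> Cmod (Psi z) <= K * Rpower (Cmod z) (- (2 * Re s)) /\
     Cmod (Cpow_principal z w * Psi (/ z)%C) <= K * Rpower (Cmod z) (- (2 * Re s))).
Proof.
  destruct (real_analytic_extension _ psi 1 Hanalytic Rlt_0_1) as [P [r [Hr [HP HPx]]]].
  destruct (half_plane_extension s psi Hs Heq Hinfty P r Hr HP HPx)
    as [G [R1 [K1 [HR1 [HG HGx]]]]].
  destruct (half_plane_extension s (inverted s psi) Hs
    (inverted_three_term s psi Heq) (inverted_growth s psi Hzero)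
    (fun z => Cpow_principal z w * P (/ z))%C (Rmin (/ 2) (r / 2)))
    as [Gt [R2 [K2 [HR2 [HGt HGtx]]]]].
  { apply Rmin_glb_lt; lra. }
  { intros z Hz. destruct (inv_near_1 z r Hz) as [H1 H2].
    apply (hol_inverted s P); [now apply slit_plane_Re|].
    now apply HP. }
  { intros x Hx. destruct (inv_near_1 (RtoC x) r) as [H1 H2].
    { now rewrite <- RtoC_minus, Cmod_R. }
    simpl in H1. rewrite <- RtoC_inv in * by lra. rewrite <- RtoC_minus, Cmod_R in H2.
    rewrite Cpow_RtoC, HPx by auto. reflexivity. }
  (* Discs of radius at most x/2 about x are covered at both ends: for x > 2 R1 they stay in Re z >
     R1, and for x < 1/(5 R2) the real part Re z / |z|^2 of 1/z exceeds (x/2)/(3x/2)^2 = 2/(9x) >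
     R2. Only this compact interval remains. *)
  destruct (compact_uniform_radius psi (/ (5 * R2)) (2 * R1)) as [d [Hd Hmid]]; auto.
  { apply Rinv_0_lt_compat. lra. }
  (* k <= 1/2 serves the two ends, and k x <= d holds for x <= 2 R1 in the middle. *)
  set (k := Rmin (/ 2) (d / (2 * R1))).
  assert (Hk : 0 < k) by (apply Rmin_glb_lt; [lra|apply Rdiv_lt_0_compat; lra]).
  assert (Hk2 : k <= / 2) by apply Rmin_l.
  assert (Hkd : k * (2 * R1) <= d).
  { apply Rle_trans with (d / (2 * R1) * (2 * R1)).
    - apply Rmult_le_compat_r; [lra|apply Rmin_r].
    - right. field. lra. }
  destruct (wedge_gluing psi k Hk) as [F [HF HFx]].
  { intros x Hx.
    assert (Half : forall z, disc (RtoC x) (k * x) z -> x / 2 < Re z /\ Cmod z < 3 / 2 * x).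
    { intros z Hz. unfold disc in Hz.
      assert (k * x <= x / 2) by nra.
      assert (Q := Rabs_Re_le (z - RtoC x)). change (Re (z - RtoC x)) with (Re z - x) in Q.
      apply Rabs_le_between in Q. split; [lra|].
      assert (T := Cmod_rev_triangle z (RtoC x)). rewrite Cmod_R, Rabs_pos_eq in T by lra. lra. }
    assert (HalfR : forall y : R, Rabs (y - x) < k * x -> x / 2 < y < 3 / 2 * x).
    { intros y Hy. apply Rabs_lt_between in Hy. nra. }
    destruct (Rlt_dec (2 * R1) x) as [L1|L1].
    { exists G. split.
      - intros z Hz. destruct (Half z Hz). apply HG. lra.
      - intros y Hy. destruct (HalfR y Hy). apply HGx. lra. }
    destruct (Rlt_dec x (/ (5 * R2))) as [L2|L2].
    { assert (Hx5 : x * (5 * R2) < 1).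
      { apply (Rmult_lt_compat_r (5 * R2)) in L2; [|lra]. now rewrite Rinv_l in L2 by lra. }
      exists (fun z => Cpow_principal z w * Gt (/ z))%C. split.
      - intros z Hz. destruct (Half z Hz) as [H1 H2].
        assert (Sz : slit_plane z) by (apply slit_plane_Re; lra).
        apply (hol_inverted s Gt); auto. apply HGt.
        assert (N := slit_plane_neq_0 z Sz).
        replace (/ z)%C with (1 / z)%C by (field; auto). rewrite Re_div by auto.
        change (Re 1) with 1. change (Im 1) with 0.
        assert (Hm : 0 < Cmod z) by now apply Cmod_gt_0.
        apply Rmult_lt_reg_r with (Cmod z * Cmod z); [nra|].
        replace ((1 * Re z + 0 * Im z) / (Cmod z * Cmod z) * (Cmod z * Cmod z))
          with (Re z) by (field; lra).
        apply Rlt_trans with (R2 * (3 / 2 * x * (3 / 2 * x))).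
        + apply Rmult_lt_compat_l; [lra|]. apply Rmult_le_0_lt_compat; lra.
        + nra.
      - intros y Hy. destruct (HalfR y Hy) as [H1 H2].
        rewrite <- RtoC_inv by lra. rewrite Cpow_RtoC by lra. rewrite HGtx.
        + apply inverted_inverted. lra.
        + apply Rmult_lt_reg_r with y; [lra|]. rewrite Rinv_l by lra. nra. }
    destruct (Hmid x) as [P0 [H1 H2]]; [lra|].
    assert (k * x <= d) by nra.
    exists P0. split.
    - intros z Hz. apply H1. unfold disc in *. lra.
    - intros y Hy. apply H2. lra. }
  assert (HFeq : three_term s (wedge k) F).
  { unfold three_term. apply (identity_from_reals (wedge k) F
      (fun z => F (z + 1) + Cpow_principal (z + 1) (- (RtoC 2 * s)) * F (z / (z + 1)))%C
      1 (/ 2)); auto.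
    - intros z Hz. now apply wedge_open.
    - now apply wedge_star.
    - intros z Hz. apply hol_three_term.
      + now apply (wedge_slit k).
      + now apply HF, wedge_plus_1.
      + now apply HF, wedge_S.
    - lra.
    - intros x Hx. apply Rabs_lt_between in Hx.
      rewrite <- RtoC_plus, <- RtoC_div by lra.
      rewrite Cpow_RtoC by lra.
      rewrite !HFx by (try apply Rdiv_lt_0_compat; lra). apply Heq. lra. }
  destruct (slit_plane_extension s k F Hk HF HFeq) as [Psi [H1 [H2 H3]]].
  assert (HPsi : forall x : R, 0 < x -> Psi (RtoC x) = psi x).
  { intros x Hx. rewrite H3 by now apply wedge_RtoC. now apply HFx. }
  exists Psi, (Rmax R1 R2), (Rmax K1 K2).
  split; [auto|]. split; [auto|]. split; [auto|].
  intros z Hz.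
  assert (Z1 : R1 < Re z) by (eapply Rle_lt_trans; [apply Rmax_l|exact Hz]).
  assert (Z2 : R2 < Re z) by (eapply Rle_lt_trans; [apply Rmax_r|exact Hz]).
  assert (Pz : 0 < Rpower (Cmod z) (- (2 * Re s))) by apply exp_pos.
  split.
  - rewrite (half_plane_identity R1 Psi G); auto.
    + eapply Rle_trans; [now apply HG|]. apply Rmult_le_compat_r; [lra|apply Rmax_l].
    + intros v Hv. apply H1, slit_plane_Re. lra.
    + intros v Hv. now apply HG.
    + intros x Hx. rewrite HPsi, HGx; auto. lra.
  - rewrite (half_plane_identity R2 (fun z => Cpow_principal z w * Psi (/ z))%C Gt); auto.
    + eapply Rle_trans; [now apply HGt|]. apply Rmult_le_compat_r; [lra|apply Rmax_r].
    + intros v Hv. assert (Sv : slit_plane v) by (apply slit_plane_Re; lra).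
      apply (hol_inverted s Psi); auto. now apply H1, slit_plane_inv.
    + intros v Hv. now apply HGt.
    + intros x Hx. rewrite Cpow_RtoC, <- RtoC_inv, HPsi by
        (try apply Rinv_0_lt_compat; lra). rewrite HGtx by auto. reflexivity.
Qed.

End Extension.

Lemma inverted_three_term_slit (s : C) (Psi : C -> C) :
  three_term s slit_plane Psi ->
  three_term s slit_plane (fun z => Cpow_principal z (- (RtoC 2 * s)) * Psi (/ z))%C.
Proof.
  intros H z Hz. set (w := (- (RtoC 2 * s))%C).
  assert (N := slit_plane_neq_0 z Hz). assert (S1 := slit_plane_plus_1 z Hz).
  assert (N1 := slit_plane_neq_0 _ S1).
  assert (Q : (/ z / (/ z + 1))%C = (/ (z + 1))%C).
  { replace (/ z + 1)%C with ((z + 1) / z)%C by (field; auto). field. auto. }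
  assert (I := H (/ z)%C (slit_plane_inv z Hz)). fold w in I.
  rewrite Q in I.
  replace (/ (z / (z + 1)))%C with (/ z + 1)%C by (field; auto).
  rewrite I. rewrite (Cmult_assoc (Cpow_principal (z + 1) w)), Cpow_S by auto.
  assert (E1 := Cpow_S (/ z) w (slit_plane_inv z Hz)).
  rewrite Q in E1.
  assert (E2 := Cpow_inv_mult z w Hz). assert (E3 := Cpow_inv_mult (z + 1) w S1).
  set (a := Cpow_principal z w) in *. set (b := Cpow_principal (z + 1) w) in *.
  set (a' := Cpow_principal (/ z) w) in *. set (b' := Cpow_principal (/ (z + 1)) w) in *.
  set (e := Cpow_principal (/ z + 1) w) in *.
  (* Principal powers are not multiplicative in general; z^w (1/z + 1)^w = (z + 1)^w is derived from
     [Cpow_S] at 1/z and the inversion rule at z and z + 1. *)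
  assert (E : (a * e)%C = b).
  { transitivity (a * e * (b' * b))%C; [rewrite E3; ring|].
    transitivity ((e * b') * a * b)%C; [ring|]. rewrite E1, E2. ring. }
  rewrite <- E. ring.
Qed.

(** The half-angle formula makes [Carg] odd in Im z, so the logarithm commutes with conjugation;
    this carries the estimates to the lower half-plane. *)
Lemma Cpow_conj (z w : C) :
  Cconj (Cpow_principal z w) = Cpow_principal (Cconj z) (Cconj w).
Proof.
  assert (L : Clog (Cconj z) = Cconj (Clog z)).
  { unfold Clog, Carg, Cconj. simpl. fold (Cconj z). rewrite Cmod_conj.
    f_equal. unfold Re, Im. simpl.
    replace (- snd z / (Cmod z + fst z)) with (- (snd z / (Cmod z + fst z)))
      by (unfold Rdiv; ring).
    rewrite atan_opp. ring. }
  unfold Cpow_principal. rewrite L, <- Cmult_conj.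
  set (v := (w * Clog z)%C). unfold Cexp, Cconj. simpl.
  rewrite cos_neg, sin_neg. f_equal. unfold Re, Im. ring.
Qed.

Lemma hol_ex_derive (f : C -> C) (z : C) :
  hol f z -> @ex_derive C_AbsRing C_NormedModule f z.
Proof.
  intros [f' H]. destruct (nbhd_self _ _ H) as [[q [Hq [Cq [d [Hd E]]]]] _].
  exists (f' z). split; [apply is_linear_scal_l|].
  intros x Hx.
  assert (Ex : z = x) by exact (is_filter_lim_locally_unique _ _ Hx). subst x.
  intros e. destruct (Cq e (cond_pos e)) as [d' [Hd' K]].
  exists (mkposreal (Rmin d d') (Rmin_glb_lt _ _ _ Hd Hd')). intros y Hy.
  assert (Hy' : Cmod (y - z) < Rmin d d') by exact Hy.
  assert (Y1 := Rlt_le_trans _ _ _ Hy' (Rmin_l _ _)).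
  assert (Y2 := Rlt_le_trans _ _ _ Hy' (Rmin_r _ _)).
  specialize (E y Y1). specialize (K y Y2). rewrite Hq in K.
  change (Cmod (f y - f z - (y - z) * f' z) <= e * Cmod (y - z)).
  rewrite E. replace (q y * (y - z) - (y - z) * f' z)%C
    with ((q y - f' z) * (y - z))%C by ring.
  rewrite Cmod_mult. apply Rmult_le_compat_r; [apply Cmod_ge_0|lra].
Qed.

Theorem theorem2 (s : C) (psi : R -> C)
  (Hs : 0 < Re s)
  (Hanalytic : real_analytic_on (fun x : R => 0 < x) psi)
  (Hthree_term : forall x : R, 0 < x ->
     psi x = (psi (x + 1)%R
              + Cpower_pos (x + 1) (- (RtoC 2 * s)) * psi (x / (x + 1))%R)%C)
  (Hzero : little_o (at_right 0) psi
             (fun x : R => Rpower x (- Rmin (2 * Re s) 1)))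
  (Hinfty : little_o (Rbar_locally p_infty) psi
             (fun x : R => Rpower x (Rmin 0 (1 - 2 * Re s)))) :
  exists Psi : C -> C,
    (forall x : R, 0 < x -> Psi (RtoC x) = psi x) /\
    holomorphic_on slit_plane Psi /\
    exists K : R, forall z : C, slit_plane z ->
      (0 <= Re z -> 1 <= Cmod z ->
         Cmod (Psi z) <= K * Rpower (Cmod z) (- (2 * Re s))) /\
      (0 <= Re z -> Cmod z <= 1 -> Cmod (Psi z) <= K * 1) /\
      (Re z < 0 ->
         Cmod (Psi z) <= K * Rpower (Rabs (Im z)) (- Re s)).
Proof.
  assert (Habs : forall x a, Rabs (Rpower x a) = Rpower x a).
  { intros. apply Rabs_pos_eq. left. apply exp_pos. }
  destruct (holomorphic_extension s psi Hs Hanalytic Hthree_term)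
    as [Psi [R1 [K0 [HPsi [Hhol [Heq HR1]]]]]].
  { intros e He. destruct (Hzero (mkposreal e He)) as [d Hd].
    exists d. split; [apply cond_pos|]. intros x Hx.
    assert (B : ball 0 d x).
    { change (Rabs (x - 0) < d). rewrite Rminus_0_r, Rabs_pos_eq; lra. }
    specialize (Hd x B (proj1 Hx)).
    change (@norm R_AbsRing C_R_NormedModule (psi x) <= e * Rabs (Rpower x (- Rmin (2 * Re s) 1))) in Hd.
    rewrite Habs in Hd. now rewrite Cmod_norm. }
  { intros e He. destruct (Hinfty (mkposreal e He)) as [X HX].
    exists X. intros x Hx. specialize (HX x Hx).
    change (@norm R_AbsRing C_R_NormedModule (psi x) <= e * Rabs (Rpower x (Rmin 0 (1 - 2 * Re s)))) in HX.
    rewrite Habs in HX. now rewrite Cmod_norm. }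
  exists Psi. split; [auto|]. split; [intros z Hz; now apply hol_ex_derive, Hhol|].
  set (w := (- (RtoC 2 * s))%C) in *.
  destruct (right_half_plane_decay s Psi R1 K0 Hs Heq) as [Ka [Ka0 HKa]].
  { intros z Hz. now apply hol_cont, Hhol, slit_plane_Re. }
  { intros z Hz. now apply HR1. }
  (* The bound for |z| <= 1 is the decay of the inverted function at 1/z; multiplying back by
     z^(-2s) cancels the powers of |z| and leaves a constant. *)
  destruct (right_half_plane_decay s (fun z => Cpow_principal z w * Psi (/ z))%C R1 K0 Hs)
    as [Kt [Kt0 HKt]].
  { now apply inverted_three_term_slit. }
  { intros z Hz. assert (Sz := slit_plane_Re z Hz). apply hol_cont.
    apply (hol_inverted s Psi); auto. now apply Hhol, slit_plane_inv. }
  { intros z Hz. now apply HR1. }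
  set (c := 2 * Re s) in *.
  set (E := exp (PI * Rabs (Im w))). assert (HE : 0 < E) by apply exp_pos.
  set (Kb := E * Kt). assert (Kb0 : 0 <= Kb) by (unfold Kb; nra).
  assert (HKb : forall z, slit_plane z -> 0 <= Re z -> Cmod z <= 1 -> Cmod (Psi z) <= Kb).
  { intros z Sz Hx Hm. assert (N := slit_plane_neq_0 z Sz).
    assert (Hm0 : 0 < Cmod z) by now apply Cmod_gt_0.
    assert (Hi : Cmod (/ z) = / Cmod z) by now apply Cmod_inv.
    assert (B := HKt (/ z)%C). rewrite Hi in B.
    assert (EI : (/ / z)%C = z) by (field; auto). rewrite EI in B.
    assert (B1 : Cmod (Cpow_principal (/ z) w * Psi z) <= Kt * Rpower (/ Cmod z) (- c)).
    { apply B.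
      - replace (/ z)%C with (1 / z)%C by (field; auto). rewrite Re_div by auto.
        change (Re 1) with 1. change (Im 1) with 0. apply Rdiv_le_0_compat; nra.
      - rewrite <- Rinv_1. apply Rinv_le_contravar; lra. }
    replace (Psi z) with (Cpow_principal z w * (Cpow_principal (/ z) w * Psi z))%C.
    2:{ transitivity ((Cpow_principal (/ z) w * Cpow_principal z w) * Psi z)%C; [ring|].
        rewrite Cpow_inv_mult by auto. ring. }
    rewrite Cmod_mult.
    assert (B2 := Cmod_Cpow_le z w). fold E in B2. unfold w in B2 at 2.
    rewrite Re_minus_2s in B2. fold c in B2.
    apply Rle_trans with ((E * Rpower (Cmod z) (- c)) * (Kt * Rpower (/ Cmod z) (- c))).
    - apply Rmult_le_compat; auto; apply Cmod_ge_0.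
    - right. replace (Rpower (/ Cmod z) (- c)) with (/ Rpower (Cmod z) (- c)).
      + unfold Kb. field. apply Rgt_not_eq, exp_pos.
      + unfold Rpower. rewrite ln_Rinv, <- exp_Ropp by auto. f_equal. ring. }
  set (Km := Rmax Ka Kb).
  assert (Km1 : Ka <= Km) by apply Rmax_l. assert (Km2 : Kb <= Km) by apply Rmax_r.
  assert (HKa' : forall z, 0 <= Re z -> 1 <= Cmod z -> Cmod (Psi z) <= Km * Rpower (Cmod z) (- c)).
  { intros z Hx Hm. eapply Rle_trans; [now apply HKa|].
    apply Rmult_le_compat_r; [left; apply exp_pos|auto]. }
  destruct (left_half_plane_bound s Psi Km Hs) as [Ku [Ku0 HKu]].
  { intros z Hz. apply Heq, slit_plane_Im. lra. }
  { lra. }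
  { intros z Hy Hx Hm. now apply HKa'. }
  { intros z Hy Hx Hm. eapply Rle_trans; [apply HKb; auto|auto]. apply slit_plane_Im. lra. }
  (* The reflected function conj(Psi(conj z)) satisfies the equation with conj s, which has the same
     real part; its bound above the real axis is the bound for [Psi] below it. *)
  destruct (left_half_plane_bound (Cconj s) (fun z => Cconj (Psi (Cconj z))) Km) as [Kl [Kl0 HKl]].
  { now rewrite re_conj. }
  { intros z Hz.
    assert (Sz : slit_plane (Cconj z)) by (apply slit_plane_Im; rewrite im_conj; lra).
    assert (Sz' : slit_plane z) by (apply slit_plane_Im; lra).
    assert (N1 := slit_plane_neq_0 _ (slit_plane_plus_1 z Sz')).
    rewrite (Heq _ Sz). rewrite Cplus_conj, Cmult_conj, Cpow_conj.
    rewrite Cdiv_conj, Cplus_conj by auto.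
    assert (C1 : Cconj 1 = 1) by (apply C_ext; simpl; ring).
    assert (C2 : Cconj 2 = 2) by (apply C_ext; simpl; ring).
    rewrite C1, Copp_conj, Cmult_conj, C2, Cplus_conj, Cconj_conj, C1. reflexivity. }
  { lra. }
  { intros z Hy Hx Hm. rewrite Cmod_conj, re_conj. rewrite <- (Cmod_conj z).
    apply HKa'; [now rewrite re_conj|now rewrite Cmod_conj]. }
  { intros z Hy Hx Hm. rewrite Cmod_conj. eapply Rle_trans; [apply HKb|auto].
    - apply slit_plane_Im. rewrite im_conj. lra.
    - now rewrite re_conj.
    - now rewrite Cmod_conj. }
  rewrite re_conj in HKl.
  exists (Km + Ku + Kl). intros z Hz. split; [|split].
  - intros Hx Hm. eapply Rle_trans; [now apply HKa'|].
    apply Rmult_le_compat_r; [left; apply exp_pos|lra].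
  - intros Hx Hm. assert (B := HKb z Hz Hx Hm). lra.
  - intros Hx.
    assert (Hy : Im z <> 0) by (intros E0; apply Hz; split; lra).
    assert (P : 0 < Rpower (Rabs (Im z)) (- Re s)) by apply exp_pos.
    destruct (Rlt_dec 0 (Im z)) as [L|L].
    + rewrite Rabs_pos_eq in * by lra. eapply Rle_trans; [now apply HKu|].
      apply Rmult_le_compat_r; lra.
    + assert (B := HKl (Cconj z)). rewrite Cconj_conj, Cmod_conj, im_conj, re_conj in B.
      rewrite Rabs_left1 in * by lra. eapply Rle_trans; [apply B; lra|].
      apply Rmult_le_compat_r; lra.
Qed.
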